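(* Let $X$ be a smooth toric surface associated to an $h$-transverse and horizontal polygon, with Euler characteristic $\chi$ and canonical class $K_X$. For every $g\ge 0$ the asymptotic polynomial $AR^X_{g,1}(\beta)$ giving the degree $1$ coefficient of $\widetilde{BG}^X_g(\beta)$ is a polynomial in $\beta^2$, $K_X\cdot\beta$, $\chi$, $K_X^2$, and the generating series of these polynomials is $$\sum_{g\geq 0} AR_{g,1}^X(\beta)\, u^g = (1+u)^{g_{\max}} \left[-\beta^2 \frac{u^3}{(1+u)^3} +2(K_X\cdot\beta)\frac{u^2}{(1+u)^3} + \chi\frac{1}{1+u} - K_X^2 \frac{u}{(1+u)^3} \right],$$ where $g_{\max}=1+\frac12(\beta^2+\beta\cdot K_X)$. That is: for every $g\ge0$ there is $C>0$ such that for every $\beta\in H_2(X,\mathbb{Z})$ with $\beta\cdot D\ge C$ for all toric divisors $D$, the coefficient of $x^1$ in $\widetilde{BG}^X_g(\beta)(x)$ equals the coefficient of $u^g$ in the right-hand side.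
   Context: **Toric surfaces and polygons.** A convex lattice polygon $\Delta\subset\mathbb{R}^2$ is *$h$-transverse* if every edge has a direction vector of the form $(\pm1,0)$ or $(n,\pm1)$ with $n\in\mathbb{Z}$; it is *horizontal* if it has both a top and a bottom horizontal edge. The toric surface $X$ associated to $\Delta$ has fan whose rays are generated by the primitive outward normal vectors $n_\rho$ of the edges of $\Delta$; $D_\rho$ denotes the corresponding toric divisor. For $\beta\in H_2(X,\mathbb{Z})$ with $\beta\cdot D>0$ for every toric divisor $D$, $\Delta_\beta$ denotes the lattice polygon (up to translation) whose edges have outward normals the $n_\rho$, the edge dual to $\rho$ having integer length $\beta\cdot D_\rho$. The number of interior lattice points of $\Delta_\beta$ is $g_{\max}=1+\frac12(\beta^2+\beta\cdot K_X)$. For an $h$-transverse polygon $\Delta$: $a$ is its height, $b^{\mathrm{top}}$ (resp. $b^{\mathrm{bot}}$) the integer length of its top (resp. bottom) horizontal edge, $b_{\mathrm{left}}$ (resp. $b_{\mathrm{right}}$) is the multiset of integers $k$, each taken with multiplicity the integer length of the side having outward normal vector $(-1,k)$ (resp. $(1,k)$). **Floor diagrams.** An oriented graph has vertices, bounded edges $E^0$ (adjacent to two vertices), sinks $E^{\mathrm{top}}$ (univalent edges oriented outward from a vertex) and sources $E^{\mathrm{bot}}$ (univalent edges oriented into a vertex). With edge weights $w(e)\in\mathbb{Z}_{>0}$, the divergence $\mathrm{div}(v)$ of a vertex is the total weight of incoming edges minus the total weight of outgoing edges. A *floor diagram* $\mathcal{D}$ with Newton polygon $\Delta$ is a connected,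 oriented, acyclic weighted graph with $a$ vertices (floors), $b^{\mathrm{top}}$ sinks and $b^{\mathrm{bot}}$ sources, all sinks and sources having weight $1$, together with bijections $L$, $R$ from the vertices to the multisets $b_{\mathrm{left}}$, $b_{\mathrm{right}}$ such that $\mathrm{div}(v)=L(v)+R(v)$ for all $v$. Its *genus* is the first Betti number of the graph. A *marking* $\mathfrak{m}$ is an increasing bijection (for the partial order induced by the orientation) from the set of all edges and vertices $E(\mathcal{D})\cup V(\mathcal{D})$ to $\{1,\dots,|E(\mathcal{D})\cup V(\mathcal{D})|\}$. Marked floor diagrams are considered up to isomorphisms of weighted oriented graphs preserving $L$, $R$ and the marking. **Refined invariants.** Set $$\overline{BG}^X_g(\beta)(q)=\sum_{(\mathcal{D},\mathfrak{m})}\ \prod_{e\in E^0(\mathcal{D})}(q^{w(e)/2}-q^{-w(e)/2})^2\prod_{e\in E^{\mathrm{top}}(\mathcal{D})\cup E^{\mathrm{bot}}(\mathcal{D})}(q^{1/2}-q^{-1/2}),$$ the sum running over isomorphism classes of marked floor diagrams with Newton polygon $\Delta_\beta$ and genus $g$, and $\widetilde{BG}^X_g(\beta)(x)=x^{\mathrm{Area}(\Delta_\beta)}\,\overline{BG}^X_g(\beta)(1/x)\in\mathbb{Z}[x]$ (Euclidean area). **Asymptotic polynomials.** $AR^X_{g,i}$ denotes the polynomial function on $H_2(X,\mathbb{Z})$ such that the coefficient of $x^i$ in $\widetilde{BG}^X_g(\beta)(x)$ equals $AR^X_{g,i}(\beta)$ whenever $\beta\cdot D$ is large enough (depending on $g$,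 $i$) for every toric divisor $D$. *)

(* Defs.v *)
From HB Require Import structures.
From mathcomp Require Import all_boot all_order all_algebra.
From mathcomp Require Import fraction.
From mathcomp Require Import mpoly.

Set Implicit Arguments.
Unset Strict Implicit.
Unset Printing Implicit Defensive.

Import Order.TTheory GRing.Theory Num.Theory.
Local Open Scope ring_scope.

Definition det (u v : int * int) : int := u.1 * v.2 - u.2 * v.1.

(** * Lattice polygons *)

(* A polygon with n edges is given by its vertices, listed counterclockwise
   and indexed cyclically by 'I_n; the i-th edge joins P i to P (ordS i). *)
Section Polygon.
Variables (n : nat) (P : 'I_n -> int * int).

Definition edge_vec (i : 'I_n) : int * int := P (ordS i) - P i.

(* Every edge has all the vertices other than its ends strictly on its left. *)
Definition convex_polygon : Prop :=
  (3 <= n)%N /\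
  forall i j : 'I_n, j != i -> j != ordS i -> 0 < det (edge_vec i) (P j - P i).

Definition edge_len (i : 'I_n) : nat :=
  gcdn `|(edge_vec i).1|%N `|(edge_vec i).2|%N.

Definition edge_dir (i : 'I_n) : int * int :=
  (((edge_vec i).1 %/ edge_len i)%Z, ((edge_vec i).2 %/ edge_len i)%Z).

(* Primitive outward normal: the direction rotated clockwise, since the
   boundary is oriented counterclockwise. *)
Definition normal (i : 'I_n) : int * int :=
  ((edge_dir i).2, - (edge_dir i).1).

Definition h_transverse : Prop :=
  forall i : 'I_n, [|| edge_dir i == (1, 0), edge_dir i == (-1, 0)
                     | ((edge_dir i).2 == 1) || ((edge_dir i).2 == -1)].

Definition horizontal : Prop :=
  (exists i : 'I_n, normal i = (0, 1)) /\ (exists i : 'I_n, normal i = (0, -1)).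

(* The normals are in cyclic order, so the maximal cones of the fan of X are
   spanned by consecutive normals. *)
Definition smooth_surface : Prop :=
  forall i : 'I_n, det (normal i) (normal (ordS i)) = 1.

Definition height : nat :=
  (\max_(i < n) \max_(j < n) `|((P i).2 - (P j).2)%R|)%N.

Definition btop : nat := (\sum_(i < n | normal i == (0, 1)%R) edge_len i)%N.
Definition bbot : nat := (\sum_(i < n | normal i == (0, -1)%R) edge_len i)%N.

(* Multisets of integers are represented by sequences up to perm_eq. *)
Definition bside (s : int) : seq int :=
  flatten [seq nseq (edge_len i) (normal i).2
          | i <- enum 'I_n & (normal i).1 == s].
Definition bleft : seq int := bside (-1).
Definition bright : seq int := bside 1.

(* Twice the Euclidean area (shoelace formula). *)
Definition double_area : int := \sum_(i < n) det (P i) (P (ordS i)).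

(** * Divisor classes on the smooth toric surface X of P *)

(* For X smooth and complete, H_2(X, Z) is generated by the classes of the
   toric divisors D_i, modulo linear equivalence.  A class is represented by
   the coefficients c of a toric divisor \sum_i c_i D_i. *)
Definition divisor : Type := 'I_n -> int.

Definition lin_equiv (c c' : divisor) : Prop :=
  exists m : int * int,
    forall i, c i - c' i = m.1 * (normal i).1 + m.2 * (normal i).2.

(* D_i ^ 2 = - k, where normal (i - 1) + normal (i + 1) = k * normal i; taking
   the determinant with normal (i - 1) gives the value of k used here. *)
Definition inter (i j : 'I_n) : int :=
  if i == j then - det (normal (ord_pred i)) (normal (ordS i))
  else ((j == ordS i) || (i == ordS j))%:R.

Definition dot (c c' : divisor) : int :=
  \sum_(i < n) \sum_(j < n) c i * c' j * inter i j.

Definition toric_divisor (i : 'I_n) : divisor := fun j => (j == i)%:R.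

Definition canonical : divisor := fun _ => -1.

Definition euler_char : int := n%:Z.

(* The polygon Delta_beta, with its first vertex at the origin. *)
Definition beta_polygon (beta : divisor) : 'I_n -> int * int :=
  fun i => \sum_(j < n | (j < i)%N) edge_dir j *~ dot beta (toric_divisor j).

Definition polynomial_function (F : divisor -> rat) : Prop :=
  (forall c c', lin_equiv c c' -> F c = F c') /\
  exists Q : {mpoly rat[n]}, forall c, F c = Q.@[fun i => (c i)%:~R].

Definition g_max (beta : divisor) : rat :=
  1 + (dot beta beta + dot beta canonical)%:~R / 2.

(* The four numbers beta^2, K_X.beta, chi, K_X^2. *)
Definition invariants (beta : divisor) : 'I_4 -> rat :=
  tnth [tuple (dot beta beta)%:~R; (dot canonical beta)%:~R;
              euler_char%:~R; (dot canonical canonical)%:~R].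

End Polygon.

(** * Marked floor diagrams *)

(* A sink has target None, a source (element of E^bot) has origin None. *)
Record marked_diagram := MarkedDiagram {
  floor : finType;
  edge : finType;
  origin : edge -> option floor;
  target : edge -> option floor;
  weight : edge -> nat;
  Lmap : floor -> int;
  Rmap : floor -> int;
  marking : floor + edge -> nat }.

Section Diagram.
Variable D : marked_diagram.

Definition bounded : pred (edge D) :=
  fun e => (origin e != None) && (target e != None).
Definition is_sink : pred (edge D) :=
  fun e => (origin e != None) && (target e == None).
Definition is_source : pred (edge D) :=
  fun e => (origin e == None) && (target e != None).

Definition arc : rel (floor D) := fun v w =>
  [exists e : edge D, (origin e == Some v) && (target e == Some w)].
Definition adjacent : rel (floor D) := fun v w => arc v w || arc w v.

Definition components : nat := n_comp adjacent (floor D).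

Definition acyclic : Prop :=
  forall v w : floor D, arc v w -> ~~ connect arc w v.

Definition divergence (v : floor D) : int :=
  (\sum_(e : edge D | target e == Some v) weight e)%N%:Z
  - (\sum_(e : edge D | origin e == Some v) weight e)%N%:Z.

(* First Betti number; ends do not contribute. *)
Definition genus : nat := (#|bounded| + components - #|floor D|)%N.

(* Covering steps of the partial order on floors and edges. *)
Definition step : rel (floor D + edge D) := fun x y =>
  match x, y with
  | inl v, inr e => origin e == Some v
  | inr e, inl v => target e == Some v
  | _, _ => false
  end.

Definition is_marking : Prop :=
  perm_eq (codom (@marking D)) (iota 1 #|{: floor D + edge D}|) /\
  forall x y : floor D + edge D,
    x != y -> connect step x y -> (marking x < marking y)%N.

Definition is_floor_diagram (n : nat) (P : 'I_n -> int * int) : Prop :=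
  [/\ (forall e : edge D, [|| bounded e, is_sink e | is_source e]),
      (forall e : edge D, (0 < weight e)%N),
      (forall e : edge D, is_sink e || is_source e -> weight e = 1%N),
      components = 1%N /\ acyclic
    & [/\ #|floor D| = height P, #|is_sink| = btop P, #|is_source| = bbot P,
          perm_eq (codom (@Lmap D)) (bleft P) /\
          perm_eq (codom (@Rmap D)) (bright P)
        & forall v : floor D, divergence v = Lmap v + Rmap v]].

(* The multiplicity, as a function of s = q^(1/2). *)
Definition multiplicity (K : fieldType) (s : K) : K :=
  (\prod_(e : edge D | bounded e) (s ^+ weight e - s ^- weight e) ^+ 2)
  * \prod_(e : edge D | is_sink e || is_source e) (s - s^-1).

End Diagram.

Definition diagram_iso (D D' : marked_diagram) : Prop :=
  exists (f : floor D -> floor D') (h : edge D -> edge D'),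
    [/\ bijective f /\ bijective h,
        (forall e, origin (h e) = omap f (origin e)) /\
        (forall e, target (h e) = omap f (target e)),
        (forall e, weight (h e) = weight e),
        (forall v, Lmap (f v) = Lmap v) /\ (forall v, Rmap (f v) = Rmap v)
      & (forall v, marking (inl (f v) : floor D' + edge D') = marking (inl v)) /\
        (forall e, marking (inr (h e) : floor D' + edge D') = marking (inr e))].

Definition marked_floor_diagram (n : nat) (P : 'I_n -> int * int) (g : nat)
    (D : marked_diagram) : Prop :=
  [/\ is_floor_diagram D P, is_marking D & genus D = g].

(* The family S has exactly one member in each isomorphism class of marked
   floor diagrams with Newton polygon P and genus g. *)
Definition iso_representatives (n : nat) (P : 'I_n -> int * int) (g : nat)
    (I : finType) (S : I -> marked_diagram) : Prop :=
  [/\ (forall i, marked_floor_diagram P g (S i)),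
      (forall i j, diagram_iso (S i) (S j) -> i = j)
    & (forall D, marked_floor_diagram P g D -> exists i, diagram_iso D (S i))].

(** * Refined invariants *)

(* The indeterminate of {fraction {poly int}} stands for x^(1/2): then x^Area
   is its double_area-th power, BGbar(1 / x) is the sum of the multiplicities
   at its inverse, and a polynomial p(x) is p \Po 'X^2. *)
Definition is_BGtilde (n : nat) (P : 'I_n -> int * int) (g : nat)
    (p : {poly int}) : Prop :=
  let t : {fraction {poly int}} := tofrac 'X in
  exists (I : finType) (S : I -> marked_diagram),
    iso_representatives P g S /\
    tofrac (p \Po 'X^2) = t ^ double_area P * \sum_(i : I) multiplicity (S i) t^-1.

(* F is the asymptotic polynomial AR_{g,k} of the toric surface of P. *)
Definition asymptotic_polynomial (n : nat) (P : 'I_n -> int * int) (g k : nat)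
    (F : divisor n -> rat) : Prop :=
  polynomial_function P F /\
  exists2 C : int, 0 < C &
    forall beta : divisor n,
      (forall i, C <= dot P beta (toric_divisor i)) ->
      exists2 p : {poly int},
        is_BGtilde (beta_polygon P beta) g p & (p`_k)%:~R = F beta.

(** * Formal power series in u, as sequences of coefficients *)

Definition series_mul (f h : nat -> rat) : nat -> rat :=
  fun k => \sum_(i < k.+1) f i * h (k - i)%N.

Definition upow (m : nat) : nat -> rat := fun k => (k == m)%:R.

(* (1 + u)^m, by the binomial series. *)
Definition one_plus_u (m : rat) : nat -> rat :=
  fun k => (\prod_(j < k) (m - j%:R)) / k`!%:R.

Definition AR1_series (n : nat) (P : 'I_n -> int * int) (beta : divisor n) :
    nat -> rat :=
  let K := canonical (n := n) in
  series_mul (one_plus_u (g_max P beta)) (fun k =>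
      - (dot P beta beta)%:~R * series_mul (upow 3) (one_plus_u (-3)) k
      + 2 * (dot P K beta)%:~R * series_mul (upow 2) (one_plus_u (-3)) k
      + (euler_char n)%:~R * one_plus_u (-1) k
      - (dot P K K)%:~R * series_mul (upow 1) (one_plus_u (-3)) k).

(* Main.v *)
Require Import Defs.
From mathcomp Require Import all_boot all_order all_algebra.
From mathcomp Require Import fraction mpoly zify ring lra.
From Stdlib Require Import Classical.
Set Implicit Arguments.
Unset Strict Implicit.
Unset Printing Implicit Defensive.
Import Order.TTheory GRing.Theory Num.Theory.
Local Open Scope ring_scope.

(** Cut a marked floor diagram along its marking: it is encoded by the two
    orderings of the left and right directions of its floors and by the list of
    its edges, each with the gap between floors where it is marked.  In
    x^Area BGbar(1/x) it contributes x^c times a product of factors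
    (1 - x^w)^2 and 1 - x, where the codegree c adds up, over the edges, the
    weight times the number of floors jumped over, and measures how far the two
    orderings are from being sorted.  Only codegrees 0 and 1 matter.  In
    codegree 0 the orderings are sorted and the edges join consecutive floors,
    their weights forming compositions of the widths of the polygon at integer
    heights; in codegree 1 either two adjacent directions differing by 1 are
    swapped, or a single edge of weight 1 jumps over one floor.  Marking bounded
    edges by u, the compositions of m give u (1 + u)^(m - 1), so that all the
    sums are explicit multiples of one power of 1 + u.  Finally, beta^2 is twice
    the area of the polygon, - K.beta its lattice perimeter, chi its number of
    edges, and K^2 = 12 - chi. *)

(** * Encoding of marked floor diagrams *)

(** The marking is a total order, so a code is a complete isomorphism invariant and isomorphism
    classes can be counted as lists. The only global condition on a diagram, connectedness, never
    has to be tested in codegree at most 1. Widths at least 3 leave a flow at least 2 at every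
    level, whereas a missing edge between two consecutive floors would force all this flow through
    jumping edges, hence an excess at least 2. This is why one threshold on the numbers [beta . D],
    namely 3, serves every genus. The denominators [(1 + u)^3] come from a jumping edge: it takes
    one unit of weight from each of the two levels that it crosses, and counting its possible
    positions in a gap costs one more factor. A swap costs a single factor. Identities are therefore
    proved after multiplication by [(1 + u)^3], inside integer polynomials. The widths just above
    the bottom side and just below the top side are not invariants of the class. They disappear
    because smoothness makes the directions of each side consecutive integers, which ties the sum of
    these two widths to the lengths of the horizontal sides and to the number of edges. *)

Section SortedByKey.
Local Open Scope nat_scope.
Variables (T : eqType) (key : T -> nat).

Lemma path_key_gt (x : T) (s : seq T) :
  path (fun u v => key u < key v) x s -> all (fun v => key x < key v) s.
Proof. by apply: order_path_min => ? ? ?; apply: ltn_trans. Qed.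

Lemma count_key_lt (s : seq T) (v : T) :
  sorted (fun u v => key u < key v) s -> v \in s ->
  count (fun u => key u < key v) s = index v s.
Proof.
elim: s => // x s IH /= ps; rewrite inE; case: (eqVneq x v) => [<- _|xv] /=.
  rewrite ltnn add0n; apply/eqP; rewrite -leqn0 leqNgt -has_count.
  apply/hasPn => u us; move/allP: (path_key_gt ps) => /(_ u us); lia.
move=> vs.
move/allP: (path_key_gt ps) => /(_ v vs) ->.
by rewrite IH //; apply: path_sorted ps.
Qed.

Lemma key_lt_count (s : seq T) (v : T) (m : nat) :
  sorted (fun u v => key u < key v) s -> v \in s ->
  (key v < m) = (index v s < count (fun u => key u < m) s).
Proof.
elim: s => // x s IH /= ps.
have h : m <= key x -> count (fun u => key u < m) s = 0.
  move=> mx; apply/eqP; rewrite -leqn0 leqNgt -has_count.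
  apply/hasPn => u us; move/allP: (path_key_gt ps) => /(_ u us); lia.
rewrite inE; case: (eqVneq x v) => [<- _|xv] /=.
  by case: ltnP => //= /h ->.
move=> vs.
case: (ltnP (key x) m) => [xm|mx] /=; last rewrite h //.
  by rewrite add1n ltnS IH //; apply: path_sorted ps.
move/allP: (path_key_gt ps) => /(_ v vs); lia.
Qed.

End SortedByKey.

Section ByKey.
Local Open Scope nat_scope.
Variables (T : finType) (key : T -> nat).
Hypothesis key_inj : injective key.

Definition bykey : seq T := sort (fun u v => key u <= key v) (enum T).

Lemma perm_bykey : perm_eq bykey (enum T).
Proof. by rewrite perm_sort. Qed.

Lemma mem_bykey v : v \in bykey.
Proof. by rewrite (perm_mem perm_bykey) mem_enum. Qed.

Lemma uniq_bykey : uniq bykey.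
Proof. by rewrite (perm_uniq perm_bykey) enum_uniq. Qed.

Lemma size_bykey : size bykey = #|T|.
Proof. by rewrite (perm_size perm_bykey) -cardE. Qed.

Lemma bykey_unique (s : seq T) :
  perm_eq s (enum T) -> sorted (fun u v => key u <= key v) s -> s = bykey.
Proof.
move=> ps ss; apply: (@sorted_eq _ (fun u v => key u <= key v)) => //.
- by move=> ? ? ?; apply: leq_trans.
- by move=> u v huv; apply: key_inj; lia.
- by apply: sort_sorted => u v; apply: leq_total.
- by rewrite (perm_trans ps) // perm_sym perm_bykey.
Qed.

Lemma sorted_bykey : sorted (fun u v => key u < key v) bykey.
Proof.
have hs : sorted (fun u v => key u <= key v) bykey.
  by apply: sort_sorted => u v; apply: leq_total.
suff: sorted ltn (map key bykey) by rewrite sorted_map.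
by rewrite ltn_sorted_uniq_leq map_inj_uniq // uniq_bykey sorted_map.
Qed.

Lemma index_bykey v : index v bykey = count (fun u => key u < key v) bykey.
Proof. by rewrite count_key_lt ?mem_bykey ?sorted_bykey. Qed.

Lemma index_bykey_lt v : index v bykey < #|T|.
Proof. by rewrite -size_bykey index_mem mem_bykey. Qed.

Lemma key_lt_bykey v m : (key v < m) = (index v bykey < count (fun u => key u < m) bykey).
Proof. by apply: key_lt_count; rewrite ?mem_bykey ?sorted_bykey. Qed.

End ByKey.

Lemma bijective_of_enumerations (T T' : eqType) (s : seq T) (s' : seq T') :
  uniq s -> uniq s' -> (forall x, x \in s) -> (forall y, y \in s') ->
  size s = size s' -> exists2 f : T -> T', bijective f & map f s = s'.
Proof.
move=> us us' ms ms' ss; case: s' us' ms' ss => [|y0 s'] us' ms' ss.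
  have F (x : T) : False by move: (ms x); rewrite (size0nil ss).
  exists (fun x => False_rect _ (F x)); last by rewrite (size0nil ss).
  by exists (fun y => False_rect _ (notF (ms' y))) => [x|y];
    [case: (F x) | case: (notF (ms' y))].
case: s us ms ss => [|x0 s] // us ms ss.
pose f x := nth y0 (y0 :: s') (index x (x0 :: s)).
pose h y := nth x0 (x0 :: s) (index y (y0 :: s')).
exists f.
  exists h => z; rewrite /f /h index_uniq ?nth_index //.
    by rewrite -ss index_mem.
  by rewrite ss index_mem.
apply: (@eq_from_nth _ y0) => [|i]; rewrite size_map // => hi.
by rewrite (nth_map x0) // /f index_uniq.
Qed.

(* An edge of a marked diagram: the number of floors marked before it, the
   ranks of its origin (0 for a source) and of its target (a + 1 for a sink),
   its weight. *)
Definition letter : Type := nat * (nat * nat * nat).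
Definition lgap (x : letter) : nat := x.1.
Definition lorigin (x : letter) : nat := x.2.1.1.
Definition ltarget (x : letter) : nat := x.2.1.2.
Definition lweight (x : letter) : nat := x.2.2.

Definition code : Type := seq int * seq int * seq letter.

Section CodeOfDiagram.
Local Open Scope nat_scope.
Variable D : marked_diagram.

Definition fmark (v : floor D) : nat := marking (inl v : floor D + edge D).
Definition emark (e : edge D) : nat := marking (inr e : floor D + edge D).
Definition floors : seq (floor D) := bykey fmark.
Definition edges : seq (edge D) := bykey emark.
Definition rank (v : floor D) : nat := (index v floors).+1.
Definition gap (e : edge D) : nat := count (fun v => fmark v < emark e) floors.
Definition letter_of (e : edge D) : letter :=
  (gap e, (oapp rank 0 (origin e), oapp rank #|floor D|.+1 (target e), weight e)).
Definition code_of : code :=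
  (map (@Lmap D) floors, map (@Rmap D) floors, map letter_of edges).

Hypothesis mark : is_marking D.

Lemma marking_inj : injective (@marking D).
Proof.
apply/injectiveP; case: mark => /perm_uniq; rewrite iota_uniq => h _.
by rewrite /injectiveb /dinjectiveb -/(codom _) h.
Qed.

Lemma fmark_inj : injective fmark.
Proof. by move=> u v /marking_inj []. Qed.

Lemma emark_inj : injective emark.
Proof. by move=> u v /marking_inj []. Qed.

Lemma fmark_neq_emark v e : fmark v != emark e.
Proof. by apply/eqP => /marking_inj. Qed.

Lemma count_iota_lt (m N : nat) : 0 < m <= N -> count (fun k => k < m) (iota 1 N) = m.-1.
Proof.
move=> hm; have {1}-> : N = m.-1 + (N - m.-1) by lia.
rewrite iotaD count_cat.
have /eqP-> : count (fun k => k < m) (iota 1 m.-1) == size (iota 1 m.-1).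
  by rewrite -all_count; apply/allP => k; rewrite mem_iota; lia.
have -> : count (fun k => k < m) (iota (1 + m.-1) (N - m.-1)) = 0.
  apply/eqP; rewrite -leqn0 leqNgt -has_count; apply/hasPn => k.
  by rewrite mem_iota; lia.
by rewrite size_iota addn0.
Qed.

(** The marks are exactly 1 to N, so a mark is one more than the number of smaller marks, which are
    those of floors and those of edges. *)
Lemma markingE (x : (floor D + edge D)%type) :
  marking x = (count (fun v => fmark v < marking x) floors
             + count (fun e => emark e < marking x) edges).+1.
Proof.
have [pm _] := mark.
have hx : 0 < marking x <= #|{: floor D + edge D}|.
  have : marking x \in codom (@marking D) by apply: codom_f.
  by rewrite (perm_mem pm) mem_iota; lia.
have := count_iota_lt hx.
rewrite -(permP pm) /codom /image_mem count_map -sum1_count big_enum_cond /=.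
rewrite big_sumType /= => h.
have <- : \sum_(i | marking (inl i : floor D + edge D) < marking x) 1
   = count (fun v => fmark v < marking x) floors.
  by rewrite /floors /edges (permP (perm_bykey _)) -sum1_count big_enum_cond.
have <- : \sum_(i | marking (inr i : floor D + edge D) < marking x) 1
   = count (fun e => emark e < marking x) edges.
  by rewrite /floors /edges (permP (perm_bykey _)) -sum1_count big_enum_cond.
move: h hx; lia.
Qed.

Lemma gap_le e : gap e <= #|floor D|.
Proof. by rewrite -(size_bykey fmark) count_size. Qed.

Lemma fmark_lt_emark v e : (fmark v < emark e) = (rank v <= gap e).
Proof. by rewrite (key_lt_bykey fmark_inj). Qed.

Lemma emark_lt_fmark v e : (emark e < fmark v) = (gap e < rank v).
Proof.
rewrite ltn_neqAle eq_sym fmark_neq_emark /= leqNgt fmark_lt_emark; lia.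
Qed.

(** Together with [emarkE], this recovers the marking from the code: an edge precedes the floor of
    index [i] exactly when its gap is at most [i]. *)
Lemma fmarkE v :
  fmark v = (index v floors + count (fun x => lgap x <= index v floors) (map letter_of edges)).+1.
Proof.
rewrite {1}/fmark markingE -/(fmark v) -(index_bykey fmark_inj) count_map.
by congr (_ + _).+1; apply: eq_count => e /=; rewrite emark_lt_fmark.
Qed.

Lemma emarkE e : emark e = (gap e + index e edges).+1.
Proof.
by rewrite {1}/emark markingE -/(emark e) (index_bykey emark_inj).
Qed.

Lemma rank_inj : injective rank.
Proof.
move=> u v [h].
by rewrite -(nth_index u (mem_bykey fmark u)) -/floors h nth_index ?mem_bykey.
Qed.

Lemma rank_le v : rank v <= #|floor D|.
Proof. exact: (index_bykey_lt fmark). Qed.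

End CodeOfDiagram.

Section CodeIso.
Local Open Scope nat_scope.
Variables D D' : marked_diagram.
Hypothesis mD : is_marking D.
Hypothesis mD' : is_marking D'.

Lemma bykey_map (T T' : finType) (k : T -> nat) (k' : T' -> nat) (f : T -> T') :
  injective k' -> bijective f -> (forall x, k' (f x) = k x) -> map f (bykey k) = bykey k'.
Proof.
move=> ik' bf kf; apply: bykey_unique => //.
  apply: uniq_perm; rewrite ?enum_uniq ?map_inj_uniq ?uniq_bykey //; first exact: bij_inj.
  move=> y; rewrite mem_enum; case: bf => f' K K'.
  by rewrite -(K' y) map_f ?mem_bykey.
rewrite sorted_map; have := @sort_sorted _ (fun u v => k u <= k v) _ (enum T).
rewrite -/(bykey k) => h.
by rewrite (eq_sorted (e' := fun u v => k u <= k v)) ?h // => u v /=; rewrite ?kf ?leq_total.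
Qed.

Lemma code_of_iso : diagram_iso D D' -> code_of D = code_of D'.
Proof.
case=> f [h [[bf bh] [ho ht] hw [hL hR] [mf me]]].
have ff : map f (floors D) = floors D' by apply: bykey_map => //; apply: fmark_inj.
have hh : map h (edges D) = edges D' by apply: bykey_map => //; apply: emark_inj.
have rf v : rank (f v) = rank v.
  by rewrite /rank -ff index_map //; apply: bij_inj.
rewrite /code_of -ff -hh -!map_comp; congr (_, _, _).
- by apply: eq_map => v /=; rewrite hL.
- by apply: eq_map => v /=; rewrite hR.
apply: eq_map => e /=; rewrite /letter_of ho ht hw; congr (_, (_, _, _)).
- by rewrite /gap -ff count_map; apply: eq_count => v /=; rewrite /fmark mf /emark me.
- by case: (origin e) => //= v; rewrite rf.
- by case: (target e) => /= [v|]; rewrite ?rf ?(bij_eq_card bf).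
Qed.

Lemma iso_of_code : code_of D = code_of D' -> diagram_iso D D'.
Proof.
case=> eL eR ee.
have sf : size (floors D) = size (floors D').
  by have := congr1 size eL; rewrite !size_map.
have se : size (edges D) = size (edges D').
  by have := congr1 size ee; rewrite !size_map.
have cf : #|floor D| = #|floor D'|.
  by rewrite -(size_bykey (@fmark D)) -(size_bykey (@fmark D')).
have [f bf ff] := bijective_of_enumerations (uniq_bykey (@fmark D)) (uniq_bykey (@fmark D'))
  (mem_bykey (@fmark D)) (mem_bykey (@fmark D')) sf.
have [h bh hh] := bijective_of_enumerations (uniq_bykey (@emark D)) (uniq_bykey (@emark D'))
  (mem_bykey (@emark D)) (mem_bykey (@emark D')) se.
have indf v : index (f v) (floors D') = index v (floors D).
  by rewrite /floors -ff index_map //; apply: bij_inj.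
have inde e : index (h e) (edges D') = index e (edges D).
  by rewrite /edges -hh index_map //; apply: bij_inj.
have rf v : rank (f v) = rank v by rewrite /rank indf.
have hL v : Lmap (f v) = Lmap v.
  move: eL; rewrite /floors -ff -map_comp => /esym /eq_in_map; apply; exact: mem_bykey.
have hR v : Rmap (f v) = Rmap v.
  move: eR; rewrite /floors -ff -map_comp => /esym /eq_in_map; apply; exact: mem_bykey.
have he e : letter_of (h e) = letter_of e.
  move: ee; rewrite /edges -hh -map_comp => /esym /eq_in_map; apply; exact: mem_bykey.
(* The default values 0 and [a + 1] used for missing endpoints are not ranks of floors, so an
   optional endpoint is determined by its number. *)
have oappI (k : nat) (T : Type) (r : T -> nat) (u v : option T) : injective r ->
    (forall x, r x != k) -> oapp r k u = oapp r k v -> u = v.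
  move=> ir nk; case: u => [u|]; case: v => [v|] //=; first by move/ir->.
    by move/eqP; rewrite (negPf (nk u)).
  by move/esym/eqP; rewrite (negPf (nk v)).
exists f, h; split; first by split.
- split=> e; case: (he e) => _ eo et _.
    apply: (oappI 0 _ (@rank D')) => //; first exact: rank_inj.
    by rewrite eo; case: (origin e) => //= v; rewrite rf.
  apply: (oappI #|floor D'|.+1 _ (@rank D')) => //; first exact: rank_inj.
    by move=> v; have := rank_le v; lia.
  by rewrite et; case: (target e) => /= [v|]; rewrite ?rf ?cf.
- by move=> e; case: (he e).
- by split.
split=> x; first by rewrite -!/(fmark _) !fmarkE // indf ee.
by rewrite -!/(emark _) !emarkE // inde; case: (he x) => ->.
Qed.

End CodeIso.

(** The first condition says that the edge is marked after its origin and before its target. *)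
Definition letter_ok (a : nat) (x : letter) : bool :=
  [&& (lorigin x <= lgap x < ltarget x)%N, (ltarget x <= a.+1)%N, (0 < lweight x)%N,
      (lorigin x == 0%N) || (ltarget x == a.+1) ==> (lweight x == 1%N)
    & ~~ ((lorigin x == 0%N) && (ltarget x == a.+1))].

Definition lbounded (a : nat) (x : letter) : bool :=
  (0 < lorigin x)%N && (ltarget x <= a)%N.

Definition gap_sorted (es : seq letter) : bool :=
  sorted (fun x y => lgap x <= lgap y)%N es.

(** Connectedness and genus are left out on purpose. Acyclicity is implied, since [letter_ok] makes
    ranks increase along edges. *)
Definition code_ok (a bt bb : nat) (lefts rights : seq int) (c : code) : Prop :=
  [/\ perm_eq c.1.1 lefts, perm_eq c.1.2 rights, gap_sorted c.2, all (letter_ok a) c.2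
    & [/\ count (fun x => lorigin x == 0%N) c.2 = bb,
          count (fun x => ltarget x == a.+1) c.2 = bt
        & forall j, (j < a)%N ->
            (\sum_(x <- c.2 | ltarget x == j.+1) lweight x)%N%:Z
            - (\sum_(x <- c.2 | lorigin x == j.+1) lweight x)%N%:Z
            = nth 0 c.1.1 j + nth 0 c.1.2 j]].

Section BigLetters.
Variable D : marked_diagram.

Lemma big_letters (R : Type) (idx : R) (op : Monoid.com_law idx) (p : pred letter)
    (F : letter -> R) (q : pred (edge D)) :
  q =1 (fun e => p (letter_of e)) ->
  \big[op/idx]_(x <- (code_of D).2 | p x) F x
  = \big[op/idx]_(e : edge D | q e) F (letter_of e).
Proof.
move=> qp; rewrite big_map (perm_big _ (perm_bykey _)) /= big_enum_cond.
by apply: eq_bigl => e; rewrite qp.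
Qed.

Lemma count_letters (p : pred letter) (q : pred (edge D)) :
  q =1 (fun e => p (letter_of e)) -> count p (code_of D).2 = #|q|.
Proof.
move=> qp; rewrite -sum1_count -sum1_card (big_letters _ _ qp).
by apply: eq_bigl.
Qed.

Lemma origin_letter (e : edge D) (v : floor D) : (origin e == Some v) = (lorigin (letter_of e) == rank v).
Proof.
rewrite /lorigin /=; case: (origin e) => [u|] //=.
by rewrite (inj_eq (@rank_inj D)).
Qed.

Lemma target_letter (e : edge D) (v : floor D) : (target e == Some v) = (ltarget (letter_of e) == rank v).
Proof.
rewrite /ltarget /=; case: (target e) => [u|] /=.
  by rewrite (inj_eq (@rank_inj D)).
by rewrite gtn_eqF ?ltnS ?rank_le.
Qed.

Lemma origin_None (e : edge D) : (origin e == None) = (lorigin (letter_of e) == 0%N).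
Proof. by rewrite /lorigin /=; case: (origin e). Qed.

Lemma target_None (e : edge D) : (target e == None) = (ltarget (letter_of e) == #|floor D|.+1).
Proof.
rewrite /ltarget /=; case: (target e) => [u|] /=; last by rewrite !eqxx.
by rewrite ltn_eqF ?ltnS ?rank_le.
Qed.

Lemma bounded_letter (e : edge D) : bounded e = lbounded #|floor D| (letter_of e).
Proof.
rewrite /bounded origin_None target_None /lbounded lt0n.
congr (_ && _); rewrite /ltarget /=.
case: (target e) => [u|] /=; last by rewrite eqxx ltnn.
by rewrite rank_le ltn_eqF // ltnS rank_le.
Qed.

End BigLetters.

Section CodeOfOk.
Variables (n : nat) (P : 'I_n -> int * int) (g : nat) (D : marked_diagram).
Hypothesis mfd : marked_floor_diagram P g D.

Lemma step_mark (x y : (floor D + edge D)%type) : step x y -> (marking x < marking y)%N.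
Proof.
case: mfd => _ [_ mk] _ xy; apply: mk; last exact: connect1.
by apply/eqP => exy; move: xy; rewrite exy; case: y {exy}.
Qed.

Lemma letter_of_ok (e : edge D) : letter_ok #|floor D| (letter_of e).
Proof.
case: mfd => -[he w0 w1 _ _] mk _.
apply/and5P; split.
- apply/andP; split.
    rewrite /lorigin /=; case E: (origin e) => [v|] //=.
    by rewrite -(fmark_lt_emark mk); apply: (@step_mark (inl v) (inr e)); rewrite /= E.
  rewrite /ltarget /=; case E: (target e) => [v|] /=; last by rewrite ltnS gap_le.
  by rewrite -(emark_lt_fmark mk); apply: (@step_mark (inr e) (inl v)); rewrite /= E.
- rewrite /ltarget /=; case: (target e) => [v|] //=.
  exact: leq_trans (rank_le v) _.
- exact: w0.
- apply/implyP; rewrite -origin_None -target_None => h; apply/eqP; apply: w1.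
  by move: h (he e); rewrite /bounded /is_sink /is_source; case: eqP; case: eqP.
- rewrite -origin_None -target_None.
  by move: (he e); rewrite /bounded /is_sink /is_source; case: eqP; case: eqP.
Qed.

Lemma code_of_ok : code_ok (height P) (btop P) (bbot P) (bleft P) (bright P) (code_of D).
Proof.
case: mfd => -[he w0 w1 _ [ca ct cb [pL pR] dv]] mk _.
split=> /=.
- by rewrite (permPl (perm_map _ (perm_bykey _))).
- by rewrite (permPl (perm_map _ (perm_bykey _))).
- rewrite /gap_sorted sorted_map.
  have := sorted_bykey (emark_inj mk); apply: sub_sorted => e f ef /=.
  by apply: sub_count => v /= h; apply: ltn_trans ef.
- by rewrite all_map; apply/allP => e _ /=; rewrite -ca; apply: letter_of_ok.
split.
- rewrite -cb (@count_letters D _ (@is_source D)) // => e /=.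
  rewrite -origin_None /is_source.
  by move: (he e); rewrite /bounded /is_sink /is_source; case: eqP; case: eqP.
- rewrite -ct (@count_letters D _ (@is_sink D)) // => e /=.
  rewrite -ca -target_None /is_sink.
  by move: (he e); rewrite /bounded /is_sink /is_source; case: eqP; case: eqP.
move=> j; rewrite -ca => ja.
have [v vj] : exists v : floor D, rank v = j.+1.
  have ja' : (j < size (floors D))%N by rewrite size_bykey.
  case E: (floors D) (ja') => [//|v0 s] _; exists (nth v0 (floors D) j).
  by rewrite /rank index_uniq // uniq_bykey.
rewrite (@big_letters D _ _ _ _ _ (fun e => target e == Some v)); last first.
  by move=> e; rewrite target_letter vj.
rewrite (@big_letters D _ _ _ _ _ (fun e => origin e == Some v)); last first.
  by move=> e; rewrite origin_letter vj.
have iv : index v (floors D) = j by case: vj.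
rewrite -!iv !(nth_map v) ?index_mem ?mem_bykey // nth_index ?mem_bykey //.
exact: (dv v).
Qed.

Lemma code_of_genus : (count (lbounded (height P)) (code_of D).2 + 1 - height P)%N = g.
Proof.
case: mfd => -[he w0 w1 [cc _] [ca ct cb _ _]] _ <-.
by rewrite /genus cc ca (@count_letters D _ (@bounded D)) // => e; rewrite bounded_letter ca.
Qed.

End CodeOfOk.

(** * Reconstruction of a marked diagram from its code *)

Section Decode.
Variables (a : nat) (c : code).
Local Notation es := c.2.

Definition letter0 : letter := (0%N, (0%N, 0%N, 0%N)).
Definition data (k : 'I_(size es)) : letter := nth letter0 es k.

(** The marking is given by the formulas of [fmarkE] and [emarkE]. A sink has target [a + 1], and
    [insub a] is [None] in ['I_a]. *)
Definition decode : marked_diagram :=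
  {| floor := 'I_a; edge := 'I_(size es);
     origin k := if lorigin (data k) is o.+1 then insub o else None;
     target k := insub (ltarget (data k)).-1;
     weight k := lweight (data k);
     Lmap v := nth 0 c.1.1 v;
     Rmap v := nth 0 c.1.2 v;
     marking x := match x with
       | inl v => (v + count (fun y => lgap y <= v)%N es).+1
       | inr k => (lgap (data k) + k).+1
       end |}.

Lemma sorted_le_count (s : seq letter) (i m : nat) :
  gap_sorted s -> (i < size s)%N ->
  (lgap (nth letter0 s i) <= m)%N = (i < count (fun y => lgap y <= m)%N s)%N.
Proof.
elim: s i => // x s IH i /= ps.
have xs : all (fun y => lgap x <= lgap y)%N s.
  by apply: order_path_min ps => u v w; apply: leq_trans.
have h : (m < lgap x)%N -> count (fun y => lgap y <= m)%N s = 0%N.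
  move=> mx; apply/eqP; rewrite -leqn0 leqNgt -has_count.
  apply/hasPn => u us; move/allP: xs => /(_ u us); lia.
case: i => [_|i hi] /=.
  by case: (leqP (lgap x) m) => //= /h ->.
case: (leqP (lgap x) m) => [xm|mx] /=.
  by rewrite add1n ltnS IH //; apply: path_sorted ps.
rewrite h //; move/allP: xs => /(_ (nth letter0 s i)).
rewrite mem_nth // => /(_ isT); lia.
Qed.

Hypothesis lok : all (letter_ok a) es.

Lemma data_ok k : letter_ok a (data k).
Proof. by move/allP: lok; apply; rewrite mem_nth. Qed.

Lemma origin_decode (k : edge decode) (v : floor decode) :
  (origin k == Some v) = (lorigin (data k) == v.+1).
Proof.
case/and5P: (data_ok k) => /andP[h1 h2] h3 _ _ _ /=.
case: (lorigin (data k)) h1 => [|o] h1 //=.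
by case: insubP => [u _ <-|]; rewrite ?eqSS //; lia.
Qed.

Lemma target_decode (k : edge decode) (v : floor decode) :
  (target k == Some v) = (ltarget (data k) == v.+1).
Proof.
case/and5P: (data_ok k) => /andP[h1 h2] h3 _ _ _ /=.
case: (ltarget (data k)) h2 h3 => [|t] h2 h3 //=.
case: insubP => [u _ <-|]; rewrite ?eqSS //.
by have := ltn_ord v; rewrite -leqNgt => hv ht; apply/esym/negbTE/eqP; lia.
Qed.

Lemma origin_decode_None (k : edge decode) : (origin k == None) = (lorigin (data k) == 0%N).
Proof.
case/and5P: (data_ok k) => /andP[h1 h2] h3 _ _ _ /=.
by case: (lorigin (data k)) h1 => [|o] h1 //=; case: insubP => //; lia.
Qed.

Lemma target_decode_None (k : edge decode) : (target k == None) = (ltarget (data k) == a.+1).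
Proof.
case/and5P: (data_ok k) => /andP[h1 h2] h3 _ _ _ /=.
case: (ltarget (data k)) h2 h3 => [|t] h2 h3 //=.
case: insubP => [u ua _|ta]; first by apply/esym/negbTE/eqP; lia.
by rewrite eqxx; apply/esym/eqP; lia.
Qed.

Hypothesis srt : gap_sorted es.

Lemma data_le_count (k : 'I_(size es)) m :
  (lgap (data k) <= m)%N = (k < count (fun y => lgap y <= m)%N es)%N.
Proof. exact: sorted_le_count. Qed.

Lemma fmark_decode_lt (u v : floor decode) : (u < v)%N -> (fmark u < fmark v)%N.
Proof.
move=> uv; rewrite /fmark /= ltnS.
have : (count (fun y => lgap y <= u) es <= count (fun y => lgap y <= v) es)%N.
  by apply: sub_count => y /=; lia.
lia.
Qed.

Lemma emark_decode_lt (k l : edge decode) : (k < l)%N -> (emark k < emark l)%N.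
Proof.
move=> kl; rewrite /emark /=.
have := @data_le_count k (lgap (data l)); have := @data_le_count l (lgap (data l)).
rewrite leqnn => /esym h1 h2; have : (lgap (data k) <= lgap (data l))%N by rewrite h2; lia.
lia.
Qed.

Lemma fmark_emark_decode (v : floor decode) (k : edge decode) :
  if (lgap (data k) <= v)%N then (emark k < fmark v)%N else (fmark v < emark k)%N.
Proof.
by have := data_le_count k v; rewrite /fmark /emark /= !ltnS; case: (leqP (lgap _)) => h /esym; lia.
Qed.

Lemma is_marking_decode : is_marking decode.
Proof.
have inj : injective (@marking decode).
  case=> [u|k] [v|l].
  - have := @fmark_decode_lt u v; have := @fmark_decode_lt v u; rewrite /fmark.
    by move=> h1 h2 e; congr inl; apply: val_inj => /=; lia.
  - by have := fmark_emark_decode u l; rewrite /fmark /emark; case: ifP => _ h e; lia.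
  - by have := fmark_emark_decode v k; rewrite /fmark /emark; case: ifP => _ h e; lia.
  have := @emark_decode_lt k l; have := @emark_decode_lt l k; rewrite /emark.
  by move=> h1 h2 e; congr inr; apply: val_inj => /=; lia.
have card : #|{: floor decode + edge decode}| = (a + size es)%N.
  by rewrite card_sum !card_ord.
split.
  have uc : uniq (codom (@marking decode)) by rewrite map_inj_uniq ?enum_uniq.
  have sub : {subset codom (@marking decode) <= iota 1 #|{: floor decode + edge decode}|}.
    move=> m /codomP[x ->]; rewrite mem_iota card.
    case: x => [v|k] /=.
      by have := ltn_ord v; have := count_size (fun y => lgap y <= v)%N es; lia.
    by case/and5P: (data_ok k) => /andP[h1 h2] h3 _ _ _; have := ltn_ord k; lia.
  (* An injective family of marks contained in an interval of the same size fills it. *)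
  apply: uniq_perm; rewrite ?iota_uniq //.
  have hs : (size (iota 1 #|{: floor decode + edge decode}|) <= size (codom (@marking decode)))%N.
    by rewrite size_codom size_iota.
  by have [] := uniq_min_size uc sub hs.
have st (x y : (floor decode + edge decode)%type) : step x y -> (marking x < marking y)%N.
  case: x => [v|k]; case: y => [w|l] //=.
    move=> /eqP E; have := origin_decode l v; rewrite -E eqxx => /esym/eqP hv.
    have := fmark_emark_decode v l; case/and5P: (data_ok l) => /andP[h1 h2] h3 _ _ _.
    by rewrite /fmark /emark; case: ifP => //=; lia.
  move=> /eqP E; have := target_decode k w; rewrite -E eqxx => /esym/eqP hv.
  have := fmark_emark_decode w k; case/and5P: (data_ok k) => /andP[h1 h2] h3 _ _ _.
  by rewrite /fmark /emark; case: ifP => //=; lia.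
move=> x y xy /connectP[p]; elim: p x xy => [x|z p IH x _] /=.
  by move=> + _ e; rewrite e eqxx.
case/andP=> /st xz pz ey; case: (eqVneq z y) => [<- //|zy].
exact: ltn_trans xz (IH z zy pz ey).
Qed.

Lemma floors_decode : floors decode = enum 'I_a.
Proof.
apply/esym/bykey_unique => //; first exact/fmark_inj/is_marking_decode.
have : sorted ltn (map val (enum 'I_a)) by rewrite val_enum_ord iota_ltn_sorted.
by rewrite sorted_map; apply: sub_sorted => u v /= uv; apply/ltnW/fmark_decode_lt.
Qed.

Lemma edges_decode : edges decode = enum 'I_(size es).
Proof.
apply/esym/bykey_unique => //; first exact/emark_inj/is_marking_decode.
have : sorted ltn (map val (enum 'I_(size es))) by rewrite val_enum_ord iota_ltn_sorted.
by rewrite sorted_map; apply: sub_sorted => u v /= uv; apply/ltnW/emark_decode_lt.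
Qed.

Lemma rank_decode (v : floor decode) : rank v = v.+1.
Proof. by rewrite /rank floors_decode index_enum_ord. Qed.

Lemma letter_decode (k : edge decode) : letter_of k = data k.
Proof.
case/and5P: (data_ok k) => /andP[h1 h2] h3 _ _ _.
have ho : oapp (@rank decode) 0%N (origin k) = lorigin (data k).
  case E: (origin k) => [v|] /=.
    by have := origin_decode k v; rewrite E eqxx rank_decode => /esym/eqP.
  by have := origin_decode_None k; rewrite E eqxx => /esym/eqP.
have ht : oapp (@rank decode) #|floor decode|.+1 (target k) = ltarget (data k).
  case E: (target k) => [v|] /=.
    by have := target_decode k v; rewrite E eqxx rank_decode => /esym/eqP.
  by have := target_decode_None k; rewrite E eqxx card_ord => /esym/eqP.
have hg : gap k = lgap (data k).
  rewrite /gap floors_decode.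
  rewrite (@eq_count _ _ (fun v : 'I_a => v < lgap (data k))%N); last first.
    move=> v; have := fmark_emark_decode v k; case: ifP => hk h; last by rewrite h; lia.
    by rewrite ltnNge (ltnW h) /=; lia.
  rewrite -(count_map val (fun v => v < lgap (data k))%N) val_enum_ord.
  have -> : a = (lgap (data k) + (a - lgap (data k)))%N by lia.
  rewrite iotaD count_cat.
  have /eqP-> : count (fun i => i < lgap (data k))%N (iota 0 (lgap (data k)))
     == size (iota 0 (lgap (data k))).
    by rewrite -all_count; apply/allP => i; rewrite mem_iota.
  have -> : count (fun i => i < lgap (data k))%N (iota (0 + lgap (data k)) (a - lgap (data k)))
     = 0%N.
    apply/eqP; rewrite -leqn0 leqNgt -has_count; apply/hasPn => i.
    by rewrite mem_iota; lia.
  by rewrite size_iota addn0.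
rewrite /letter_of ho ht hg /=; move: (data k) => [x [[y z] w]] //=.
Qed.

Lemma code_of_decode : size c.1.1 = a -> size c.1.2 = a -> code_of decode = c.
Proof.
move=> sL sR; rewrite /code_of floors_decode edges_decode.
have E1 (s : seq int) : size s = a -> [seq nth 0 s v | v : 'I_a <- enum 'I_a] = s.
  by move=> <-; rewrite (map_comp (nth 0 s) val) val_enum_ord -/(mkseq _ _) mkseq_nth.
rewrite (eq_map letter_decode) E1 // E1 //.
rewrite /data (map_comp (nth letter0 es) val) val_enum_ord -/(mkseq _ _) mkseq_nth.
by case: c => [[]].
Qed.

End Decode.

Section DecodeDiagram.
Variables (n : nat) (P : 'I_n -> int * int) (c : code).
Local Notation a := (height P).
Hypothesis ha : (0 < a)%N.
Hypothesis ok : code_ok a (btop P) (bbot P) (bleft P) (bright P) c.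
Hypothesis chain : forall i, (0 < i < a)%N ->
  has (fun x => (lorigin x == i) && (ltarget x == i.+1)) c.2.
Hypothesis sl : size (bleft P) = a.
Hypothesis sr : size (bright P) = a.

Let D := decode a c.

Let srt : gap_sorted c.2. Proof. by case: ok. Qed.
Let lok : all (letter_ok a) c.2. Proof. by case: ok. Qed.

Let letters (p : pred letter) (q : pred (edge D)) :
  q =1 (fun k => p (letter_of k)) -> count p c.2 = #|q|.
Proof.
move=> qp; rewrite -(count_letters qp) /D code_of_decode //.
- by case: ok => /perm_size->.
- by case: ok => _ /perm_size->.
Qed.

Lemma code_of_decode_ok : code_of D = c.
Proof.
rewrite /D code_of_decode //.
- by case: ok => /perm_size->.
- by case: ok => _ /perm_size->.
Qed.

Lemma arc_decode_lt (u v : floor D) : Defs.arc u v -> (u < v)%N.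
Proof.
case/existsP=> k; rewrite (origin_decode lok) (target_decode lok).
by case/and5P: (data_ok lok k) => /andP[h1 h2] _ _ _ _ /andP[/eqP e1 /eqP e2]; lia.
Qed.

Lemma acyclic_decode : acyclic D.
Proof.
move=> u v uv; apply/negP => /connectP[p pp eu].
have : (v <= u)%N.
  rewrite eu; elim: p v {uv eu} pp => //= w p IH v /andP[/arc_decode_lt vw /IH].
  lia.
have := arc_decode_lt uv; lia.
Qed.

(** The hypothesis [chain] joins each floor to the next one, so every floor is connected to the
    lowest. *)
Lemma components_decode : components D = 1%N.
Proof.
have adjC : connect_sym (@adjacent D).
  by apply: sym_connect_sym => u v; rewrite /adjacent orbC.
rewrite /components -[RHS](n_comp_connect adjC (Ordinal ha : floor D)).
apply: eq_n_comp_r => -[v va]; apply/esym; rewrite [RHS]inE.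
rewrite /in_mem /=.
elim: v va => [|v IH] va.
  by apply: eq_connect0; apply: val_inj.
have va' : (v < a)%N by lia.
apply: connect_trans (IH va') _; apply: connect1.
have /hasP[x xe /andP[/eqP xo /eqP xt]] : has (fun x => (lorigin x == v.+1) && (ltarget x == v.+2)) c.2.
  by apply: chain; lia.
have xi : (index x c.2 < size c.2)%N by rewrite index_mem.
apply/orP; left; apply/existsP; exists (Ordinal xi).
by rewrite (origin_decode lok) (target_decode lok) /data /= nth_index // xo xt !eqxx.
Qed.

Lemma decode_marked_floor_diagram (g : nat) :
  (count (lbounded a) c.2 + 1 - a)%N = g -> marked_floor_diagram P g D.
Proof.
move=> hg; case: (ok) => pL pR _ _ [cb ct dv].
have bnd (k : edge D) : bounded k = lbounded a (data k).
  rewrite /bounded (origin_decode_None lok) (target_decode_None lok) /lbounded lt0n.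
  by case/and5P: (data_ok lok k) => /andP[h1 h2] h3 _ _ _; congr (_ && _); lia.
have nL : size c.1.1 = a by rewrite (perm_size pL).
have nR : size c.1.2 = a by rewrite (perm_size pR).
have E1 (s : seq int) : size s = a -> [seq nth 0 s v | v : 'I_a <- enum 'I_a] = s.
  by move=> <-; rewrite (map_comp (nth 0 s) val) val_enum_ord -/(mkseq _ _) mkseq_nth.
split; first (split=> //).
- move=> k; rewrite bnd /is_sink /is_source.
  rewrite (origin_decode_None lok) (target_decode_None lok) /lbounded.
  by case/and5P: (data_ok lok k) => /andP[h1 h2] h3 _ _; lia.
- by move=> k; case/and5P: (data_ok lok k).
- move=> k; rewrite /is_sink /is_source.
  rewrite (origin_decode_None lok) (target_decode_None lok).
  case/and5P: (data_ok lok k) => /andP[h1 h2] h3 _ /implyP h _ h'.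
  by apply/eqP/h; move: h'; lia.
- by split; [exact: components_decode | exact: acyclic_decode].
- split.
  + by rewrite card_ord.
  + rewrite -ct; apply/esym/letters => k; rewrite (letter_decode lok srt) /is_sink.
    rewrite (origin_decode_None lok) (target_decode_None lok).
    by case/and5P: (data_ok lok k) => _ _ _ _; lia.
  + rewrite -cb; apply/esym/letters => k; rewrite (letter_decode lok srt) /is_source.
    rewrite (origin_decode_None lok) (target_decode_None lok).
    by case/and5P: (data_ok lok k) => _ _ _ _; lia.
  + by rewrite /codom /image_mem /= !E1.
  move=> v; have sumE p (q : pred (edge D)) : q =1 (fun k => p (letter_of k)) ->
      (\sum_(x <- c.2 | p x) lweight x = \sum_(k : edge D | q k) weight k)%N.
    by move=> qp; rewrite -[c in LHS]code_of_decode_ok (big_letters _ _ qp).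
  rewrite /divergence /= -dv // (sumE _ (fun k => target k == Some v)).
    rewrite (sumE _ (fun k => origin k == Some v)) // => k.
    by rewrite (origin_decode lok) (letter_decode lok srt).
  by move=> k; rewrite (target_decode lok) (letter_decode lok srt).
- exact: is_marking_decode.
rewrite /genus components_decode card_ord -hg; congr (_ + _ - _)%N.
by apply/esym/letters => k; rewrite bnd (letter_decode lok srt).
Qed.

End DecodeDiagram.

(** * Diagrams of codegree at most one *)

Section PrefixSums.

Definition psum (s : seq int) (i : nat) : int := \sum_(x <- take i s) x.

Lemma psum0 s : psum s 0 = 0.
Proof. by rewrite /psum take0 big_nil. Qed.

Lemma psumS s i : (i < size s)%N -> psum s i.+1 = psum s i + s`_i.
Proof. by move=> hi; rewrite /psum (take_nth 0 hi) -cats1 big_cat big_seq1. Qed.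

Lemma psum_oversize s i : (size s <= i)%N -> psum s i = \sum_(x <- s) x.
Proof. by move=> hi; rewrite /psum take_oversize. Qed.

Lemma eq_from_psum (s t : seq int) :
  size s = size t -> (forall i, (i <= size t)%N -> psum s i = psum t i) -> s = t.
Proof.
move=> st h; apply: (@eq_from_nth _ 0) => // i hi.
rewrite st in hi; have := h _ hi.
by rewrite !psumS ?st // h ?(ltnW hi) // => /addrI.
Qed.

Lemma sorted_nth_le (t : seq int) i j :
  sorted <=%R t -> (i <= j)%N -> (j < size t)%N -> t`_i <= t`_j.
Proof.
move=> srt ij jt; apply: (sorted_leq_nth le_trans le_refl) => //.
by rewrite inE (leq_ltn_trans ij).
Qed.

(* Truncating the entries at the value of [t] at [i], the first [i] entries of
   [s] sum to at least the sum of all the truncated entries. *)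
Lemma psum_sorted_le (s t : seq int) i : perm_eq s t -> sorted <=%R t -> psum t i <= psum s i.
Proof.
move=> pst srt; case: (leqP (size t) i) => hi.
  by rewrite !psum_oversize ?(perm_size pst) // (perm_big _ pst).
have hs : (i < size s)%N by rewrite (perm_size pst).
set m := t`_i.
have key u : (i < size u)%N -> psum u i = m *+ i + \sum_(x <- take i u) (x - m).
  by move=> hu; rewrite sumrB big_const_seq count_predT size_takel ?(ltnW hu) //
    iter_addr_0 addrC subrK.
rewrite !key // lerD2l.
have E : \sum_(x <- t) Num.min (x - m) 0 = \sum_(x <- take i t) (x - m).
  rewrite -{1}(cat_take_drop i t) big_cat /= [X in _ + X]big1_seq ?addr0.
    apply: eq_big_seq => x /(nthP 0)[j]; rewrite size_takel ?(ltnW hi) // => ji <-.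
    rewrite nth_take //; apply/min_idPl; rewrite subr_le0.
    by apply: sorted_nth_le => //; apply: ltnW.
  move=> x /(nthP 0)[j]; rewrite size_drop => ji <-.
  rewrite nth_drop; apply/min_idPr; rewrite subr_ge0.
  by apply: sorted_nth_le; rewrite ?leq_addr -?ltn_subRL.
rewrite -E -(perm_big _ pst) -{1}(cat_take_drop i s) big_cat /=.
have h1 : \sum_(x <- drop i s) Num.min (x - m) 0 <= 0.
  by apply: sumr_le0 => x _; rewrite ge_min lexx orbT.
have h2 : \sum_(x <- take i s) Num.min (x - m) 0 <= \sum_(x <- take i s) (x - m).
  by apply: ler_sum => x _; rewrite ge_min lexx.
by rewrite (le_trans (lerD h2 h1)) ?addr0.
Qed.

Definition swap (s : seq int) (k : nat) : seq int :=
  take k s ++ s`_k.+1 :: s`_k :: drop k.+2 s.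

(** These are the positions where exchanging two neighbours raises a single prefix sum, and raises
    it by exactly 1. *)
Definition ascents (s : seq int) : seq nat :=
  [seq k <- iota 0 (size s).-1 | s`_k.+1 == s`_k + 1].

Lemma split_at2 (s : seq int) k : (k.+1 < size s)%N ->
  s = take k s ++ s`_k :: s`_k.+1 :: drop k.+2 s.
Proof.
move=> hk; have hk' : (k < size s)%N by lia.
by rewrite -(drop_nth 0 hk) -(drop_nth 0 hk') cat_take_drop.
Qed.

Lemma perm_swap s k : (k.+1 < size s)%N -> perm_eq (swap s k) s.
Proof.
move=> hk; rewrite {2}(split_at2 hk) /swap perm_cat2l.
by rewrite -[X in perm_eq X]/([:: s`_k.+1] ++ [:: s`_k] ++ drop k.+2 s)
  -[X in perm_eq _ X]/([:: s`_k] ++ [:: s`_k.+1] ++ drop k.+2 s) perm_catCA.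
Qed.

Lemma size_swap s k : (k.+1 < size s)%N -> size (swap s k) = size s.
Proof. by move=> hk; apply: perm_size (perm_swap hk). Qed.

Lemma mem_ascents s k : (k \in ascents s) = (k.+1 < size s)%N && (s`_k.+1 == s`_k + 1).
Proof. by rewrite mem_filter mem_iota andbC; congr (_ && _); lia. Qed.

Lemma psum_swap s k i : k \in ascents s -> psum (swap s k) i = psum s i + (i == k.+1)%:R.
Proof.
rewrite mem_ascents => /andP[hk /eqP asc].
have st : size (take k s) = k by rewrite size_takel //; lia.
rewrite /psum [in RHS](split_at2 hk) /swap !take_cat st.
case: (ltnP i k) => ik; first by rewrite ltn_eqF ?addr0 // ltnW.
rewrite !big_cat /= -!addrA; congr (_ + _).
have -> : (i == k.+1) = (i - k == 1)%N by lia.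
by case: (i - k)%N => [|[|j]] /=; rewrite ?big_nil ?big_cons ?take0 ?big_nil ?addr0 ?asc //;
   rewrite addrCA.
Qed.

Lemma sum_eq1 (I : eqType) (r : seq I) (F : I -> int) :
  uniq r -> (forall i, i \in r -> 0 <= F i) -> \sum_(i <- r) F i = 1 ->
  exists2 i, i \in r & forall j, j \in r -> F j = (j == i)%:R.
Proof.
elim: r => [|x r IH] /=; first by rewrite big_nil.
move=> /andP[xr ur] F0; rewrite big_cons => s1.
have x0 : 0 <= F x by apply: F0; rewrite mem_head.
have r0 i : i \in r -> 0 <= F i by move=> ir; apply: F0; rewrite in_cons ir orbT.
have sr0 : 0 <= \sum_(i <- r) F i by rewrite big_seq; apply: sumr_ge0.
have [Fx|Fx] := eqVneq (F x) 0.
  rewrite Fx add0r in s1; have [i ir hi] := IH ur r0 s1.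
  exists i => [|j]; rewrite in_cons ?ir ?orbT // => /orP[/eqP ->|/hi //].
  by rewrite Fx; case: eqP ir xr => // -> ->.
move: s1 sr0; set S := \sum_(j <- r) F j => s1 sr0; have Fx1 : F x = 1 by lia.
exists x => [|j]; first exact: mem_head.
rewrite in_cons; case: (eqVneq j x) => [->//|jx] /= jr.
have s0 : \sum_(i <- r) F i = 0 by rewrite -/S; lia.
have := r0 j jr; have : F j <= \sum_(i <- r) F i.
  rewrite (big_rem j) //= lerDl big_seq; apply: sumr_ge0 => i ir.
  by apply: r0; apply: mem_rem ir.
by rewrite s0 => *; apply/le_anti/andP.
Qed.

(* The sums of squares of [s] and [t] agree, which forces the gap to be 1. *)
Lemma swap_of_deficit (s t : seq int) :
  perm_eq s t -> sorted <=%R t ->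
  \sum_(i <- iota 0 (size t).+1) (psum s i - psum t i) = 1 ->
  exists2 k, k \in ascents t & s = swap t k.
Proof.
move=> pst srt s1.
have d0 i : 0 <= psum s i - psum t i by rewrite subr_ge0 psum_sorted_le.
have [i ir hi] := sum_eq1 (iota_uniq _ _) (fun i _ => d0 i) s1.
have ss : size s = size t := perm_size pst.
rewrite mem_iota in ir.
(* The empty prefix and the full sum are the same for [s] and [t], so the only prefix sum that
   differs is at an inner position. *)
have i0 : i != 0%N.
  apply/eqP => e; have := hi 0%N; rewrite mem_iota e eqxx !psum0 subrr => /(_ isT); lia.
have ia : i != size t.
  apply/eqP => e; have := hi (size t); rewrite mem_iota e eqxx.
  rewrite !psum_oversize ?ss // (perm_big _ pst) /= subrr.
  by rewrite add0n ltnS leqnn => /(_ isT); lia.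
have E j : (j < size t)%N -> s`_j = t`_j + (j.+1 == i)%:R - (j == i)%:R.
  move=> hj; have := hi j.+1; have := hi j; rewrite !mem_iota !psumS ?ss //; lia.
pose k := i.-1; have ik : i = k.+1 by lia.
have hk : (k.+1 < size t)%N by lia.
have hks : (k.+1 < size s)%N by lia.
have Ek : s`_k = t`_k + 1 by rewrite E ?ik ?eqxx; lia.
have Ek1 : s`_k.+1 = t`_k.+1 - 1 by rewrite E ?ik ?eqxx; lia.
have asc : k \in ascents t.
  rewrite mem_ascents hk /=; apply/eqP.
  have tk : take k s = take k t.
    have sk : size (take k s) = k by rewrite size_takel //; lia.
    have st : size (take k t) = k by rewrite size_takel //; lia.
    apply: (@eq_from_nth _ 0); rewrite sk // => j jk.
    by rewrite !nth_take // E; lia.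
  have dk : drop k.+2 s = drop k.+2 t.
    apply: (@eq_from_nth _ 0); rewrite !size_drop ss // => j jk.
    by rewrite !nth_drop // E; lia.
  have sq : \sum_(x <- s) x * x = \sum_(x <- t) x * x by apply: perm_big.
  have splitsq (u : seq int) : (k.+1 < size u)%N -> \sum_(x <- u) x * x
      = \sum_(x <- take k u) x * x
        + (u`_k * u`_k + (u`_k.+1 * u`_k.+1 + \sum_(x <- drop k.+2 u) x * x)).
    by move=> hu; rewrite {1}(split_at2 hu) big_cat !big_cons.
  move: sq; rewrite (splitsq s hks) (splitsq t hk) tk dk Ek Ek1 => /addrI.
  rewrite !addrA => /addIr; move: (t`_k) (t`_k.+1) => u v; nia.
exists k => //; apply: eq_from_psum; first by rewrite size_swap // ss.
move=> j; rewrite size_swap // => hj; rewrite psum_swap // -ik -hi ?mem_iota; lia.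
Qed.

Lemma eq_of_deficit0 (s t : seq int) :
  perm_eq s t -> sorted <=%R t ->
  \sum_(i <- iota 0 (size t).+1) (psum s i - psum t i) = 0 -> s = t.
Proof.
move=> pst srt s0; apply: eq_from_psum; first exact: perm_size.
move=> i hi; apply/eqP; rewrite -subr_eq0; apply/eqP.
have d0 i' : 0 <= psum s i' - psum t i' by rewrite subr_ge0 psum_sorted_le.
have ir : (i \in iota 0 (size t).+1) by rewrite mem_iota.
move/eqP: s0; rewrite psumr_eq0 // => /allP/(_ i ir)/=.
by rewrite subr_eq0 => /eqP ->; rewrite subrr.
Qed.

End PrefixSums.

(** * Compositions and words of straight edges *)

Section Compositions.
Local Open Scope nat_scope.

Definition incr_head (c : seq nat) : seq nat := if c is x :: c' then x.+1 :: c' else [::].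

(* The compositions of m + 1. *)
Fixpoint compositions (m : nat) : seq (seq nat) :=
  if m is m'.+1 then
    [seq 1 :: c | c <- compositions m'] ++ [seq incr_head c | c <- compositions m']
  else [:: [:: 1]].

Lemma mem_compositions m c :
  (c \in compositions m) = all (fun x => 0 < x) c && (sumn c == m.+1).
Proof.
elim: m c => [|m IH] c.
  rewrite mem_seq1; case: c => [|[|[|x]] [|y c]] //=.
  - by apply/idP/andP => [/eqP[]|[/andP[y0 _] /eqP]] //; lia.
  - by apply/idP/andP => [/eqP[]|[/andP[y0 _] /eqP]] //; lia.
rewrite mem_cat; apply/orP/andP => [[/mapP[d] | /mapP[[|x d]]] | [c0 /eqP sc]].
- by rewrite IH => /andP[d0 /eqP sd] -> /=; rewrite d0 sd add1n eqxx.
- by rewrite IH.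
- by rewrite IH /= => /andP[/andP[x0 d0] /eqP sd] -> /=; rewrite d0 addSn sd eqxx.
case: c c0 sc => [|[|[|x]] c] //= c0 sc.
  by left; apply: map_f; rewrite IH c0; apply/eqP; lia.
right; apply/mapP; exists (x.+1 :: c) => //.
by rewrite IH /= c0; apply/eqP; lia.
Qed.

Lemma uniq_compositions m : uniq (compositions m).
Proof.
elim: m => // m IH /=; rewrite cat_uniq !map_inj_in_uniq ?IH //=.
- rewrite andbT; apply/hasPn => c /mapP[[|x d]]; rewrite mem_compositions //=.
  by move=> /andP[/andP[x0 _] _] ->; apply/mapP => -[? _ []]; lia.
- move=> [|x c] [|y d]; rewrite !mem_compositions //=.
  by move=> _ _ [-> ->].
- by move=> c d _ _ [].
Qed.

End Compositions.

Section Products.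
Variable T : eqType.

Fixpoint choices (Cs : seq (seq T)) : seq (seq T) :=
  if Cs is C :: Cs' then [seq x :: y | x <- C, y <- choices Cs'] else [:: [::]].

Lemma mem_choices Cs s :
  (s \in choices Cs) = (size s == size Cs) && all (fun p => p.1 \in p.2) (zip s Cs).
Proof.
elim: Cs s => [|C Cs IH] [|x s] //=.
  by apply/negP => /allpairsP[[? ?] [_ _]].
rewrite eqSS; apply/allpairsP/idP => [[[y t] /= [yC tC [-> ->]]]|].
  by move: tC; rewrite IH yC.
by case/and3P=> ss xC zC; exists (x, s); rewrite IH ss.
Qed.

Lemma uniq_choices Cs : all uniq Cs -> uniq (choices Cs).
Proof.
elim: Cs => //= C Cs IH /andP[uC uCs]; apply: allpairs_uniq => //; first exact: IH.
by move=> [x s] [y t] _ _ /= [-> ->].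
Qed.

Lemma big_choices (R : comPzSemiRingType) (C : nat -> seq T) (phi : nat -> T -> R)
    (x0 : T) (i m : nat) :
  \sum_(s <- choices [seq C j | j <- iota i m]) \prod_(j <- iota i m) phi j (nth x0 s (j - i))
  = \prod_(j <- iota i m) \sum_(x <- C j) phi j x.
Proof.
elim: m i => [|m IH] i /=; first by rewrite big_seq1 !big_nil.
rewrite big_cons big_allpairs_dep /= big_distrl /=; apply: eq_bigr => x _.
rewrite -IH big_distrr /=; apply: eq_bigr => s _; rewrite big_cons subnn /=; congr (_ * _).
apply: eq_big_seq => j; rewrite mem_iota => hj.
by have -> : (j - i = (j - i.+1).+1)%N by lia.
Qed.

End Products.

Section Words.
Local Open Scope nat_scope.
Variable a : nat.
Implicit Types (F : nat -> nat) (es : seq letter).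

(** Level [i] lies between the floors of ranks [i] and [i + 1]; levels 0 and [a] are below and above
    all floors. An edge from rank [o] to rank [t] crosses the levels [o] to [t - 1]. *)
Definition flow es i : nat := \sum_(x <- es | lorigin x <= i < ltarget x) lweight x.

Definition excess es : nat := \sum_(x <- es) lweight x * (ltarget x - lorigin x).-1.

Definition interior (i : nat) : bool := 0 < i < a.

(* The edge is marked between the two consecutive floors (or levels) that it
   joins; a diagram has excess 0 exactly when all its edges are straight. *)
Definition straight (x : letter) : bool :=
  [&& lorigin x == lgap x, ltarget x == (lgap x).+1, 0 < lweight x
    & interior (lgap x) || (lweight x == 1)].

Definition straight_letter (i w : nat) : letter := (i, (i, i.+1, w)).

(* [c] lists the weights of the straight edges in each gap from the i-th on. *)
Fixpoint layout (i : nat) (c : seq (seq nat)) : seq letter :=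
  if c is x :: c' then map (straight_letter i) x ++ layout i.+1 c' else [::].

(** The predecessor compensates for [compositions m] listing the compositions of [m + 1]; it is
    faithful only for [F i] positive, whence the positivity hypotheses below. The straight edges of
    the two extreme gaps are ends, all of weight 1, which leaves a single possibility. *)
Definition slot F i : seq (seq nat) :=
  if interior i then compositions (F i).-1 else [:: nseq (F i) 1].

Definition words_from F i m : seq (seq letter) :=
  map (layout i) (choices [seq slot F j | j <- iota i m]).

Definition words F : seq (seq letter) := words_from F 0 a.+1.

Definition gap_weight es i : nat := \sum_(x <- es | lgap x == i) lweight x.

Lemma mem_slot F i x : 0 < F i ->
  (x \in slot F i) = [&& all (fun w => 0 < w) x, all (fun w => interior i || (w == 1)) x
                       & sumn x == F i].
Proof.
move=> Fi; rewrite /slot; case: ifP => hi /=.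
  by rewrite mem_compositions prednK // all_predT.
rewrite mem_seq1; apply/eqP/and3P => [->|[_ /all_pred1P -> /eqP]].
  by rewrite !all_nseq sumn_nseq mul1n !orbT eqxx.
by rewrite sumn_nseq mul1n => ->.
Qed.

Lemma uniq_slot F i : uniq (slot F i).
Proof. by rewrite /slot; case: ifP => // _; apply: uniq_compositions. Qed.

Lemma gap_sorted_pairwise es :
  gap_sorted es = pairwise (fun x y => lgap x <= lgap y) es.
Proof. by rewrite /gap_sorted sorted_pairwise // => x y z; apply: leq_trans. Qed.

Lemma gap_sorted_cat es es' :
  gap_sorted (es ++ es')
  = [&& allrel (fun x y => lgap x <= lgap y) es es', gap_sorted es & gap_sorted es'].
Proof. by rewrite !gap_sorted_pairwise pairwise_cat. Qed.

Lemma split_min_gap es i : gap_sorted es -> all (fun x => i <= lgap x) es ->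
  es = [seq x <- es | lgap x == i] ++ [seq x <- es | lgap x != i].
Proof.
elim: es => //= x es IH ps /andP[xi es_i].
have xs : all (fun y => lgap x <= lgap y) es.
  by apply: order_path_min ps => u v w; apply: leq_trans.
case: eqP => xi' /=; first by rewrite -IH //; apply: path_sorted ps.
rewrite (@eq_in_filter _ _ pred0) ?filter_pred0 /= => [|y ys].
  congr (_ :: _); apply/esym/all_filterP/allP => y ys.
  by move/allP: xs => /(_ y ys); lia.
by move/allP: xs => /(_ y ys); apply/contraTF => /eqP; lia.
Qed.

Lemma layout_gap i c : all (fun x => i <= lgap x < i + size c) (layout i c).
Proof.
elim: c i => //= x c IH i; rewrite all_cat all_map; apply/andP; split.
  by apply/allP => w _ /=; lia.
by apply: sub_all (IH i.+1) => y; lia.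
Qed.

Lemma filter_layout i x c :
  [seq y <- layout i (x :: c) | lgap y == i] = map (straight_letter i) x.
Proof.
rewrite /= filter_cat filter_map (@eq_filter _ _ predT) ?filter_predT; last first.
  by move=> w /=; rewrite /lgap /= eqxx.
rewrite (@eq_in_filter _ _ pred0) ?filter_pred0 ?cats0 // => y.
by move/(allP (layout_gap i.+1 c)) => h; apply/negbTE/eqP; lia.
Qed.

Lemma layout_inj i c d : size c = size d -> layout i c = layout i d -> c = d.
Proof.
elim: c d i => [|x c IH] [|y d] //= i [scd] e.
have exy : map (straight_letter i) x = map (straight_letter i) y.
  by rewrite -(filter_layout i x c) -(filter_layout i y d) /= e.
have -> : x = y by move: exy; apply: inj_map => u v [].
congr (_ :: _); apply: (IH _ i.+1) => //.
by apply/eqP; move/eqP: e; rewrite exy eqseq_cat // eqxx.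
Qed.

Lemma uniq_words_from F i m : uniq (words_from F i m).
Proof.
rewrite map_inj_in_uniq; last first.
  move=> c d; rewrite !mem_choices => /andP[/eqP sc _] /andP[/eqP sd _].
  by apply: layout_inj; rewrite sc sd.
by apply: uniq_choices; rewrite all_map; apply/allP => j _; apply: uniq_slot.
Qed.

(** Induction on the number of gaps: in a sorted word the letters of lowest gap form a prefix, whose
    weights are an element of the first slot. *)
Lemma mem_words_from F i m es : (forall j, i <= j < i + m -> 0 < F j) ->
  (es \in words_from F i m) =
  [&& gap_sorted es, all straight es, all (fun x => i <= lgap x < i + m) es
    & all (fun j => gap_weight es j == F j) (iota i m)].
Proof.
elim: m i es => [|m IH] i es F0.
  rewrite /words_from /= mem_seq1 andbT; apply/eqP/and3P => [-> //|[_ _]].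
  by case: es => //= x es /andP[]; lia.
have F0' j : i.+1 <= j < i.+1 + m -> 0 < F j by move=> hj; apply: F0; lia.
have Fi : 0 < F i by apply: F0; lia.
have mem_cat : (es \in words_from F i m.+1) <->
    exists x y, [/\ x \in slot F i, y \in words_from F i.+1 m
                  & es = map (straight_letter i) x ++ y].
  split.
    case/mapP=> c /= /allpairsP[[x d] /= [xs dd ->]] ->.
    by exists x, (layout i.+1 d); split=> //; apply: map_f.
  case=> x [y [xs /mapP[d dd ->] ->]].
  by apply/mapP; exists (x :: d) => //=; apply/allpairsP; exists (x, d).
have wcat x y j : gap_weight (map (straight_letter i) x ++ y) j
    = (if i == j then sumn x else 0) + gap_weight y j.
  rewrite /gap_weight big_cat /= big_map; congr (_ + _).
  rewrite (eq_bigl (fun=> i == j)) // sumnE; case: eqP => _; first by [].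
  by rewrite big_pred0_eq.
apply/idP/and4P.
  case/mem_cat=> x [y [xs]]; rewrite IH // => /and4P[sy ty ry wy] ->.
  move: xs; rewrite mem_slot // => /and3P[x0 x1 /eqP sx].
  have y_gt : all (fun u => i < lgap u) y by apply: sub_all ry => u; lia.
  split.
  - rewrite gap_sorted_cat sy andbT; apply/andP; split.
      apply/allrelP => u v /mapP[w _ ->] vy.
      by move/allP: y_gt => /(_ v vy) /ltnW.
    rewrite gap_sorted_pairwise pairwise_map; apply/(pairwiseP 0) => ? ? ? ? ? /=.
    by rewrite leqnn.
  - rewrite all_cat ty andbT all_map; apply/allP => w wx /=.
    rewrite /straight /= /lgap /= !eqxx /=.
    by move/allP: x0 => /(_ w wx) ->; move/allP: x1 => /(_ w wx) ->.
  - rewrite all_cat all_map; apply/andP; split; first by apply/allP => w _ /=; rewrite /lgap /=; lia.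
    by apply: sub_all ry => u; lia.
  rewrite /= wcat eqxx sx; apply/andP; split.
    rewrite /gap_weight big_seq_cond big_pred0 ?addn0 // => u; apply/negbTE/negP.
    by move=> /andP[uy /eqP ui]; move/allP: y_gt => /(_ u uy); lia.
  apply/allP => j jm; rewrite wcat; move/allP: wy => /(_ j jm) /eqP ->.
  by move: jm; rewrite mem_iota => /andP[ij _]; rewrite (ltn_eqF ij) add0n eqxx.
case=> sE tE rE /= /andP[/eqP wi wE].
have iE : all (fun x => i <= lgap x) es by apply: sub_all rE => x; lia.
apply/mem_cat; set e1 := [seq x <- es | lgap x == i]; set e2 := [seq x <- es | lgap x != i].
have eE : es = e1 ++ e2 by apply: split_min_gap.
have e1E : e1 = map (straight_letter i) (map lweight e1).
  rewrite -map_comp -[LHS]map_id; apply/eq_in_map => x.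
  rewrite mem_filter => /andP[/eqP xi xE]; move/allP: tE => /(_ x xE).
  rewrite /straight; case/and4P; move: x xi {xE} => [g [[o t] w]] /=.
  by rewrite /lgap /lorigin /ltarget /lweight /= => -> /eqP -> /eqP ->.
have rest j : i < j -> gap_weight e2 j = gap_weight es j.
  move=> ij; rewrite /gap_weight /e2 big_filter_cond; apply: eq_bigl => x.
  by case: (eqVneq (lgap x) j) => [->|]; rewrite ?andbF ?andbT //; lia.
exists (map lweight e1), e2; split; last by rewrite -e1E.
- rewrite mem_slot // !all_map; apply/and3P; split.
  + apply/allP => x; rewrite mem_filter => /andP[_ xE].
    by move/allP: tE => /(_ x xE) /and4P[].
  + apply/allP => x; rewrite mem_filter => /andP[/eqP xi xE] /=.
    by move/allP: tE => /(_ x xE) /and4P[_ _ _]; rewrite xi.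
  by rewrite sumnE big_map big_filter -wi.
rewrite IH //; apply/and4P; split.
- move: sE; rewrite {1}eE gap_sorted_cat => /and3P[] //.
- by apply/allP => x; rewrite mem_filter => /andP[_]; move/allP: tE; apply.
- apply/allP => x; rewrite mem_filter => /andP[xi xE].
  by move/allP: rE => /(_ x xE); lia.
apply/allP => j jm; rewrite rest; first by move/allP: wE; apply.
by move: jm; rewrite mem_iota; lia.
Qed.

Lemma straight_ok x : 0 < a -> lgap x <= a -> straight x -> letter_ok a x.
Proof.
move=> a0 xa /and4P[/eqP ho /eqP ht hw]; rewrite /interior => hi.
by apply/and5P; split; rewrite ?ho ?ht //; lia.
Qed.

Lemma ok_straight x : letter_ok a x -> (ltarget x - lorigin x).-1 = 0 -> straight x.
Proof.
case/and5P=> /andP[h1 h2] h3 h4 /implyP h5 h6 e.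
have eg : lorigin x = lgap x by lia.
have et : ltarget x = (lgap x).+1 by lia.
rewrite /straight eg et !eqxx h4 /=; case: (boolP (interior _)) => //=.
by rewrite /interior => hi; apply: h5; lia.
Qed.

Lemma flow_straight es i : all straight es -> flow es i = gap_weight es i.
Proof.
move=> /allP sE; rewrite /flow /gap_weight big_seq_cond [RHS]big_seq_cond.
apply: eq_bigl => x; case xE: (x \in es) => //=.
by case/and4P: (sE x xE) => /eqP -> /eqP -> _ _; lia.
Qed.

(** Conservation at the floor of rank [j + 1]: going up, the edges that end there leave the flow and
    those that start there enter it. *)
Lemma flow_step es j : all (letter_ok a) es ->
  flow es j + \sum_(x <- es | lorigin x == j.+1) lweight x
  = flow es j.+1 + \sum_(x <- es | ltarget x == j.+1) lweight x.
Proof.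
move=> /allP ok; rewrite /flow !(big_mkcond (fun x => _ <= _ < _)).
rewrite !(big_mkcond (fun x => _ == _)) -!big_split /=.
apply: eq_big_seq => x /ok /and5P[/andP[h1 h2] _ _ _ _].
by do ![case: ifP => ?]; lia.
Qed.

Lemma flow0 es : all (letter_ok a) es -> flow es 0 = count (fun x => lorigin x == 0) es.
Proof.
move=> /allP ok; rewrite /flow -sum1_count big_seq_cond [RHS]big_seq_cond.
rewrite (eq_bigl (fun x => (x \in es) && (lorigin x == 0))); last first.
  by move=> x; case xE: (x \in es) => //=; case/and5P: (ok x xE) => /andP[h1 h2] _ _ _ _; lia.
apply: eq_bigr => x /andP[/ok /and5P[_ _ _ /implyP h _] o0].
by apply/eqP/h; rewrite o0.
Qed.

Lemma flow_last es : all (letter_ok a) es ->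
  flow es a = count (fun x => ltarget x == a.+1) es.
Proof.
move=> /allP ok; rewrite /flow -sum1_count big_seq_cond [RHS]big_seq_cond.
rewrite (eq_bigl (fun x => (x \in es) && (ltarget x == a.+1))); last first.
  by move=> x; case xE: (x \in es) => //=; case/and5P: (ok x xE) => /andP[h1 h2] ? _ _ _; lia.
apply: eq_bigr => x /andP[/ok /and5P[_ _ _ /implyP h _] o0].
by apply/eqP/h; rewrite o0 orbT.
Qed.

Lemma count_between o t N : count (fun i => o <= i < t) (iota 0 N) = minn t N - o.
Proof.
elim: N => [|N IH]; first by rewrite /=; lia.
by rewrite -addn1 iotaD count_cat IH /= add0n; case: (boolP (o <= N < t)); lia.
Qed.

(** Double counting: an edge crosses one level more than the number of floors that it jumps over. *)
Lemma sum_flow es : all (letter_ok a) es ->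
  \sum_(i <- iota 0 a.+1) flow es i = \sum_(x <- es) lweight x + excess es.
Proof.
move=> /allP ok; rewrite /flow (exchange_big_dep xpredT) // /excess -big_split /=.
apply: eq_big_seq => x /ok /and5P[/andP[h1 h2] h3 _ _ _].
by rewrite -[_ :: _]/(iota 0 a.+1) big_const_seq iter_addn_0 count_between; nia.
Qed.

Lemma sum_weight es : all (letter_ok a) es ->
  \sum_(x <- es) lweight x = \sum_(x <- es | lbounded a x) lweight x
    + count (fun x => lorigin x == 0) es + count (fun x => ltarget x == a.+1) es.
Proof.
move=> /allP ok; rewrite -!sum1_count !(big_mkcond (fun x => _ == _)).
rewrite (big_mkcond (lbounded a)) -!big_split /=.
apply: eq_big_seq => x /ok /and5P[/andP[h1 h2] h3 h4 /implyP h5]; rewrite /lbounded.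
by move: h5; do ![case: ifP => ?] => h5 //; try (have := h5 isT); lia.
Qed.

Lemma mem_words F es : 0 < a -> (forall j, j <= a -> 0 < F j) ->
  (es \in words F) <->
  [/\ gap_sorted es, all (letter_ok a) es, excess es = 0 & forall j, j <= a -> flow es j = F j].
Proof.
move=> a0 F0; rewrite /words mem_words_from; last by move=> j; rewrite add0n ltnS => /F0.
split=> [/and4P[sE tE rE /allP wE]|[sE oE eE fE]].
  split=> //.
  - apply/allP => x xE; apply: straight_ok => //; last by move/allP: tE; apply.
    by move/allP: rE => /(_ x xE); lia.
  - rewrite /excess big1_seq // => x /andP[_ xE]; move/allP: tE => /(_ x xE).
    by case/and4P=> /eqP -> /eqP -> _ _; lia.
  by move=> j ja; rewrite flow_straight //; apply/eqP/wE; rewrite mem_iota.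
have tE : all straight es.
  apply/allP => x xE; apply: ok_straight; first by move/allP: oE; apply.
  move: eE; rewrite /excess (big_rem x) //=.
  by move/allP: oE => /(_ x xE) /and5P[_ _ w0 _ _]; nia.
apply/and4P; split=> //.
  by apply/allP => x xE; move/allP: oE => /(_ x xE) /and5P[/andP[h1 h2] h3 _ _ _]; lia.
by apply/allP => j; rewrite mem_iota -flow_straight // => ja; apply/eqP/fE; lia.
Qed.

End Words.

(** * Diagrams with a single edge jumping over one floor *)

Section Deviants.
Local Open Scope nat_scope.
Variable a : nat.
Implicit Types (F : nat -> nat) (es : seq letter).

(* An edge of weight 1 from level [o = q.1] to level [o + 2], jumping over one
   floor and marked in one of the two gaps [q.2] that it meets. *)
Definition dev_letter (q : nat * nat) : letter := (q.2, (q.1, q.1.+2, 1)).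

Definition insert (x : letter) (p : nat) es : seq letter := take p es ++ x :: drop p es.

Definition dev_flow F (o j : nat) : nat := F j - ((j == o) || (j == o.+1)).

Definition dev_index : seq (nat * nat) := [seq (o, i) | o <- iota 0 a, i <- [:: o; o.+1]].

(** A word remains sorted exactly when the new letter is inserted inside, or at an end of, the block
    of letters of its gap: one position more than the size of the block. *)
Definition dev_slots F (q : nat * nat) : seq (seq letter * nat) :=
  [seq (es, p) | es <- words a (dev_flow F q.1),
                 p <- iota (count (fun x => lgap x < q.2) es)
                           (count (fun x => lgap x == q.2) es).+1].

Definition dev_data F : seq ((nat * nat) * (seq letter * nat)) :=
  [seq (q, t) | q <- dev_index, t <- dev_slots F q].

Definition deviants F : seq (seq letter) :=
  [seq insert (dev_letter u.1) u.2.2 u.2.1 | u <- dev_data F].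

Lemma mem_dev_index q : (q \in dev_index) = (q.1 < a) && ((q.2 == q.1) || (q.2 == q.1.+1)).
Proof.
case: q => o i /=; apply/allpairsPdep/idP => [[o' [i' [/= + + [-> ->]]]]|].
  by rewrite mem_iota !inE => /andP[_ ->].
by case/andP=> oa oi; exists o, i; rewrite mem_iota !inE.
Qed.

Lemma mem_dev_data F q es p : ((q, (es, p)) \in dev_data F) =
  [&& q \in dev_index, es \in words a (dev_flow F q.1),
      count (fun x => lgap x < q.2) es <= p
    & p <= count (fun x => lgap x < q.2) es + count (fun x => lgap x == q.2) es].
Proof.
apply/allpairsPdep/and4P => [[q' [t [qi + [-> et]]]]|[qi ei p1 p2]].
  rewrite -{t}et => /allpairsPdep[es' [p' [ei + [-> ->]]]].
  by rewrite mem_iota addnS ltnS => /andP[].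
exists q, (es, p); split=> //; apply/allpairsPdep; exists es, p; split=> //.
by rewrite mem_iota p1 addnS ltnS.
Qed.

Lemma uniq_dev_data F : uniq (dev_data F).
Proof.
apply: allpairs_uniq_dep => [|q _|].
- apply: allpairs_uniq_dep; rewrite ?iota_uniq //.
  + by move=> o _ /=; rewrite !inE andbT; lia.
  + by move=> [o i] [o' i'] _ _ /= [-> ->].
- apply: allpairs_uniq_dep => [|es _|].
  + exact: uniq_words_from.
  + exact: iota_uniq.
  + by move=> [o i] [o' i'] _ _ /= [-> ->].
by move=> [o i] [o' i'] _ _ /= [-> ->].
Qed.

Lemma words_straight F es : (forall j, j <= a -> 0 < F j) -> es \in words a F -> all (straight a) es.
Proof.
move=> F0; rewrite /words mem_words_from; first by case/and4P.
by move=> j; rewrite add0n ltnS => /F0.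
Qed.

Lemma dev_letter_crooked q : ~~ straight a (dev_letter q).
Proof.
by apply/negP => /and4P[]; rewrite /lorigin /ltarget /lgap /=; lia.
Qed.

Lemma dev_flow_gt0 F o : (forall j, j <= a -> 1 < F j) -> forall j, j <= a -> 0 < dev_flow F o j.
Proof. by move=> F1 j /F1; rewrite /dev_flow; case: (_ || _); lia. Qed.

(** The inserted letter is the only one that is not straight, so the letter, its position and the
    remaining word can all be read off the result. *)
Lemma uniq_deviants F : (forall j, j <= a -> 1 < F j) -> uniq (deviants F).
Proof.
move=> F1; rewrite map_inj_in_uniq ?uniq_dev_data //.
have key q es p : (q, (es, p)) \in dev_data F ->
    let w := insert (dev_letter q) p es in
    [/\ filter (straight a) w = es, filter (predC (straight a)) w = [:: dev_letter q]
      & find (predC (straight a)) w = p].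
  rewrite mem_dev_data => /and4P[_ ei _ p2].
  have se : all (straight a) es by apply: words_straight ei; apply: dev_flow_gt0.
  have ps : p <= size es.
    apply: leq_trans p2 _; rewrite -count_predUI.
    rewrite [X in _ + X](@eq_count _ _ pred0) => [|x /=]; last by lia.
    by rewrite count_pred0 addn0 count_size.
  have nse : filter (predC (straight a)) es = [::].
    by apply/eqP; rewrite -[_ == _]negbK -has_filter has_predC se.
  rewrite /= /insert; split.
  - by rewrite filter_cat /= (negPf (dev_letter_crooked q)) -filter_cat cat_take_drop; apply/all_filterP.
  - move: nse; rewrite -{1}(cat_take_drop p es) !filter_cat /= dev_letter_crooked.
    by case: filter => //= ->.
  rewrite find_cat; have -> /= : has (predC (straight a)) (take p es) = false.
    rewrite has_predC; apply/negbTE; rewrite negbK.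
    by apply/allP => x /mem_take; move/allP: se; apply.
  by rewrite dev_letter_crooked addn0 size_takel.
move=> [q [es p]] [q' [es' p']] /key /= [k1 k2 k3] /key /= [k1' k2' k3'] e.
have Ee : es = es' by rewrite -k1 e k1'.
have Ep : p = p' by rewrite -k3 e k3'.
have : [:: dev_letter q] = [:: dev_letter q'] by rewrite -k2 e k2'.
rewrite Ee Ep; case: q q' {k1 k2 k3 k1' k2' k3' e} => o i [o' i'] [-> ->].
by [].
Qed.

Lemma sum_nat_eq1 (T : eqType) (s : seq T) (f : T -> nat) : \sum_(x <- s) f x = 1 ->
  exists s1 x s2, [/\ s = s1 ++ x :: s2, f x = 1, all (fun y => f y == 0) s1
                    & all (fun y => f y == 0) s2].
Proof.
elim: s => [|x s IH]; first by rewrite big_nil.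
rewrite big_cons; case fx: (f x) => [|[|m]] e; last by lia.
  have [s1 [y [s2 [-> fy h1 h2]]]] := IH e.
  by exists (x :: s1), y, s2; rewrite /= fx eqxx.
exists [::], x, s; split=> //; have {}e : \sum_(x <- s) f x = 0 by lia.
apply/allP => y ys; move: e; rewrite (big_rem y) //= => /eqP.
by rewrite addn_eq0 => /andP[].
Qed.

Lemma perm_insert x p es : perm_eq (insert x p es) (x :: es).
Proof. by rewrite /insert perm_catC /= perm_cons perm_catC cat_take_drop. Qed.

Lemma excess_perm es es' : perm_eq es es' -> excess es = excess es'.
Proof. by move=> p; apply: perm_big. Qed.

Lemma flow_perm es es' i : perm_eq es es' -> flow es i = flow es' i.
Proof. by move=> p; apply: perm_big. Qed.

Lemma excess_cons x es : excess (x :: es) = lweight x * (ltarget x - lorigin x).-1 + excess es.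
Proof. by rewrite /excess big_cons. Qed.

Lemma flow_cons x es i :
  flow (x :: es) i = (lorigin x <= i < ltarget x) * lweight x + flow es i.
Proof. by rewrite /flow big_cons; case: ifP; rewrite ?mul1n. Qed.

Lemma gap_sorted_insert x p es : gap_sorted es ->
  gap_sorted (insert x p es) = all (fun y => lgap y <= lgap x) (take p es)
                               && all (fun y => lgap x <= lgap y) (drop p es).
Proof.
rewrite -{1}(cat_take_drop p es) gap_sorted_cat => /and3P[h1 h2 h3].
rewrite /insert gap_sorted_cat h2 andTb.
rewrite [gap_sorted (x :: _)]gap_sorted_pairwise pairwise_cons -gap_sorted_pairwise h3 andbT.
congr (_ && _); rewrite /allrel; apply/idP/idP => /allP h; apply/allP => y yt.
  by have /= /andP[] := h y yt.
by rewrite /= h //=; move/allrelP: h1 => h1; apply/allP => z zt; apply: h1.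
Qed.

Lemma mem_deviants F es : 1 < a -> (forall j, j <= a -> 1 < F j) ->
  (es \in deviants F) <->
  [/\ gap_sorted es, all (letter_ok a) es, excess es = 1 & forall j, j <= a -> flow es j = F j].
Proof.
move=> a1 F1; split.
  case/mapP=> -[[o i] [S p]]; rewrite mem_dev_data mem_dev_index /=.
  move=> /and4P[/andP[oa oi] SW p1 p2] ->.
  have [sS oS eS fS] := (mem_words S (ltnW a1) (dev_flow_gt0 o F1)).1 SW.
  have pi := perm_insert (dev_letter (o, i)) p S.
  split.
  - rewrite gap_sorted_insert //.
    have ps : p <= size S.
      apply: leq_trans p2 _; rewrite -count_predUI.
      rewrite [X in _ + X](@eq_count _ _ pred0) => [|x /=]; last by lia.
      by rewrite count_pred0 addn0 count_size.
    apply/andP; split; apply/allP => x /(nthP letter0)[k].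
      rewrite size_takel // => kp <-; rewrite nth_take // sorted_le_count //; last exact: leq_trans kp ps.
      apply: leq_trans kp (leq_trans p2 _); rewrite -count_predUI.
      rewrite [X in _ + X](@eq_count _ _ pred0) => [|y /=]; last by lia.
      by rewrite count_pred0 addn0; apply: sub_count => y /=; rewrite /lgap /=; lia.
    rewrite size_drop => kp <-; rewrite nth_drop leqNgt /lgap /= -/(lgap _).
    case: i oi p1 {p2 SW pi} => // i oi p1.
    rewrite ltnS sorted_le_count //; last by rewrite -ltn_subRL.
    rewrite -leqNgt; apply: leq_trans (leq_addr _ _); apply: leq_trans p1.
    by apply: sub_count => y /=; lia.
  - rewrite (perm_all _ pi) /= oS andbT; apply/and5P; split=> //.
    + by rewrite /lorigin /ltarget /lgap /=; lia.
    + by apply/implyP.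
    (* With a single floor, an edge jumping over it would be both a source and a sink. *)
    + by rewrite /lorigin /ltarget /=; lia.
  - by rewrite (excess_perm pi) excess_cons eS /lweight /ltarget /lorigin /=; lia.
  move=> j ja; rewrite (flow_perm _ pi) flow_cons fS // /dev_flow.
  by have := F1 j ja; rewrite /lorigin /ltarget /lweight /=; case: (boolP (_ || _)); lia.
case=> sE oE eE fE.
(* Exactly one letter contributes to the excess. Its contribution 1 is a product of its weight and
   of the number of floors jumped over, so both are 1. *)
have [s1 [x [s2 [Ees xe h1 h2]]]] := sum_nat_eq1 eE.
have xE : x \in es by rewrite Ees mem_cat mem_head orbT.
have okx : letter_ok a x by move/allP: oE; apply.
case: (and5P okx) => /andP[x1 x2] x3 x4 _ x6.
have xw : lweight x = 1 by nia.
have xt : ltarget x = (lorigin x).+2 by rewrite xw in xe; lia.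
have xD : x = dev_letter (lorigin x, lgap x).
  move: xw xt; case: (x) => [g [[o t] w]]; rewrite /lweight /ltarget /lorigin /lgap /=.
  by move=> -> ->.
set o := lorigin x in xt xD *; set i := lgap x in xD *.
pose S := s1 ++ s2; pose p := size s1.
have esE : es = insert x p S by rewrite /insert /p /S take_size_cat // drop_size_cat.
have subS : subseq S es by rewrite Ees cat_subseq // subseq_cons.
have pS : perm_eq es (x :: S) by rewrite esE perm_insert.
have sS : gap_sorted S.
  by apply: subseq_sorted subS sE => u v w; apply: leq_trans.
have oS : all (letter_ok a) S.
  by apply/allP => y /(mem_subseq subS); move/allP: oE; apply.
have eS : excess S = 0.
  by have := excess_perm pS; rewrite excess_cons eE xe add1n => -[].
have fS j : j <= a -> flow S j = dev_flow F o j.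
  move=> ja; have := flow_perm j pS; rewrite flow_cons fE // xw xt -/o /dev_flow.
  by move: (F1 j ja); move: (flow S j) (F j) (o) => u v k; clear; case: (boolP (_ || _)); lia.
have SW : S \in words a (dev_flow F o).
  by apply/(mem_words S (ltnW a1) (dev_flow_gt0 o F1)).
apply/mapP; exists ((o, i), (S, p)); last by rewrite /= -xD.
have /andP[/allP t1 /allP t2] : all (fun y => lgap y <= lgap x) s1 && all (fun y => lgap x <= lgap y) s2.
  move: sE; rewrite esE gap_sorted_insert // /p /S take_size_cat // drop_size_cat //.
rewrite mem_dev_data mem_dev_index /= SW /=; apply/and3P; split.
  by move: x1 x2 x3; rewrite xt -/o -/i; move: (o) (i); clear; lia.
  rewrite /S count_cat [X in _ + X](@eq_in_count _ _ pred0) ?count_pred0 ?addn0 ?count_size //.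
  by move=> y /t2; rewrite -/i /=; move: (i) (lgap y); clear; lia.
rewrite /S !count_cat.
have : count (fun y => lgap y < i) s1 + count (fun y => lgap y == i) s1 = p.
  rewrite -count_predUI [X in _ + X](@eq_count _ _ pred0) => [|y /=].
    rewrite count_pred0 addn0 /p; apply/eqP; rewrite -all_count; apply/allP => y /t1 /=.
    by rewrite -/i; move: (i) (lgap y); clear; lia.
  by move: (i) (lgap y); clear; lia.
by move=> <-; rewrite addnACA leq_addr.
Qed.

End Deviants.

(** * Classification of the codes of codegree 0 and 1 *)

Section Classification.
Variables (a bt bb : nat) (sL sR : seq int) (W : nat -> nat).
Hypothesis a_gt1 : (1 < a)%N.
Hypothesis size_sL : size sL = a.
Hypothesis size_sR : size sR = a.
Hypothesis sorted_sL : sorted <=%R sL.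
Hypothesis sorted_sR : sorted <=%R sR.
Hypothesis W_psum : forall i, (i <= a)%N -> (W i)%:Z = bb%:Z - psum sL i - psum sR i.
Hypothesis W_top : W a = bt.
Hypothesis W_gt2 : forall i, (i <= a)%N -> (2 < W i)%N.

Implicit Types (c : code) (es : seq letter).

Definition deficit (s t : seq int) : int :=
  \sum_(i <- iota 0 (size t).+1) (psum s i - psum t i).

(* The largest power of x dividing the contribution of the diagram to BGtilde. *)
Definition codegree c : int := (excess c.2)%:Z + deficit c.1.1 sL + deficit c.1.2 sR.

Lemma deficit_ge0 s t : perm_eq s t -> sorted <=%R t -> 0 <= deficit s t.
Proof. by move=> p st; apply: sumr_ge0 => i _; rewrite subr_ge0 psum_sorted_le. Qed.

Lemma deficitxx s : deficit s s = 0.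
Proof. by rewrite /deficit big1 // => i _; rewrite subrr. Qed.

Lemma deficit_swap s k : k \in ascents s -> deficit (swap s k) s = 1.
Proof.
move=> ks; have := ks; rewrite mem_ascents => /andP[hk _].
rewrite /deficit (bigD1_seq k.+1) ?iota_uniq ?mem_iota //=; last by lia.
rewrite psum_swap // eqxx big1 ?addr0 => [|i ik]; first by rewrite [psum s _ + _]addrC addrK.
by rewrite psum_swap // (negPf ik) addr0 subrr.
Qed.

(** Adding up the divergences of the lowest floors, level by level, turns the conditions at the
    floors into prescribed flows. At the last level the flow is the number of sinks, and [W_top]
    gives its value. *)
Lemma code_okP c : perm_eq c.1.1 sL -> perm_eq c.1.2 sR ->
  code_ok a bt bb sL sR c <->
  [/\ gap_sorted c.2, all (letter_ok a) c.2
    & forall i, (i <= a)%N -> (flow c.2 i)%:Z = bb%:Z - psum c.1.1 i - psum c.1.2 i].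
Proof.
move=> pL pR; have nL := perm_size pL; have nR := perm_size pR.
rewrite size_sL in nL; rewrite size_sR in nR.
split=> [[_ _ sE oE [cb ct dv]]|[sE oE fE]].
  split=> //; elim=> [|i IH] ia; first by rewrite (flow0 oE) cb !psum0 !subr0.
  have := flow_step i oE; have := dv i ia; rewrite !psumS ?nL ?nR //.
  by have := IH (ltnW ia); lia.
split=> //; split.
- by rewrite -(flow0 oE); have := fE 0%N isT; rewrite !psum0; lia.
- rewrite -(flow_last oE) -W_top; have := fE a (leqnn _); have := W_psum (leqnn a).
  rewrite !psum_oversize ?nL ?nR ?size_sL ?size_sR //.
  have sumL : \sum_(x <- c.1.1) x = \sum_(x <- sL) x by apply: perm_big.
  have sumR : \sum_(x <- c.1.2) x = \sum_(x <- sR) x by apply: perm_big.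
  by rewrite sumL sumR => <- [].
move=> j ja; have := flow_step j oE; have := fE j (ltnW ja); have := fE j.+1 ja.
by rewrite !psumS ?nL ?nR //; lia.
Qed.

(** The flow at level [i] is [W i] lowered by what the prefix sums of the two orderings exceed the
    sorted ones; summing over all levels produces the deficits, and [sum_flow] the excess. *)
Lemma codegreeE c : code_ok a bt bb sL sR c ->
  (\sum_(i <- iota 0 a.+1) W i)%N%:Z
  = (\sum_(x <- c.2 | lbounded a x) lweight x)%N%:Z + bb%:Z + bt%:Z + codegree c.
Proof.
move=> ok; case: (ok) => pL pR sE oE [cb ct dv].
have [_ _ fE] := (code_okP pL pR).1 ok.
have E : (\sum_(i <- iota 0 a.+1) W i)%N%:Z
    = (\sum_(i <- iota 0 a.+1) flow c.2 i)%N%:Z + deficit c.1.1 sL + deficit c.1.2 sR.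
  have rP i : i \in iota 0 a.+1 -> (i <= a)%N by rewrite mem_iota.
  rewrite /deficit size_sL size_sR; move: (iota 0 a.+1) rP => r rP.
  rewrite -addrA -big_split /=.
  rewrite (big_morph Posz PoszD (erefl _)) [in RHS](big_morph Posz PoszD (erefl _)).
  rewrite -[RHS]big_split /=; apply: eq_big_seq => i /rP hi.
  by rewrite W_psum // fE //; lia.
rewrite E (sum_flow oE) (sum_weight oE) cb ct /codegree; lia.
Qed.

Lemma codegree_ge0 c : code_ok a bt bb sL sR c -> 0 <= codegree c.
Proof.
case=> pL pR _ _ _; have := deficit_ge0 pL sorted_sL; have := deficit_ge0 pR sorted_sR.
rewrite /codegree; lia.
Qed.

(* Swapping the directions of the floors k + 1 and k + 2 lowers by 1 the total
   weight of the edges between them. *)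
Definition shift (k j : nat) : nat := (W j - (j == k.+1))%N.

Definition codes0 : seq code := [seq (sL, sR, es) | es <- words a W].
Definition codesL : seq code :=
  [seq (swap sL k, sR, es) | k <- ascents sL, es <- words a (shift k)].
Definition codesR : seq code :=
  [seq (sL, swap sR k, es) | k <- ascents sR, es <- words a (shift k)].
Definition codesD : seq code := [seq (sL, sR, es) | es <- deviants a W].

Let W_gt0 j : (j <= a)%N -> (0 < W j)%N.
Proof. by move/W_gt2; lia. Qed.
Let W_gt1 j : (j <= a)%N -> (1 < W j)%N.
Proof. by move/W_gt2; lia. Qed.
Let shift_gt0 k j : (j <= a)%N -> (0 < shift k j)%N.
Proof. by rewrite /shift => /W_gt2; case: eqP; lia. Qed.

Lemma mem_codes0 c : (c \in codes0) <-> code_ok a bt bb sL sR c /\ codegree c = 0.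
Proof.
split.
  case/mapP=> es /(mem_words _ (ltnW a_gt1) W_gt0)[sE oE eE fE] ->; split.
    by apply/code_okP => //; split=> // i ia; rewrite fE // W_psum.
  by rewrite /codegree eE !deficitxx.
case=> ok; case: (ok) => pL pR _ _ _; rewrite /codegree => d0.
have dL := deficit_ge0 pL sorted_sL; have dR := deficit_ge0 pR sorted_sR.
have eL : c.1.1 = sL by apply: eq_of_deficit0 => //; rewrite -/(deficit _ _); lia.
have eR : c.1.2 = sR by apply: eq_of_deficit0 => //; rewrite -/(deficit _ _); lia.
have [sE oE fE] := (code_okP pL pR).1 ok.
apply/mapP; exists c.2; last by case: (c) eL eR => [[? ?] ?] /= -> ->.
apply/(mem_words _ (ltnW a_gt1) W_gt0); split=> //; first by lia.
by move=> j ja; have := fE j ja; rewrite eL eR -W_psum //; lia.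
Qed.

Lemma mem_codes1 c : (c \in codesL ++ codesR ++ codesD)
  <-> code_ok a bt bb sL sR c /\ codegree c = 1.
Proof.
have kE k s : k \in ascents s -> size s = a -> (k.+1 < a)%N.
  by rewrite mem_ascents => /andP[+ _] => + <-.
split.
  rewrite !mem_cat => /or3P[/allpairsPdep[k [es [kL ew ->]]]|/allpairsPdep[k [es [kR ew ->]]]|].
  - have [sE oE eE fE] := (mem_words _ (ltnW a_gt1) (@shift_gt0 k)).1 ew.
    have hk := kE _ _ kL size_sL; have pk : perm_eq (swap sL k) sL by rewrite perm_swap ?size_sL.
    split; last by rewrite /codegree eE deficitxx deficit_swap.
    apply/code_okP => //; split=> // i ia; rewrite fE // psum_swap //= /shift.
    by have := W_psum ia; have := W_gt2 ia; case: eqP; lia.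
  - have [sE oE eE fE] := (mem_words _ (ltnW a_gt1) (@shift_gt0 k)).1 ew.
    have hk := kE _ _ kR size_sR; have pk : perm_eq (swap sR k) sR by rewrite perm_swap ?size_sR.
    split; last by rewrite /codegree eE deficitxx deficit_swap.
    apply/code_okP => //; split=> // i ia; rewrite fE // psum_swap //= /shift.
    by have := W_psum ia; have := W_gt2 ia; case: eqP; lia.
  case/mapP=> es /(mem_deviants _ a_gt1 W_gt1)[sE oE eE fE] ->; split.
    by apply/code_okP => //; split=> // i ia; rewrite fE // W_psum.
  by rewrite /codegree eE !deficitxx.
case: c => [[Ls Rs] es] [ok]; case: (ok) => /= pL pR _ _ _; rewrite /codegree /= => d1.
have dL := deficit_ge0 pL sorted_sL; have dR := deficit_ge0 pR sorted_sR.
have [/= sE oE fE] := (@code_okP (Ls, Rs, es) pL pR).1 ok.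
have eL0 : deficit Ls sL = 0 -> Ls = sL by apply: eq_of_deficit0.
have eR0 : deficit Rs sR = 0 -> Rs = sR by apply: eq_of_deficit0.
rewrite !mem_cat.
have [eL|eL] := eqVneq (deficit Ls sL) 1.
  have [k kL LsE] := swap_of_deficit pL sorted_sL eL.
  have RsE : Rs = sR by apply: eR0; lia.
  apply/orP; left; apply/allpairsPdep; exists k, es; rewrite LsE RsE; split=> //.
  apply/(mem_words _ (ltnW a_gt1) (@shift_gt0 k)); split=> //; first by lia.
  move=> j ja; have := fE j ja; have := W_psum ja; have := W_gt2 ja.
  by rewrite LsE RsE psum_swap // /shift; clear; case: eqP; lia.
have LsE : Ls = sL by apply: eL0; lia.
have [eR|eR] := eqVneq (deficit Rs sR) 1.
  have [k kR RsE] := swap_of_deficit pR sorted_sR eR.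
  apply/orP; right; apply/orP; left; apply/allpairsPdep; exists k, es.
  rewrite LsE RsE; split=> //.
  apply/(mem_words _ (ltnW a_gt1) (@shift_gt0 k)); split=> //; first by lia.
  move=> j ja; have := fE j ja; have := W_psum ja; have := W_gt2 ja.
  by rewrite LsE RsE psum_swap // /shift; clear; case: eqP; lia.
have RsE : Rs = sR by apply: eR0; lia.
apply/orP; right; apply/orP; right; rewrite LsE RsE; apply: map_f.
apply/(mem_deviants _ a_gt1 W_gt1); split=> //; first by lia.
by move=> j ja; have := fE j ja; rewrite LsE RsE -W_psum // => -[].
Qed.

Lemma uniq_codes0 : uniq codes0.
Proof. by rewrite map_inj_uniq ?uniq_words_from // => x y []. Qed.

Lemma swap_inj s : {in ascents s &, injective (swap s)}.
Proof.
move=> k l ks ls e; have := psum_swap k.+1 ks; rewrite e psum_swap // eqxx.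
by move=> /addrI; case: eqP => // -[->].
Qed.

Lemma swap_neq s k : k \in ascents s -> swap s k <> s.
Proof. by move=> ks e; have := psum_swap k.+1 ks; rewrite e eqxx; lia. Qed.

Lemma uniq_codes1 : uniq (codesL ++ codesR ++ codesD).
Proof.
have uL : uniq codesL.
  apply: allpairs_uniq_dep => [|k _|]; first by rewrite filter_uniq ?iota_uniq.
    exact: uniq_words_from.
  move=> [k es] [l es'] /allpairsPdep[k' [? [kL _ [-> _]]]] /allpairsPdep[l' [? [lL _ [-> _]]]] /=.
  by case=> /(swap_inj kL lL) -> ->.
have uR : uniq codesR.
  apply: allpairs_uniq_dep => [|k _|]; first by rewrite filter_uniq ?iota_uniq.
    exact: uniq_words_from.
  move=> [k es] [l es'] /allpairsPdep[k' [? [kL _ [-> _]]]] /allpairsPdep[l' [? [lL _ [-> _]]]] /=.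
  by case=> /(swap_inj kL lL) -> ->.
have uD : uniq codesD by rewrite map_inj_uniq ?uniq_deviants // => x y [].
rewrite !cat_uniq uL uR uD has_cat negb_or /= andbT -andbA.
apply/and3P; split.
- apply/hasPn => c /allpairsPdep[k [es [kR _ ->]]]; apply/negP => /allpairsPdep[l [es' [lL _ []]]].
  by move=> _ /(swap_neq kR).
- apply/hasPn => c /mapP[es _ ->]; apply/negP => /allpairsPdep[l [es' [lL _ []]]].
  by move=> /esym /(swap_neq lL).
apply/hasPn => c /mapP[es _ ->]; apply/negP => /allpairsPdep[l [es' [lL _ []]]].
by move=> /esym /(swap_neq lL).
Qed.

(** Widths are at least 3, and a flow falls short of the width by at most the two deficits, hence by
    at most 1. *)
Lemma code_ok_low c : code_ok a bt bb sL sR c -> codegree c <= 1 ->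
  forall i, (i <= a)%N -> (1 < flow c.2 i)%N /\ (excess c.2 <= 1)%N.
Proof.
move=> ok c1 i ia; case: (ok) => pL pR _ _ _; have [_ _ fE] := (code_okP pL pR).1 ok.
have dL := deficit_ge0 pL sorted_sL; have dR := deficit_ge0 pR sorted_sR.
have hL : psum c.1.1 i - psum sL i <= deficit c.1.1 sL.
  rewrite /deficit (bigD1_seq i) ?iota_uniq ?mem_iota ?size_sL //= lerDl.
  by apply: sumr_ge0 => j _; rewrite subr_ge0 psum_sorted_le.
have hR : psum c.1.2 i - psum sR i <= deficit c.1.2 sR.
  rewrite /deficit (bigD1_seq i) ?iota_uniq ?mem_iota ?size_sR //= lerDl.
  by apply: sumr_ge0 => j _; rewrite subr_ge0 psum_sorted_le.
have := fE i ia; have := W_psum ia; have := W_gt2 ia; rewrite /codegree in c1.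
move: (psum _ _) (psum _ _) (psum _ _) (psum _ _) hL hR dL dR c1 => u v w x.
move: (deficit _ _) (deficit _ _) => y z; clear; lia.
Qed.

(** If no edge joined the floors [i] and [i + 1], each edge crossing level [i] would jump over some
    floor, so its weight would be bounded by its share of the excess. The flow, at least 2, would
    then be at most the excess, which is at most 1. *)
Lemma low_chain c : code_ok a bt bb sL sR c -> codegree c <= 1 ->
  forall i, (0 < i < a)%N -> has (fun x => (lorigin x == i) && (ltarget x == i.+1)) c.2.
Proof.
move=> ok c1 i /andP[i0 ia]; have [f2 e1] := code_ok_low ok c1 (ltnW ia).
apply/negPn/negP => /hasPn h; move: f2 e1; rewrite /flow /excess big_mkcond.
have : (\sum_(x <- c.2) (if lorigin x <= i < ltarget x then lweight x else 0)
   <= \sum_(x <- c.2) lweight x * (ltarget x - lorigin x).-1)%N.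
  rewrite big_seq [X in (_ <= X)%N]big_seq; apply: leq_sum => x /h.
  by case: ifP => //; nia.
by move=> le f2 e1; have := leq_trans (leq_trans f2 le) e1; rewrite ltnn.
Qed.

(** The chain provides bounded edges with [a - 1] different origins. This makes the truncated
    subtraction in the genus faithful. *)
Lemma low_bounded c : code_ok a bt bb sL sR c -> codegree c <= 1 ->
  (a.-1 <= count (lbounded a) c.2)%N.
Proof.
move=> ok c1; rewrite -size_filter -(size_map lorigin) -(size_iota 1 a.-1).
apply: uniq_leq_size; first exact: iota_uniq.
move=> i; rewrite mem_iota => hi.
have hi' : (0 < i < a)%N by lia.
have /hasP[x xE /andP[/eqP xo /eqP xt]] := low_chain ok c1 hi'.
rewrite -xo map_f // mem_filter xE /lbounded xo xt; lia.
Qed.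

End Classification.

(** * Generating polynomials *)

Section CompositionSums.
Local Notation R := {poly int}.
Implicit Types c : seq nat.

Local Notation G m := (\sum_(c <- compositions m) ('X : R) ^+ size c).

Lemma size_incr_head c : size (incr_head c) = size c.
Proof. by case: c. Qed.

Lemma sum_compositions m : G m = 'X * (1 + 'X) ^+ m.
Proof.
elim: m => [|m IH]; first by rewrite big_seq1 expr0 mulr1.
rewrite /= big_cat !big_map /= (eq_bigr (fun c => 'X * 'X ^+ size c)) => [|c _]; last first.
  by rewrite exprS.
rewrite [X in _ + X](eq_bigr (fun c => 'X ^+ size c)) => [|c _]; last by rewrite size_incr_head.
rewrite -big_distrr /= IH exprS; ring.
Qed.

(** This is the operator [u d/du] applied to [sum_compositions], multiplied by [1 + u] to stay among
    polynomials. *)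
Lemma sum_compositions_size m :
  (1 + 'X) * (\sum_(c <- compositions m) (size c)%:R * 'X ^+ size c)
  = (1 + 'X + m%:R * 'X) * G m.
Proof.
elim: m => [|m IH]; first by rewrite !big_seq1 /=; ring.
rewrite sum_compositions in IH.
rewrite sum_compositions /= big_cat !big_map /=.
rewrite (eq_bigr (fun c => 'X * ((size c)%:R * 'X ^+ size c) + 'X * 'X ^+ size c)) => [|c _]; last first.
  by rewrite exprS -addn1 natrD; ring.
rewrite [X in _ * (_ + X) = _](eq_bigr (fun c => (size c)%:R * 'X ^+ size c)) => [|c _]; last first.
  by rewrite size_incr_head.
rewrite big_split -!big_distrr /= sum_compositions.
move: IH; set H := \sum_(c <- _) _ => IH.
transitivity ((1 + 'X) * ((1 + 'X) * H) + (1 + 'X) * ('X * ('X * (1 + 'X) ^+ m))); first by ring.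
by rewrite IH exprS -[m.+1]addn1 natrD; ring.
Qed.

Lemma sum_compositions_head m :
  \sum_(c <- compositions m.+1) (head 0%N c == 1%N)%:R * 'X ^+ size c = 'X * G m.
Proof.
rewrite /= big_cat !big_map /= [X in _ + X]big1_seq ?addr0.
  by rewrite big_distrr /=; apply: eq_bigr => c _; rewrite mul1r exprS.
move=> [|x c] /andP[_]; rewrite mem_compositions //= => /andP[/andP[x0 _] _].
by case: x x0 => //= x _; rewrite mul0r.
Qed.

(** Cut a row of [m + 2] cells at some of its [m + 1] walls. A part equal to 1 is an isolated cell:
    one wall must be cut for each of the two extreme cells, two for each of the [m] others, and
    forcing a cut replaces a factor [1 + u] by [u]. The proof uses the recursion instead: prepending
    a 1 adds a part equal to 1, increasing the head destroys one if the head was 1. *)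
Lemma sum_compositions_ones m :
  (1 + 'X) ^+ 2 * (\sum_(c <- compositions m.+1) (count (pred1 1%N) c)%:R * 'X ^+ size c)
  = (2 * 'X * (1 + 'X) + m%:R * 'X ^+ 2) * G m.+1.
Proof.
have rec k : \sum_(c <- compositions k.+1) (count (pred1 1%N) c)%:R * ('X : R) ^+ size c
    = (1 + 'X) * (\sum_(c <- compositions k) (count (pred1 1%N) c)%:R * 'X ^+ size c)
      + 'X * G k - \sum_(c <- compositions k) (head 0%N c == 1%N)%:R * 'X ^+ size c.
  rewrite /= big_cat !big_map /=.
  rewrite (eq_bigr (fun c => 'X * ((count (pred1 1%N) c)%:R * 'X ^+ size c) + 'X * 'X ^+ size c)) => [|c _]; last first.
    by rewrite exprS natrD; ring.
  rewrite [X in _ + X = _](eq_big_seq (fun c => (count (pred1 1%N) c)%:R * 'X ^+ size c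
     - (head 0%N c == 1%N)%:R * 'X ^+ size c)) => [|c]; last first.
    rewrite mem_compositions size_incr_head -mulrBl; case: c => [|x c] //= /andP[/andP[x0 _] _].
    by rewrite natrD; case: x x0 => //= x _; congr (_ * _); ring.
  rewrite big_split sumrB -!big_distrr /=; ring.
elim: m => [|m IH].
  rewrite rec !sum_compositions !big_seq1 /=; ring.
rewrite !sum_compositions in IH; rewrite rec sum_compositions_head !sum_compositions.
move: IH; set H := \sum_(c <- _) _ => IH.
transitivity ((1 + 'X) * ((1 + 'X) ^+ 2 * H) + (1 + 'X) ^+ 2 * ('X * ('X * (1 + 'X) ^+ m.+1)
  - 'X * ('X * (1 + 'X) ^+ m))); first by ring.
rewrite IH !exprS -[in RHS]addn1 natrD; ring.
Qed.

End CompositionSums.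

(** * Generating polynomials of words, as products over gaps *)

Section WordSums.
Variables (a : nat) (F : nat -> nat).
Hypothesis F_gt0 : forall j, (j <= a)%N -> (0 < F j)%N.
Local Notation R := {poly int}.
Implicit Types es : seq letter.

Definition weights es (j : nat) : seq nat := [seq lweight x | x <- es & lgap x == j].

Definition genus_weight es : R := 'X^(count (lbounded a) es).

Definition slot_weight (j : nat) (c : seq nat) : R :=
  if interior a j then 'X ^+ size c else 1.

Lemma weights_layout i c j : (i <= j)%N -> weights (layout i c) j = nth [::] c (j - i).
Proof.
elim: c i => [|x c IH] i ij; first by rewrite nth_nil.
have [<-|ij'] := eqVneq i j.
  by rewrite /weights filter_layout subnn -map_comp /= map_id.
rewrite /weights [layout _ _]/= filter_cat map_cat.
have := IH i.+1; rewrite /weights => ->; last by lia.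
rewrite filter_map (@eq_filter _ _ pred0) => [|w /=]; last by rewrite /lgap /= (negPf ij').
by rewrite filter_pred0 /=; have -> : (j - i = (j - i.+1).+1)%N by lia.
Qed.

Lemma sum_words (psi : nat -> seq nat -> R) :
  \sum_(es <- words a F) \prod_(j <- iota 0 a.+1) psi j (weights es j)
  = \prod_(j <- iota 0 a.+1) \sum_(x <- slot a F j) psi j x.
Proof.
rewrite -(big_choices _ _ [::]) big_map; apply: eq_bigr => c _.
by apply: eq_bigr => j _; rewrite weights_layout.
Qed.

Lemma size_weights es j : size (weights es j) = count (fun x => lgap x == j) es.
Proof. by rewrite size_map size_filter. Qed.

Lemma mem_words_straight es x : es \in words a F -> x \in es -> straight a x /\ (lgap x <= a)%N.
Proof.
rewrite /words mem_words_from => [|j]; last by rewrite add0n ltnS => /F_gt0.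
case/and4P=> _ /allP sE /allP gE _ xE; split; first exact: sE.
by have := gE x xE; rewrite ltnS.
Qed.

(** A straight letter is bounded exactly when its gap is interior, so a count over bounded letters
    splits into gaps. *)
Lemma count_interior es (p : pred letter) : es \in words a F ->
  count (fun x => lbounded a x && p x) es
  = (\sum_(j <- iota 0 a.+1 | interior a j) count (fun x => (lgap x == j) && p x) es)%N.
Proof.
move=> ew; under [RHS]eq_bigr => j _ do rewrite -sum1_count big_mkcond.
rewrite exchange_big -sum1_count big_mkcond; apply: eq_big_seq => x xE.
have [/and4P[/eqP xo /eqP xt _ _] xa] := mem_words_straight ew xE.
have -> : lbounded a x = interior a (lgap x) by rewrite /lbounded /interior xo xt.
case: (p x); last by rewrite andbF big1 // => j _; rewrite andbF.
rewrite andbT; under eq_bigr => j _ do rewrite andbT.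
rewrite -big_mkcondr /= -[LHS]/(if _ then _ else _).
rewrite (eq_bigl (fun j => (j == lgap x) && interior a (lgap x))); last first.
  by move=> j; rewrite andbC eq_sym; case: eqP => // ->.
case: (interior a (lgap x)); last by rewrite big_pred0 // => j; rewrite andbF.
under eq_bigl => j do rewrite andbT.
by rewrite -[_ :: _]/(iota 0 a.+1) -big_filter filter_pred1_uniq ?iota_uniq ?big_seq1 ?mem_iota.
Qed.

Lemma genus_weightE es : es \in words a F ->
  genus_weight es = \prod_(j <- iota 0 a.+1) slot_weight j (weights es j).
Proof.
move=> ew; rewrite /genus_weight; have := count_interior predT ew.
under eq_count => x do rewrite andbT.
move=> ->; rewrite (big_morph _ (exprD 'X) (expr0 _)) big_mkcond /=.
apply: eq_bigr => j _; rewrite /slot_weight size_weights.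
by case: ifP => // _; congr ('X ^+ _); apply: eq_count => x; rewrite andbT.
Qed.

Definition word_sum : R := \sum_(es <- words a F) genus_weight es.

Lemma word_sum_prod :
  word_sum = \prod_(j <- iota 0 a.+1) \sum_(x <- slot a F j) slot_weight j x.
Proof. by rewrite -sum_words; apply: eq_big_seq => es; apply: genus_weightE. Qed.

Lemma word_sumE :
  word_sum = 'X ^+ a.-1 * (1 + 'X) ^+ (\sum_(j <- iota 1 a.-1) (F j).-1)%N.
Proof.
rewrite word_sum_prod.
have out j : interior a j = false -> \sum_(x <- slot a F j) slot_weight j x = 1.
  by move=> h; rewrite /slot /slot_weight h big_seq1.
have [a0|a0] := posnP a.
  have -> : iota 0 a.+1 = [:: 0%N] by rewrite a0.
  by rewrite big_seq1 out ?a0 //= big_nil !expr0 mulr1.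
have -> : iota 0 a.+1 = 0%N :: iota 1 a.-1 ++ [:: a].
  case: (a) a0 => // a' _; rewrite -[iota 0 _]/(0%N :: iota 1 a'.+1).
  by have -> : iota 1 a'.+1 = iota 1 (a' + 1) by [rewrite addn1]; rewrite iotaD.
rewrite big_cons big_cat big_seq1 !out ?mul1r ?mulr1 //; last first.
  by rewrite /interior ltnn andbF.
have -> : 'X ^+ a.-1 = \prod_(j <- iota 1 a.-1) ('X : R).
  by rewrite big_const_seq count_predT size_iota iter_mulr_1.
rewrite (big_morph _ (exprD (1 + 'X)) (expr0 _)) -big_split /= mulr1.
apply: eq_big_seq => j; rewrite mem_iota => hj.
have hI : interior a j by rewrite /interior; lia.
by rewrite /slot /slot_weight hI -sum_compositions.
Qed.

(** A statistic of the weights in gap [k] alters one factor of the product only, so a relation known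
    for that factor carries over to the whole sum. The multiplier [e] clears the denominators in
    [1 + u]. *)
Lemma sum_words_stat (k : nat) (s : seq nat -> R) (e r : R) : (k <= a)%N ->
  e * (\sum_(x <- slot a F k) s x * slot_weight k x)
    = r * (\sum_(x <- slot a F k) slot_weight k x) ->
  e * (\sum_(es <- words a F) s (weights es k) * genus_weight es) = r * word_sum.
Proof.
move=> ka h; have ki : k \in iota 0 a.+1 by rewrite mem_iota.
have E : \sum_(es <- words a F) s (weights es k) * genus_weight es
    = \prod_(j <- iota 0 a.+1) \sum_(x <- slot a F j) (if j == k then s x else 1) * slot_weight j x.
  rewrite -sum_words; apply: eq_big_seq => es ew; rewrite genus_weightE // big_split.
  by congr (_ * _); rewrite -big_mkcond -big_filter filter_pred1_uniq ?iota_uniq // big_seq1.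
rewrite E word_sum_prod (bigD1_seq k) ?iota_uniq // eqxx mulrA h.
rewrite [in RHS](bigD1_seq k) ?iota_uniq // mulrA; congr (_ * _).
by apply: eq_bigr => j /negPf ->; apply: eq_bigr => x _; rewrite mul1r.
Qed.

Lemma sum_words_gap k : interior a k ->
  (1 + 'X) * (\sum_(es <- words a F) (count (fun x => lgap x == k) es)%:R * genus_weight es)
  = (1 + 'X + (F k).-1%:R * 'X) * word_sum.
Proof.
move=> hk; under eq_bigr => es _ do rewrite -size_weights.
apply: (@sum_words_stat k (fun c => (size c)%:R)); first by case/andP: hk => _ /ltnW.
by rewrite /slot /slot_weight hk sum_compositions_size.
Qed.

Lemma sum_words_end k : (k <= a)%N -> ~~ interior a k ->
  \sum_(es <- words a F) (count (fun x => lgap x == k) es)%:R * genus_weight es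
  = (F k)%:R * word_sum.
Proof.
move=> ka /negPf hk; under eq_bigr => es _ do rewrite -size_weights.
rewrite -[LHS]mul1r; apply: (@sum_words_stat k (fun c => (size c)%:R)) => //.
by rewrite /slot /slot_weight hk !big_seq1 size_nseq mul1r.
Qed.

Lemma sum_words_ones : (forall j, (j <= a)%N -> (1 < F j)%N) ->
  (1 + 'X) ^+ 2 * (\sum_(es <- words a F)
      (count (fun x => lbounded a x && (lweight x == 1%N)) es)%:R * genus_weight es)
  = (\sum_(j <- iota 0 a.+1 | interior a j) (2 * 'X * (1 + 'X) + (F j - 2)%:R * 'X ^+ 2))
    * word_sum.
Proof.
move=> F1; rewrite (eq_big_seq (fun es => \sum_(j <- iota 0 a.+1 | interior a j)
     (count (pred1 1%N) (weights es j))%:R * genus_weight es)); last first.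
  move=> es ew; rewrite (count_interior _ ew) natr_sum big_distrl /=.
  apply: eq_bigr => j _; congr (_%:R * _).
  by rewrite count_map count_filter; apply: eq_count => x /=; rewrite andbC.
rewrite exchange_big big_distrr big_distrl /=; apply: eq_bigr => j hj.
have ja : (j <= a)%N by case/andP: hj => _ /ltnW.
apply: (@sum_words_stat j (fun c => (count (pred1 1%N) c)%:R)) => //.
rewrite /slot /slot_weight hj; have := F1 j ja; case: (F j) => [|[|m]] // _.
by rewrite sum_compositions_ones subSS subSS subn0.
Qed.

End WordSums.

Section Exponents.
Variable a : nat.
Implicit Types F : nat -> nat.

(** For the widths of the polygon, [W j - 1] is the number of interior lattice points at height [j],
    so this is the number [g_max] of all interior lattice points. *)
Definition exponent F : nat := (\sum_(j <- iota 1 a.-1) (F j).-1)%N.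

Lemma eq_exponent F F' : (forall j, interior a j -> F j = F' j) -> exponent F = exponent F'.
Proof.
move=> h; apply: eq_big_seq => j; rewrite mem_iota => hj; rewrite h //.
by rewrite /interior; lia.
Qed.

Lemma exponent_decr F k : interior a k -> (1 < F k)%N ->
  ((exponent (fun j => F j - (j == k))).+1 = exponent F)%N.
Proof.
move=> /andP[k0 ka] Fk; have ki : k \in iota 1 a.-1 by rewrite mem_iota; lia.
rewrite /exponent (bigD1_seq k) ?iota_uniq //= [in RHS](bigD1_seq k) ?iota_uniq //=.
rewrite eqxx (eq_bigr (fun j => (F j).-1)) => [|j /negPf ->]; last by rewrite subn0.
by move: (\sum_(_ <- _ | _) _)%N => s; lia.
Qed.

End Exponents.

(** * The total contribution of codegrees 0 and 1 *)

Section TotalCount.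
Variables (a bt bb : nat) (sL sR : seq int) (W : nat -> nat).
Hypothesis a_gt2 : (2 < a)%N.
Hypothesis size_sL : size sL = a.
Hypothesis size_sR : size sR = a.
Hypothesis W_bot : W 0%N = bb.
Hypothesis W_top : W a = bt.
Hypothesis W_gt2 : forall i, (i <= a)%N -> (2 < W i)%N.
Local Notation R := {poly int}.
Local Notation v := (1 + 'X : R).
Local Notation Z := (word_sum a W).
Local Notation U es := (genus_weight a es).

Let W_gt0 j : (j <= a)%N -> (0 < W j)%N.
Proof. by move/W_gt2; lia. Qed.

Let W_gt1 j : (j <= a)%N -> (1 < W j)%N.
Proof. by move/W_gt2; lia. Qed.

Lemma word_sum_exponent F F' m :
  (forall j, (j <= a)%N -> (0 < F j)%N) -> (forall j, (j <= a)%N -> (0 < F' j)%N) ->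
  (exponent a F + m = exponent a F')%N -> v ^+ m * word_sum a F = word_sum a F'.
Proof.
move=> F0 F0' e; rewrite !word_sumE // -/(exponent a F) -/(exponent a F') -e.
by rewrite mulrCA -exprD addnC.
Qed.

Lemma word_sum_shift k : (k.+1 < a)%N -> v * word_sum a (shift W k) = Z.
Proof.
move=> ka; have hk : interior a k.+1 by rewrite /interior; lia.
rewrite -[v]expr1; apply: word_sum_exponent => //.
  by move=> j /W_gt2; rewrite /shift; case: (j == _); lia.
by rewrite addn1; apply: exponent_decr => //; apply: W_gt1; apply: ltnW.
Qed.

Lemma word_sum_dev_mid o : (0 < o)%N -> (o.+1 < a)%N -> v ^+ 2 * word_sum a (dev_flow W o) = Z.
Proof.
move=> o0 oa; have ho : interior a o by rewrite /interior; lia.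
have ho1 : interior a o.+1 by rewrite /interior; lia.
apply: word_sum_exponent => //; first exact: dev_flow_gt0.
rewrite -(@exponent_decr a W _ ho1); last by apply: W_gt1; lia.
rewrite -(@exponent_decr a (fun j => (W j - (j == o.+1))%N) _ ho); last by rewrite ltn_eqF // subn0 W_gt1 //; lia.
rewrite addn2; congr _.+2; apply: eq_exponent => j _.
by rewrite /dev_flow; case: eqP => [->|_]; case: eqP => //=; lia.
Qed.

Lemma word_sum_dev_bot : v * word_sum a (dev_flow W 0) = Z.
Proof.
have h1 : interior a 1 by rewrite /interior; lia.
rewrite -[v]expr1; apply: word_sum_exponent => //; first exact: dev_flow_gt0.
rewrite -(@exponent_decr a W _ h1); last by apply: W_gt1; lia.
by rewrite addn1; congr _.+1; apply: eq_exponent => j /andP[j0 _]; rewrite /dev_flow gtn_eqF.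
Qed.

Lemma word_sum_dev_top : v * word_sum a (dev_flow W a.-1) = Z.
Proof.
have h1 : interior a a.-1 by rewrite /interior; lia.
rewrite -[v]expr1; apply: word_sum_exponent => //; first exact: dev_flow_gt0.
rewrite -(@exponent_decr a W _ h1); last by apply: W_gt1; lia.
rewrite addn1; congr _.+1; apply: eq_exponent => j /andP[j0 ja].
by rewrite /dev_flow prednK ?(ltn_eqF ja) ?orbF //; lia.
Qed.

(** The coefficient [count + 1] is the number of insertion positions; the power of ['X] is 1 if the
    jumping edge is bounded and 0 if it is an end. *)
Definition dev_sum (o i : nat) : R :=
  'X ^+ lbounded a (dev_letter (o, i))
  * \sum_(es <- words a (dev_flow W o)) (count (fun x => lgap x == i) es).+1%:R * U es.

Lemma dev_sum_int o i : (o < a)%N -> (i == o) || (i == o.+1) -> interior a i ->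
  v * dev_sum o i = 'X ^+ ((0 < o) && (o.+1 < a))%N * (2 * v + ((W i)%:R - 2) * 'X)
                    * word_sum a (dev_flow W o).
Proof.
move=> oa oi hi; rewrite /dev_sum /lbounded /lorigin /ltarget /= mulrCA -!mulrA; congr (_ * _).
under eq_bigr => es _ do rewrite -addn1 natrD mulrDl mul1r.
rewrite big_split mulrDr sum_words_gap //; last exact: dev_flow_gt0.
have Wi : (2 < W i)%N by apply: W_gt2; case/andP: hi => _ /ltnW.
(* One unit of width is taken by the jumping edge, and one more is subtracted because a composition
   of [m] has [m - 1] possible cuts. *)
have -> : (dev_flow W o i).-1 = (W i - 2)%N by rewrite /dev_flow oi; lia.
by rewrite natrB ?(ltnW Wi) // -/(word_sum _ _); ring.
Qed.

Lemma dev_sum_end o i : (o < a)%N -> (i == o) || (i == o.+1) -> ~~ interior a i ->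
  dev_sum o i = 'X ^+ ((0 < o) && (o.+1 < a))%N * (W i)%:R * word_sum a (dev_flow W o).
Proof.
move=> oa oi hi; rewrite /dev_sum /lbounded /lorigin /ltarget /= -!mulrA; congr (_ * _).
under eq_bigr => es _ do rewrite -addn1 natrD mulrDl mul1r.
have ia : (i <= a)%N by lia.
rewrite big_split sum_words_end //; last exact: dev_flow_gt0.
have -> : W i = (dev_flow W o i + 1)%N by have := W_gt2 ia; rewrite /dev_flow oi; lia.
by rewrite natrD mulrDl mul1r.
Qed.

(** Two of the three factors [v] restore the unit of weight lost at each of the levels [o] and
    [o + 1]; the third comes from counting insertion positions. A jumping end crosses only one
    interior level, which leaves a spare factor [v] in the two lemmas that follow. *)
Lemma dev_sum_mid o : (0 < o)%N -> (o.+1 < a)%N ->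
  v ^+ 3 * (dev_sum o o + dev_sum o o.+1)
  = 'X * (4 * v + ((W o)%:R + (W o.+1)%:R - 4) * 'X) * Z.
Proof.
move=> o0 oa; have oa' : (o < a)%N by lia.
have h1 : interior a o by rewrite /interior; lia.
have h2 : interior a o.+1 by rewrite /interior; lia.
have e1 := @dev_sum_int o o oa' _ h1; have e2 := @dev_sum_int o o.+1 oa' _ h2.
rewrite eqxx in e1; rewrite eqxx orbT in e2; rewrite -(word_sum_dev_mid o0 oa).
transitivity (v ^+ 2 * (v * dev_sum o o + v * dev_sum o o.+1)); first by ring.
by rewrite e1 // e2 // o0 oa; ring.
Qed.

Lemma dev_sum_bot :
  v ^+ 3 * (dev_sum 0 0 + dev_sum 0 1)
  = v * (bb%:R * v + 2 * v + ((W 1%N)%:R - 2) * 'X) * Z.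
Proof.
have a0 : (0 < a)%N by lia.
have h1 : interior a 1 by rewrite /interior; lia.
have e1 := @dev_sum_int 0 1 a0 isT h1; have e2 := @dev_sum_end 0 0 a0 isT isT.
rewrite W_bot in e2; rewrite -word_sum_dev_bot.
transitivity (v ^+ 2 * (v * dev_sum 0 0 + v * dev_sum 0 1)); first by ring.
by rewrite e1 // e2 //=; ring.
Qed.

Lemma dev_sum_top :
  v ^+ 3 * (dev_sum a.-1 a.-1 + dev_sum a.-1 a)
  = v * (bt%:R * v + 2 * v + ((W a.-1)%:R - 2) * 'X) * Z.
Proof.
have a0 : (a.-1 < a)%N by lia.
have h1 : interior a a.-1 by rewrite /interior; lia.
have h2 : ~~ interior a a by rewrite /interior; lia.
have e1 := @dev_sum_int a.-1 a.-1 a0 _ h1; have e2 := @dev_sum_end a.-1 a a0 _ h2.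
have ap : a.-1.+1 = a by lia.
rewrite ap eqxx orbT ltnn andbF in e2; rewrite ap eqxx ltnn andbF in e1.
rewrite W_top in e2; rewrite -word_sum_dev_top.
transitivity (v ^+ 2 * (v * dev_sum a.-1 a.-1 + v * dev_sum a.-1 a)); first by ring.
by rewrite e1 // e2 //=; ring.
Qed.

Lemma sum_codesD :
  \sum_(c <- codesD a sL sR W) U c.2 = \sum_(o <- iota 0 a) (dev_sum o o + dev_sum o o.+1).
Proof.
rewrite !big_map big_allpairs_dep [LHS]big_allpairs_dep /=; apply: eq_bigr => o _.
have E i : \sum_(t <- dev_slots a W (o, i)) U (insert (dev_letter (o, i)) t.2 t.1) = dev_sum o i.
  rewrite big_allpairs_dep /dev_sum big_distrr /=; apply: eq_bigr => es _.
  rewrite (eq_bigr (fun=> 'X ^+ lbounded a (dev_letter (o, i)) * U es)) => [|p _]; last first.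
    by rewrite /genus_weight (permP (perm_insert _ _ _)) /= exprD.
  rewrite -[X in \sum_(_ <- X) _]/(iota (count (fun x => lgap x < i)%N es)
    (count (fun x => lgap x == i) es).+1).
  by rewrite big_const_seq count_predT size_iota iter_addr_0 mulr_natl mulrnAr.
by rewrite !big_cons big_nil addr0 !E.
Qed.

Lemma sum_codes_shift (s : seq int) : size s = a ->
  v * \sum_(k <- ascents s) word_sum a (shift W k) = (size (ascents s))%:R * Z.
Proof.
move=> ss; rewrite big_distrr /= (eq_big_seq (fun=> Z)) => [|k]; last first.
  by rewrite mem_ascents ss => /andP[ka _]; rewrite word_sum_shift.
by rewrite big_const_seq count_predT iter_addr_0 mulr_natl.
Qed.

Definition light_count (es : seq letter) : nat :=
  count (fun x => lbounded a x && (lweight x == 1%N)) es.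

(* The product of [(1 - x ^ w) ^ 2] over the bounded edges and of [1 - x] over
   the ends has [- (2 * light_count + (bb + bt))] as its coefficient of [x]. *)
Definition low_total : R :=
  \sum_(c <- codesL a sL sR W ++ codesR a sL sR W ++ codesD a sL sR W) U c.2
  - \sum_(c <- codes0 a sL sR W) (2 * light_count c.2 + (bb + bt))%N%:R * U c.2.

Definition width_sum : nat := (\sum_(j <- iota 1 a.-1) W j)%N.

Lemma interior_filter : [seq j <- iota 0 a.+1 | interior a j] = iota 1 a.-1.
Proof.
have -> : iota 0 a.+1 = [:: 0%N] ++ iota 1 a.-1 ++ [:: a].
  case: (a) a_gt2 => // a' _; rewrite -[iota 0 _]/(0%N :: iota 1 a'.+1).
  by have -> : iota 1 a'.+1 = iota 1 (a' + 1) by [rewrite addn1]; rewrite iotaD.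
rewrite !filter_cat /= [interior a a]/interior ltnn andbF cats0.
by apply/all_filterP/allP => j; rewrite mem_iota /interior; lia.
Qed.

Lemma total_light :
  v ^+ 2 * (\sum_(es <- words a W) (light_count es)%:R * U es)
  = (2 * a.-1%:R * 'X * v + (width_sum%:R - 2 * a.-1%:R) * 'X ^+ 2) * Z.
Proof.
rewrite sum_words_ones // -big_filter interior_filter; congr (_ * _).
rewrite big_split /= big_const_seq count_predT size_iota iter_addr_0.
rewrite -big_distrl /= -[X in X + _]mulr_natl; congr (_ + _ * _); first by ring.
rewrite (eq_big_seq (fun j => (W j)%:R - 2)) => [|j]; last first.
  by rewrite mem_iota => hj; rewrite natrB // ltnW // W_gt2 //; lia.
rewrite sumrB big_const_seq count_predT size_iota iter_addr_0 /width_sum natr_sum.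
by rewrite -[X in _ - X]mulr_natl; congr (_ - _); rewrite mulrC.
Qed.

(** Each interior width occurs for two values of [o], except the first and the last one, which occur
    once; hence the terms in [W 1] and [W a.-1]. *)
Lemma total_mid :
  v ^+ 3 * (\sum_(o <- iota 1 a.-2) (dev_sum o o + dev_sum o o.+1))
  = 'X * (4 * a.-2%:R * v + (2 * width_sum%:R - (W 1%N)%:R - (W a.-1)%:R - 4 * a.-2%:R) * 'X) * Z.
Proof.
rewrite big_distrr /= (eq_big_seq (fun o => 'X * 'X * Z * ((W o)%:R + (W o.+1)%:R)
   + 'X * (4 * v - 4 * 'X) * Z)) => [|o]; last first.
  by rewrite mem_iota => ho; rewrite dev_sum_mid; [ring | lia | lia].
rewrite big_split -big_distrr /= big_const_seq count_predT size_iota iter_addr_0.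
have E1 : (width_sum%:R : R) = (W 1%N)%:R + \sum_(o <- iota 1 a.-2) (W o.+1)%:R.
  rewrite /width_sum natr_sum; have -> : a.-1 = a.-2.+1 by lia.
  by rewrite /= big_cons; congr (_ + _); rewrite -[2%N]add1n iotaDl big_map.
have E2 : (width_sum%:R : R) = \sum_(o <- iota 1 a.-2) (W o)%:R + (W a.-1)%:R.
  rewrite /width_sum natr_sum; have -> : iota 1 a.-1 = iota 1 a.-2 ++ [:: a.-1].
    case: (a) a_gt2 => // -[//|a'] _.
    by have -> : iota 1 a'.+2.-1 = iota 1 (a' + 1) by [rewrite addn1]; rewrite iotaD.
  by rewrite big_cat big_seq1.
rewrite big_split /= -[X in _ + X = _]mulr_natl.
have -> : \sum_(o <- iota 1 a.-2) (W o)%:R = width_sum%:R - (W a.-1)%:R :> R by rewrite E2 addrK.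
have -> : \sum_(o <- iota 1 a.-2) (W o.+1)%:R = width_sum%:R - (W 1%N)%:R :> R.
  by rewrite E1 addrC addKr.
ring.
Qed.

Hypothesis ends_width :
  (W 1%N + W a.-1 = bb + bt + (size (ascents sL) + size (ascents sR)))%N.

(** The widths [W 1] and [W a.-1] left over by the jumping edges enter only through their sum, which
    [ends_width] eliminates. The coefficients that remain are twice the area, twice the lattice
    perimeter, the number of edges and 12 minus that number, that is the four invariants of the
    formula. *)
Lemma total_mul :
  v ^+ 3 * low_total = Z *
    (- (2 * width_sum + (bb + bt))%N%:R * 'X ^+ 3
     - (2 * (2 * a + (bb + bt)))%N%:R * 'X ^+ 2
     + (size (ascents sL) + size (ascents sR) + 4)%N%:R * v ^+ 2
     - (8 - (size (ascents sL) + size (ascents sR))%N%:R) * 'X).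
Proof.
set nA := (size (ascents sL) + size (ascents sR))%N.
have EL : \sum_(c <- codesL a sL sR W) U c.2 = \sum_(k <- ascents sL) word_sum a (shift W k).
  by rewrite big_allpairs_dep.
have ER : \sum_(c <- codesR a sL sR W) U c.2 = \sum_(k <- ascents sR) word_sum a (shift W k).
  by rewrite big_allpairs_dep.
have E0 : \sum_(c <- codes0 a sL sR W) (2 * light_count c.2 + (bb + bt))%N%:R * U c.2
   = 2 * (\sum_(es <- words a W) (light_count es)%:R * U es) + (bb + bt)%N%:R * Z.
  rewrite big_map big_distrr /= [in X in _ + X]/word_sum big_distrr -big_split /=.
  by apply: eq_bigr => es _; rewrite natrD natrM; ring.
have ED : \sum_(c <- codesD a sL sR W) U c.2 = (dev_sum 0 0 + dev_sum 0 1)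
   + (\sum_(o <- iota 1 a.-2) (dev_sum o o + dev_sum o o.+1) + (dev_sum a.-1 a.-1 + dev_sum a.-1 a)).
  rewrite sum_codesD; have -> : iota 0 a = [:: 0%N] ++ iota 1 a.-2 ++ [:: a.-1].
    case: (a) a_gt2 => // -[//|a'] _; rewrite -[iota 0 _]/(0%N :: iota 1 a'.+1).
    by have -> : iota 1 a'.+1 = iota 1 (a' + 1) by [rewrite addn1]; rewrite iotaD.
  by rewrite !big_cat !big_seq1 /= prednK //; lia.
rewrite /low_total !big_cat EL ER ED E0.
have tL := sum_codes_shift size_sL.
have tR := sum_codes_shift size_sR.
have tl := total_light; have tm := total_mid.
have tb := dev_sum_bot; have tt := dev_sum_top.
move: (\sum_(k <- ascents sL) _) (\sum_(k <- ascents sR) _) tL tR => xL xR tL tR.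
move: (\sum_(es <- words a W) _ * _) (\sum_(o <- iota 1 a.-2) _) tl tm => xl xm tl tm.
move: (dev_sum 0 0 + dev_sum 0 1) (dev_sum a.-1 a.-1 + dev_sum a.-1 a) tb tt => xb xt tb tt.
transitivity (v ^+ 2 * (v * xL) + v ^+ 2 * (v * xR) + v ^+ 3 * xb + v ^+ 3 * xm + v ^+ 3 * xt
   - 2 * v * (v ^+ 2 * xl) - (bb + bt)%N%:R * v ^+ 3 * Z).
  by rewrite /=; ring.
rewrite tL tR tb tm tt tl.
have w1 : (W a.-1)%:R = (bb + bt + nA)%N%:R - (W 1%N)%:R :> R.
  by rewrite /nA -ends_width natrD addrC addKr.
have a1 : (a.-1%:R : R) = a%:R - 1 by rewrite -subn1 natrB //; lia.
have a2 : (a.-2%:R : R) = a%:R - 2 by rewrite -subn2 natrB //; lia.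
by rewrite w1 a1 a2 /nA; ring.
Qed.

End TotalCount.

(** * The coefficient of degree one *)

Section FinitelyManyCodes.

Lemma seqs_of_bounded_size (T : eqType) (A : seq T) (m : nat) :
  exists l : seq (seq T), forall s, (size s <= m)%N -> all (mem A) s -> s \in l.
Proof.
elim: m => [|m [l IH]].
  by exists [:: [::]] => s; rewrite leqn0 => /nilP->.
exists ([::] :: [seq x :: s | x <- A, s <- l]) => -[|x s] //=.
rewrite ltnS => sm /andP[xA sA]; rewrite inE /=.
by apply/allpairsP; exists (x, s); split=> //; apply: IH.
Qed.

(** The predicate will be the existence of a diagram with a given code, a mere proposition; excluded
    middle filters the list. *)
Lemma subset_of_seq (T : eqType) (l : seq T) (Q : T -> Prop) :
  exists2 l' : seq T, uniq l' & forall x, x \in l' <-> x \in l /\ Q x.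
Proof.
elim: l => [|x l [l' ul' IH]].
  by exists [::] => // x; split=> [//|[]].
case: (boolP (x \in l')) => xl'.
  exists l' => // y; rewrite inE; split=> [/IH[-> ?]|[/orP[/eqP->//|yl] Qy]].
    by rewrite orbT.
  exact/IH.
have [Qx|nQx] := classic (Q x).
  exists (x :: l') => [|y]; first by rewrite /= xl'.
  rewrite !inE; split=> [/orP[/eqP->|/IH[-> ?]]|[/orP[->//|yl] Qy]].
  - by rewrite eqxx.
  - by rewrite orbT.
  by apply/orP; right; apply/IH.
exists l' => // y; rewrite inE; split=> [/IH[-> ?]|[/orP[/eqP->//|yl] Qy]].
  by rewrite orbT.
exact/IH.
Qed.

Lemma code_ok_finite a bt bb lefts rights (w m : nat) :
  exists l : seq code, forall c, code_ok a bt bb lefts rights c ->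
    (size c.2 <= m)%N -> all (fun x => lweight x <= w)%N c.2 -> c \in l.
Proof.
pose B := [seq (u.1.1, (u.1.2, u.2)) | u <- [seq (q, k) |
   q <- [seq (i, p) | i <- iota 0 a.+2, p <- [seq (o, t) | o <- iota 0 a.+2, t <- iota 0 a.+2]],
   k <- iota 0 w.+1]].
have [l hl] := seqs_of_bounded_size B m.
exists [seq (u, s) | u <- [seq (p, q) | p <- permutations lefts, q <- permutations rights], s <- l].
move=> [[Ls Rs] es] [/= pL pR _ oE _] se we.
apply: allpairs_f; first by apply: allpairs_f; rewrite mem_permutations.
apply: hl => //; apply/allP => -[g [[o t] k]] xE.
move/allP: oE => /(_ _ xE) /and5P[/andP[h1 h2] h3 _ _ _].
move/allP: we => /(_ _ xE) h4.
move: h1 h2 h3 h4; rewrite /lorigin /lgap /ltarget /lweight /= => h1 h2 h3 h4.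
apply/mapP; exists ((g, (o, t)), k) => //.
by do ![apply: allpairs_f]; rewrite mem_iota; lia.
Qed.

End FinitelyManyCodes.

Section CodePolynomial.
Variable a : nat.

Definition letter_poly (x : letter) : {poly int} :=
  if lbounded a x then (1 - 'X ^+ lweight x) ^+ 2 else 1 - 'X.

Lemma coef01_prod (es : seq letter) : all (letter_ok a) es ->
  (\prod_(x <- es) letter_poly x)`_0 = 1 /\
  (\prod_(x <- es) letter_poly x)`_1
  = - (2 * light_count a es + count (fun x => ~~ lbounded a x) es)%N%:Z.
Proof.
elim: es => [|x es IH] /=; first by rewrite big_nil !coefC.
move=> /andP[ox /IH[h0 h1]]; rewrite big_cons !coefM.
rewrite !big_ord_recr !big_ord0 /= !subn0 subnn h0 h1 !add0r mulr1.
have wx : (0 < lweight x)%N by case/and5P: ox.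
have p0 : (letter_poly x)`_0 = 1.
  rewrite /letter_poly; case: ifP => _; last by rewrite coefB coefC coefX.
  by rewrite expr2 coefM big_ord_recr big_ord0 /= !coefB !coefC !coefXn; case: (lweight x) wx.
have p1 : (letter_poly x)`_1
    = - (2 * (lbounded a x && (lweight x == 1%N)) + ~~ lbounded a x)%N%:Z.
  rewrite /letter_poly; case: ifP => _; last by rewrite coefB coefC coefX.
  rewrite expr2 coefM !big_ord_recr big_ord0 /= !coefB !coefC !coefXn /=.
  by case: (lweight x) wx => [|[|k]].
by split; rewrite p0 ?p1 ?mul1r //= /light_count /=; lia.
Qed.

End CodePolynomial.

(** * From codes to the refined invariant *)

Section Realization.
Variables (n : nat) (P : 'I_n -> int * int) (g : nat).
Variables (a bt bb : nat) (sL sR : seq int) (W : nat -> nat).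
Hypothesis heightP : height P = a.
Hypothesis btopP : btop P = bt.
Hypothesis bbotP : bbot P = bb.
Hypothesis bleftP : perm_eq (bleft P) sL.
Hypothesis brightP : perm_eq (bright P) sR.
Hypothesis areaP : double_area P = (2 * width_sum a W + (bb + bt))%N%:Z.
Hypothesis a_gt2 : (2 < a)%N.
Hypothesis size_sL : size sL = a.
Hypothesis size_sR : size sR = a.
Hypothesis sorted_sL : sorted <=%R sL.
Hypothesis sorted_sR : sorted <=%R sR.
Hypothesis W_psum : forall i, (i <= a)%N -> (W i)%:Z = bb%:Z - psum sL i - psum sR i.
Hypothesis W_top : W a = bt.
Hypothesis W_gt2 : forall i, (i <= a)%N -> (2 < W i)%N.

Let a_gt1 : (1 < a)%N. Proof. exact: ltnW. Qed.
Let W_bot : W 0%N = bb.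
Proof. by have := W_psum (leq0n a); rewrite !psum0 !subr0 => -[]. Qed.

Definition realized (c : code) : Prop :=
  exists2 D, marked_floor_diagram P g D & code_of D = c.

Lemma code_ok_perm c :
  code_ok (height P) (btop P) (bbot P) (bleft P) (bright P) c <-> code_ok a bt bb sL sR c.
Proof.
rewrite heightP btopP bbotP; split=> -[pL pR sE oE h]; split=> //.
- exact: perm_trans pL bleftP.
- exact: perm_trans pR brightP.
- by rewrite (perm_trans pL) // perm_sym.
- by rewrite (perm_trans pR) // perm_sym.
Qed.

Lemma realized_ok c : realized c -> code_ok a bt bb sL sR c.
Proof. by case=> D mD <-; apply/code_ok_perm; apply: code_of_ok mD. Qed.

Lemma realized_genus c : realized c -> (count (lbounded a) c.2 + 1 - a)%N = g.
Proof. by case=> D mD <-; rewrite -heightP; apply: code_of_genus mD. Qed.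

Local Notation cdeg := (codegree sL sR).

(** In codegree at most 1 the decoded diagram is automatically connected by [low_chain], so the
    genus is the only remaining condition. *)
Lemma realized_low c : code_ok a bt bb sL sR c -> cdeg c <= 1 ->
  realized c <-> count (lbounded a) c.2 = (a.-1 + g)%N.
Proof.
move=> ok c1.
have lb := low_bounded a_gt1 size_sL size_sR sorted_sL sorted_sR W_psum W_top W_gt2 ok c1.
have ch := low_chain a_gt1 size_sL size_sR sorted_sL sorted_sR W_psum W_top W_gt2 ok c1.
have okP : code_ok (height P) (btop P) (bbot P) (bleft P) (bright P) c by apply/code_ok_perm.
have sl : size (bleft P) = height P by rewrite (perm_size bleftP) heightP.
have sr : size (bright P) = height P by rewrite (perm_size brightP) heightP.
have hP : (0 < height P)%N by rewrite heightP; lia.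
split=> [/realized_genus|e]; first by lia.
exists (decode (height P) c); last by apply: (code_of_decode_ok okP).
apply: (decode_marked_floor_diagram hP okP) => //; first by rewrite heightP.
by rewrite heightP; lia.
Qed.

Lemma sum_widths : (\sum_(i <- iota 0 a.+1) W i = bb + (width_sum a W + bt))%N.
Proof.
have -> : iota 0 a.+1 = [:: 0%N] ++ iota 1 a.-1 ++ [:: a].
  case: (a) a_gt2 => // a' _; rewrite -[iota 0 _]/(0%N :: iota 1 a'.+1).
  by have -> : iota 1 a'.+1 = iota 1 (a' + 1) by [rewrite addn1]; rewrite iotaD.
by rewrite !big_cat !big_seq1 W_bot W_top.
Qed.

Lemma count_unbounded es : all (letter_ok a) es -> count (fun x => ~~ lbounded a x) es
  = (count (fun x => lorigin x == 0%N) es + count (fun x => ltarget x == a.+1) es)%N.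
Proof.
move=> /allP ok; rewrite -!sum1_count !(big_mkcond (fun x => _ == _)) (big_mkcond (fun x => ~~ _)) -big_split /=.
apply: eq_big_seq => x /ok /and5P[/andP[h1 h2] h3 _ _ h5]; rewrite /lbounded.
by move: h5; do ![case: ifP => ?]; lia.
Qed.

(** This is the exponent of [x^(1/2)] in [x^Area]: two for each unit of bounded weight and one for
    each end cancel the poles of the multiplicity, and twice the codegree is left over. *)
Lemma area_codegree c : code_ok a bt bb sL sR c ->
  double_area P = (2 * (\sum_(x <- c.2 | lbounded a x) lweight x)
     + count (fun x => ~~ lbounded a x) c.2 + 2 * `|cdeg c|)%N%:Z.
Proof.
move=> ok; have := codegreeE a_gt1 size_sL size_sR sorted_sL sorted_sR W_psum W_top ok.
have := codegree_ge0 a_gt1 size_sL size_sR sorted_sL sorted_sR W_top ok; case: (ok) => _ _ _ oE [cb ct _].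
rewrite areaP sum_widths (count_unbounded oE) cb ct.
move: (\sum_(x <- _ | _) _)%N (width_sum a W) (cdeg c) => u s d; lia.
Qed.

Definition code_poly (c : code) : {poly int} :=
  'X ^+ `|cdeg c| * \prod_(x <- c.2) letter_poly a x.

Local Notation t := (tofrac ('X : {poly int})).

(** With [t] the square root of [x], a bounded edge of weight [w] absorbs [t^(2w)] and becomes
    [(1 - t^(2w))^2]; an end absorbs [t] and becomes [1 - t^2]. *)
Lemma multiplicity_code D : marked_floor_diagram P g D ->
  t ^ double_area P * multiplicity D t^-1 = tofrac (code_poly (code_of D) \Po 'X ^+ 2).
Proof.
move=> mD; have ok : code_ok a bt bb sL sR (code_of D) by apply: realized_ok; exists D.
have t0 : t != 0 by rewrite tofrac_eq0 polyX_eq0.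
have aD : a = #|floor D| by case: mD => -[_ _ _ _ [-> _ _ _ _]].
have he (e : edge D) : (is_sink e || is_source e) = ~~ lbounded a (letter_of e).
  rewrite aD -bounded_letter; case: mD => -[/(_ e) + _ _ _ _] _ _.
  by rewrite /bounded /is_sink /is_source; case: eqP; case: eqP.
have hb (e : edge D) : bounded e = lbounded a (letter_of e) by rewrite aD bounded_letter.
have -> : multiplicity D t^-1
   = \prod_(x <- (code_of D).2) (if lbounded a x then (t^-1 ^+ lweight x - t^-1 ^- lweight x) ^+ 2
                                 else t^-1 - t^-1^-1).
  rewrite [RHS](bigID (lbounded a)) /= (big_letters _ _ hb) (big_letters _ _ he).
  congr (_ * _); apply: eq_bigr => e; first by rewrite hb => ->.
  by rewrite he => /negPf ->.
have -> : t ^ double_area P = t ^+ (2 * `|cdeg (code_of D)|)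
   * \prod_(x <- (code_of D).2) (if lbounded a x then t ^+ (2 * lweight x) else t).
  rewrite (area_codegree ok) -exprnP exprD mulrC; congr (_ * _).
  rewrite exprD [RHS](bigID (lbounded a)) /=; congr (_ * _).
    by rewrite big_distrr /= (big_morph _ (exprD t) (expr0 _)); apply: eq_bigr => x ->.
  rewrite -sum1_count (big_morph _ (exprD t) (expr0 _)).
  by apply: eq_bigr => x /negPf ->; rewrite expr1.
rewrite -mulrA -big_split /= /code_poly !rmorphM /= !rmorphXn /= comp_polyX rmorphXn /= -exprM.
congr (_ * _); rewrite !rmorph_prod; apply: eq_bigr => x _; rewrite /letter_poly.
case: ifP => _.
  rewrite !rmorphXn !rmorphB !rmorph1 /= !rmorphXn /= comp_polyX rmorphXn /=.
  rewrite mulnC exprM -exprMn; congr (_ ^+ 2).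
  rewrite -exprVn invrK mulrBr -exprMn divff // expr1n -exprM mulnC.
  by rewrite muln2 -addnn exprD.
by rewrite !rmorphB !rmorph1 /= comp_polyX rmorphXn /= invrK mulrBr divff // expr2.
Qed.

Lemma realized_finite : exists2 cs : seq code, uniq cs & forall c, c \in cs <-> realized c.
Proof.
(* The genus bounds the number of bounded edges by [g + a], and there are [bb + bt] ends. The area
   bounds the weights of bounded edges; the successor accommodates the weight 1 of ends. *)
have [l hl] := code_ok_finite a bt bb sL sR (`|double_area P|).+1 (g + a + (bb + bt)).
have [cs ucs hcs] := subset_of_seq l realized.
exists cs => // c; split=> [/hcs[]//|rc]; apply/hcs; split=> //.
have ok := realized_ok rc; have gc := realized_genus rc.
case: (ok) => _ _ _ oE [cb ct _]; apply: hl => //.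
  by rewrite -(count_predC (lbounded a)) (count_unbounded oE) cb ct; lia.
apply/allP => x xE; case xb: (lbounded a x).
  have := area_codegree ok; rewrite (big_rem x) //= xb => ->; lia.
move/allP: oE => /(_ x xE) /and5P[/andP[h1 h2] h3 _ /implyP h4 _].
suff /eqP-> : lweight x == 1%N by [].
by apply: h4; move: xb; rewrite /lbounded; lia.
Qed.

Lemma code_poly_coef1 c : code_ok a bt bb sL sR c ->
  (code_poly c)`_1 = (cdeg c == 1)%:R
     - (if cdeg c == 0 then (2 * light_count a c.2 + (bb + bt))%N%:Z else 0).
Proof.
move=> ok; have d0 := codegree_ge0 a_gt1 size_sL size_sR sorted_sL sorted_sR W_top ok.
case: (ok) => _ _ _ oE [cb ct _]; have [p0 p1] := coef01_prod oE.
rewrite /code_poly coefXnM; rewrite count_unbounded // cb ct in p1.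
by case: (cdeg c) d0 => // -[|[|d]] _ //=; rewrite ?p0 ?p1 ?subr0 ?add0r.
Qed.

Let codes1 := codesL a sL sR W ++ codesR a sL sR W ++ codesD a sL sR W.

Lemma total_coef m : (low_total a bt bb sL sR W)`_m
  = (\sum_(c <- codes1 | count (lbounded a) c.2 == m) 1)
    - \sum_(c <- codes0 a sL sR W | count (lbounded a) c.2 == m)
        (2 * light_count a c.2 + (bb + bt))%N%:Z.
Proof.
rewrite /low_total coefB !coef_sum; congr (_ - _); rewrite [RHS]big_mkcond; apply: eq_bigr => c _.
  by rewrite coefXn eq_sym; case: eqP.
rewrite mulr_natl coefMn coefXn eq_sym; case: eqP => _; last by rewrite mul0rn.
by rewrite -natz.
Qed.

(** One diagram is chosen for each realized code; as the code is a complete invariant, these are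
    representatives of all isomorphism classes. *)
Lemma BGtilde_coef1 :
  exists2 p, is_BGtilde P g p & p`_1 = (low_total a bt bb sL sR W)`_(a.-1 + g).
Proof.
have [cs ucs hcs] := realized_finite.
have /fin_all_exists[S hS] : forall i : 'I_(size cs), exists D,
    marked_floor_diagram P g D /\ code_of D = tnth (in_tuple cs) i.
  by move=> i; have /hcs[D mD cD] := mem_tnth i (in_tuple cs); exists D.
exists (\sum_(c <- cs) code_poly c).
  exists 'I_(size cs), S; split; first split.
  - by move=> i; case: (hS i).
  - move=> i j ij; have [mi ci] := hS i; have [mj cj] := hS j.
    have [_ kj _] := mj; have := code_of_iso kj ij.
    by rewrite ci cj; have /(tuple_uniqP (in_tuple cs)) := ucs; apply.
  - move=> D mD; have /tnthP[i ci] : code_of D \in in_tuple cs by apply/hcs; exists D.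
    exists i; have [mi ci'] := hS i; apply: iso_of_code; last by rewrite ci ci'.
      by case: mD.
    by case: mi.
  rewrite !rmorph_sum /= big_distrr /= big_tnth; apply: eq_bigr => i _.
  by have [mi <-] := hS i; rewrite multiplicity_code.
have ok c : c \in cs -> code_ok a bt bb sL sR c by move/hcs/realized_ok.
have low c : c \in cs -> cdeg c <= 1 -> count (lbounded a) c.2 == (a.-1 + g)%N.
  by move=> cE c1; apply/eqP/(realized_low (ok c cE) c1)/hcs.
have m0 := mem_codes0 a_gt1 size_sL size_sR sorted_sL sorted_sR W_psum W_top W_gt2.
have m1 := mem_codes1 a_gt1 size_sL size_sR sorted_sL sorted_sR W_psum W_top W_gt2.
(* A code of codegree 1 contributes 1 in degree 1, and one of codegree 0 the linear coefficient of
   its product. Genus [g] amounts to [a - 1 + g] bounded edges, whence the coefficient extracted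
   from [low_total]. *)
rewrite coef_sum (eq_big_seq _ (fun c cE => code_poly_coef1 (ok c cE))) sumrB total_coef.
congr (_ - _).
  rewrite (eq_bigr (fun c => if cdeg c == 1 then 1 else 0)) => [|c _]; last by case: eqP.
  rewrite -big_mkcond -[LHS]big_filter -[RHS]big_filter; apply: perm_big.
  apply: uniq_perm; rewrite ?filter_uniq //.
    exact: uniq_codes1 a_gt1 size_sL size_sR sorted_sL sorted_sR W_top W_gt2.
  move=> c; rewrite !mem_filter; apply/andP/andP => -[].
    move=> /eqP c1 cE; split; first by apply: low => //; rewrite c1.
    by apply/m1; split=> //; apply: ok.
  move=> /eqP cb /m1[okc c1]; split; first by apply/eqP.
  by apply/hcs/(realized_low okc) => //; rewrite c1.
rewrite -big_mkcond -[LHS]big_filter -[RHS]big_filter; apply: perm_big.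
apply: uniq_perm; rewrite ?filter_uniq ?uniq_codes0 //.
move=> c; rewrite !mem_filter; apply/andP/andP => -[].
  move=> /eqP c1 cE; split; first by apply: low => //; rewrite c1.
  by apply/m0; split=> //; apply: ok.
move=> /eqP cb /m0[okc c1]; split; first by apply/eqP.
by apply/hcs/(realized_low okc) => //; rewrite c1.
Qed.

End Realization.

(** * Binomial series and closed form of the coefficient *)

Section BinomialSeries.
Local Notation bin := one_plus_u.

Lemma one_plus_u0 m : bin m 0 = 1.
Proof. by rewrite /bin big_ord0 divr1. Qed.

Lemma one_plus_uS m k : k.+1%:R * bin m k.+1 = (m - k%:R) * bin m k.
Proof.
rewrite /bin big_ord_recr /= factS natrM invfM.
have k0 : (k.+1%:R : rat) != 0 by rewrite pnatr_eq0.
by move: (\prod_(_ < k) _) (k`!%:R^-1) (k.+1%:R) k0 => x y z z0; field.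
Qed.

(* Both sides satisfy the recurrence (k + 1) f (k + 1) = (m + m' - k) f k. *)
Lemma one_plus_uD m m' k : series_mul (bin m) (bin m') k = bin (m + m') k.
Proof.
elim: k => [|k IH].
  by rewrite /series_mul big_ord_recr big_ord0 /= subn0 !one_plus_u0 add0r mulr1.
have k0 : (k.+1%:R : rat) != 0 by rewrite pnatr_eq0.
apply: (mulfI k0); rewrite one_plus_uS -IH /series_mul !big_distrr /=.
transitivity (\sum_(i < k.+2) (i%:R * bin m i * bin m' (k.+1 - i)
    + bin m i * ((k.+1 - i)%:R * bin m' (k.+1 - i)))).
  apply: eq_bigr => i _; have hi : (i <= k.+1)%N by rewrite -ltnS.
  by rewrite -{1}(subnKC hi) natrD; ring.
rewrite big_split /= big_ord_recl /= !mul0r add0r.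
rewrite [X in _ + X]big_ord_recr /= subnn mul0r mulr0 addr0 -big_split /=.
apply: eq_bigr => i _; have hi : (i <= k)%N by rewrite -ltnS.
rewrite /bump /= add1n subSS subSn // !one_plus_uS.
by rewrite natrB //; ring.
Qed.

Lemma one_plus_u_nat m k : bin m%:R k = 'C(m, k)%:R.
Proof.
elim: k => [|k IH]; first by rewrite one_plus_u0 bin0.
have k0 : (k.+1%:R : rat) != 0 by rewrite pnatr_eq0.
apply: (mulfI k0); rewrite one_plus_uS IH -natrM mul_bin_left.
case: (leqP k m) => km; first by rewrite -natrB // -natrM.
by rewrite bin_small // muln0 mulr0.
Qed.

Lemma series_mul_upow j f k :
  series_mul (upow j) f k = if (k < j)%N then 0 else f (k - j)%N.
Proof.
rewrite /series_mul /upow; case: ltnP => kj.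
  rewrite big1 // => i _; have := ltn_ord i; case: eqP => [->|_]; last by rewrite mul0r.
  by lia.
have jk : (j < k.+1)%N by rewrite ltnS.
rewrite (bigD1 (Ordinal jk)) //= eqxx mul1r big1 ?addr0 // => i ij.
case: eqP => [e|_]; last by rewrite mul0r.
by case/eqP: ij; apply: val_inj.
Qed.

Lemma series_mul_shift f h j k :
  series_mul f (series_mul (upow j) h) k
  = if (k < j)%N then 0 else series_mul f h (k - j)%N.
Proof.
have sE := series_mul_upow j h; move: (series_mul (upow j) h) sE => s sE.
case: ltnP => kj.
  rewrite /series_mul big1 // => i _; rewrite sE; case: ltnP; first by rewrite mulr0.
  by lia.
rewrite /series_mul; have -> : k.+1 = ((k - j).+1 + j)%N by lia.
rewrite big_split_ord /= [X in _ + X]big1 ?addr0 => [|i _].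
  apply: eq_bigr => i _; rewrite sE; have hi := ltn_ord i.
  by case: ltnP => [|_]; [lia | congr (_ * h _); lia].
rewrite sE; case: ltnP; first by rewrite mulr0.
by have := ltn_ord i; lia.
Qed.

Lemma coef_one_plus_Xn (R : comNzRingType) m k : ((1 + 'X : {poly R}) ^+ m)`_k = 'C(m, k)%:R.
Proof.
rewrite exprDn coef_sum; under eq_bigr => i _ do rewrite expr1n mul1r coefMn coefXn.
case: (leqP k m) => km.
  have km' : (k < m.+1)%N by rewrite ltnS.
  rewrite (bigD1 (Ordinal km')) //= eqxx big1 ?addr0 // => i ik.
  by case: eqP => [e|_]; [case/eqP: ik; apply: val_inj | rewrite mul0rn].
rewrite bin_small // big1 // => i _; have := ltn_ord i; case: eqP => [<-|_]; first by lia.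
by rewrite mul0rn.
Qed.

Lemma coef_Xj_one_plus j m k : (('X ^+ j * (1 + 'X) ^+ m : {poly int})`_k)%:~R
  = if (k < j)%N then 0 else bin m%:R (k - j).
Proof.
rewrite coefXnM; case: ifP => _; first by [].
by rewrite coef_one_plus_Xn one_plus_u_nat natz.
Qed.

End BinomialSeries.

Section AsymptoticSeries.
Variables (n : nat) (P : 'I_n -> int * int).

Lemma AR1_seriesE (beta : divisor n) k : AR1_series P beta k =
  let gm := g_max P beta in
  let K := canonical (n := n) in
  let term j m := if (k < j)%N then 0 else one_plus_u m (k - j) in
  - (dot P beta beta)%:~R * term 3%N (gm - 3) + 2 * (dot P K beta)%:~R * term 2%N (gm - 3)
  + (euler_char n)%:~R * term 0%N (gm - 1) - (dot P K K)%:~R * term 1%N (gm - 3).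
Proof.
rewrite /AR1_series /=; set gm := g_max P beta.
have e3 := series_mul_shift (one_plus_u gm) (one_plus_u (-3)) 3 k.
have e2 := series_mul_shift (one_plus_u gm) (one_plus_u (-3)) 2 k.
have e1 := series_mul_shift (one_plus_u gm) (one_plus_u (-3)) 1 k.
have e0 := one_plus_uD gm (-1) k.
rewrite !one_plus_uD in e3 e2 e1; rewrite subn0 -e0.
move: ((dot P (canonical (n := n)) (canonical (n := n)))%:~R : rat) => kk.
move: ((dot P (canonical (n := n)) beta)%:~R : rat) => kb.
move: ((dot P beta beta)%:~R : rat) ((euler_char n)%:~R : rat) => b c.
rewrite -[X in - b * X]e3 -[X in 2 * kb * X]e2 -[X in - (kk * X)]e1.
move: (series_mul (upow 3) _) (series_mul (upow 2) _) (series_mul (upow 1) _) => s3 s2 s1.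
rewrite /series_mul !big_distrr -!big_split -sumrB /=.
by apply: eq_bigr => i _; ring.
Qed.

End AsymptoticSeries.

Section ClosedForm.
Variables (a bt bb : nat) (sL sR : seq int) (W : nat -> nat).
Hypothesis a_gt2 : (2 < a)%N.
Hypothesis size_sL : size sL = a.
Hypothesis size_sR : size sR = a.
Hypothesis W_bot : W 0%N = bb.
Hypothesis W_top : W a = bt.
Hypothesis W_gt2 : forall i, (i <= a)%N -> (2 < W i)%N.
Hypothesis ends_width :
  (W 1%N + W a.-1 = bb + bt + (size (ascents sL) + size (ascents sR)))%N.
Local Notation v := (1 + 'X : {poly int}).

Lemma width_sum_exponent : (width_sum a W = exponent a W + a.-1)%N.
Proof.
have E : (\sum_(j <- iota 1 a.-1) 1 = a.-1)%N by rewrite sum1_size size_iota.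
rewrite -[X in (_ + X)%N]E /exponent -big_split; apply: eq_big_seq => j.
by rewrite mem_iota => hj /=; have := @W_gt2 j; lia.
Qed.

(** This makes the division by [(1 + u)^3] exact and the natural number [exponent a W - 3] a true
    difference. *)
Lemma exponent_gt2 : (2 < exponent a W)%N.
Proof.
have h : (\sum_(j <- iota 1 a.-1) 2 <= exponent a W)%N.
  rewrite /exponent big_seq [X in (_ <= X)%N]big_seq; apply: leq_sum => j.
  by rewrite mem_iota => hj; have := @W_gt2 j; lia.
by move: h; rewrite big_const_seq count_predT size_iota iter_addn_0; lia.
Qed.

Lemma low_totalE : low_total a bt bb sL sR W = 'X ^+ a.-1 *
   ((- (2 * width_sum a W + (bb + bt))%N%:Z)%:P * ('X ^+ 3 * v ^+ (exponent a W - 3))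
     - (2 * (2 * a + (bb + bt)))%N%:Z%:P * ('X ^+ 2 * v ^+ (exponent a W - 3))
     + (size (ascents sL) + size (ascents sR) + 4)%N%:Z%:P * v ^+ (exponent a W - 1)
     - (8 - (size (ascents sL) + size (ascents sR))%N%:Z)%:P * ('X ^+ 1 * v ^+ (exponent a W - 3))).
Proof.
have v0 : v ^+ 3 != 0.
  apply/expf_neq0/eqP => e; have := congr1 (fun p : {poly int} => p`_0) e.
  by rewrite coefD coefC coefX coef0.
have W0 j : (j <= a)%N -> (0 < W j)%N by move/W_gt2; lia.
have polyCnat k : (k%:Z%:P : {poly int}) = k%:R by rewrite -natz rmorph_nat.
apply: (mulfI v0); rewrite (total_mul a_gt2 size_sL size_sR W_bot W_top W_gt2 ends_width).
rewrite (word_sumE W0) -/(exponent a W).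
have := exponent_gt2; move: (exponent a W) => [|[|[|e]]] // _.
have -> : (e.+3 - 3 = e)%N by lia.
have -> : (e.+3 - 1 = e + 2)%N by lia.
have -> : e.+3 = (e + 3)%N by lia.
rewrite !rmorphB !rmorphN /= !polyCnat !exprD.
ring.
Qed.

Lemma low_total_coefE k : ((low_total a bt bb sL sR W)`_(a.-1 + k))%:~R =
  let M := (exponent a W)%:R : rat in
  let term j m := if (k < j)%N then 0 else one_plus_u m (k - j) in
  - (2 * width_sum a W + (bb + bt))%N%:R * term 3%N (M - 3)
  - (2 * (2 * a + (bb + bt)))%N%:R * term 2%N (M - 3)
  + (size (ascents sL) + size (ascents sR) + 4)%N%:R * term 0%N (M - 1)
  - (8 - (size (ascents sL) + size (ascents sR))%N%:R) * term 1%N (M - 3).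
Proof.
rewrite low_totalE coefXnM; case: ltnP => [|_]; first by lia.
rewrite addKn; have e2 := exponent_gt2.
have E3 : ((exponent a W)%:R - 3 : rat) = (exponent a W - 3)%N%:R by rewrite natrB.
have E1 : ((exponent a W)%:R - 1 : rat) = (exponent a W - 1)%N%:R by rewrite natrB //; lia.
rewrite /= E3 E1 subn0 -!coef_Xj_one_plus one_plus_u_nat.
move: (2 * width_sum a W + (bb + bt))%N (2 * (2 * a + (bb + bt)))%N => A B.
move: (size (ascents sL) + size (ascents sR) + 4)%N (size (ascents sL) + size (ascents sR))%N => C D.
rewrite coefB coefD coefB !coefCM coef_one_plus_Xn.
move: ('X^3 * _)`_k ('X^2 * _)`_k ('X^1 * _)`_k => x y z.
by rewrite !(rmorphB, rmorphD, rmorphM, rmorphN) /= -!pmulrn natz.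
Qed.

End ClosedForm.

(** * Smooth h-transverse polygons *)

Section CyclicIndex.
Variable n : nat.

Lemma val_iter_ordS k (i : 'I_n) : val (iter k (@ordS n) i) = ((i + k) %% n)%N.
Proof.
elim: k => [|k IH] /=; first by rewrite addn0 modn_small.
by rewrite IH -addn1 modnDml addnAC addn1 addnS.
Qed.

Lemma iter_ordS_size (i : 'I_n) : iter n (@ordS n) i = i.
Proof. by apply: val_inj; rewrite val_iter_ordS modnDr modn_small. Qed.

Lemma iter_ordS_dvdn k (i : 'I_n) : (iter k (@ordS n) i == i) = (n %| k)%N.
Proof.
rewrite -val_eqE /= val_iter_ordS.
rewrite -{2}(modn_small (ltn_ord i)) -{2}[nat_of_ord i]addn0.
by rewrite eqn_modDl mod0n.
Qed.

Lemma ordS_reach (i j : 'I_n) p : exists2 k, (p <= k)%N & iter k (@ordS n) i = j.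
Proof.
have n0 : (0 < n)%N := leq_ltn_trans (leq0n i) (ltn_ord i).
exists (p * n + (j + (n - i)))%N.
  by apply: leq_trans (leq_addr _ _); rewrite -{1}[p]muln1 leq_mul2l n0 orbT.
apply: val_inj; rewrite val_iter_ordS addnCA modnMDl.
have -> : (i + (j + (n - i)) = j + n)%N by have := ltn_ord i; lia.
by rewrite modnDr modn_small.
Qed.

Lemma perm_iter_ordS (i : 'I_n) :
  perm_eq [seq iter k (@ordS n) i | k <- iota 0 n] (enum 'I_n).
Proof.
apply: uniq_perm; rewrite ?enum_uniq //.
  rewrite map_inj_in_uniq ?iota_uniq // => k l; rewrite !mem_iota !add0n /= => kn ln.
  move=> /(congr1 val); rewrite !val_iter_ordS => /eqP.
  by rewrite eqn_modDl !modn_small // => /eqP.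
move=> j; rewrite mem_enum; apply/mapP.
have [k _ <-] := ordS_reach i j 0.
exists (k %% n)%N; first by rewrite mem_iota ltn_pmod // (leq_ltn_trans (leq0n i)).
by apply: val_inj; rewrite !val_iter_ordS modnDmr.
Qed.

Lemma ordS_neq (i : 'I_n) : (1 < n)%N -> ordS i != i.
Proof. by move=> n1; rewrite (iter_ordS_dvdn 1) dvdn1; lia. Qed.

Lemma ordSS_neq (i : 'I_n) : (2 < n)%N -> ordS (ordS i) != i.
Proof.
move=> n2; rewrite (iter_ordS_dvdn 2); apply/negP => /dvdn_leq; lia.
Qed.

End CyclicIndex.

Section ConvexPolygon.
Variables (n : nat) (P : 'I_n -> int * int).
Hypothesis convexP : convex_polygon P.

Let n_gt2 : (2 < n)%N. Proof. by case: convexP. Qed.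

Lemma edge_vecE i : edge_vec P i = ((edge_dir P i).1 * (edge_len P i)%:Z,
                                    (edge_dir P i).2 * (edge_len P i)%:Z).
Proof.
rewrite /edge_dir /edge_len; case: (edge_vec P i) => x y /=.
by rewrite !divzK ?dvdzE /= ?dvdn_gcdl ?dvdn_gcdr.
Qed.

Lemma side_ge0 i j : 0 <= det (edge_dir P i) (P j - P i)
  /\ (det (edge_dir P i) (P j - P i) = 0 -> j = i \/ j = ordS i).
Proof.
have E : det (edge_vec P i) (P j - P i)
    = det (edge_dir P i) (P j - P i) * (edge_len P i)%:Z.
  by rewrite edge_vecE /det /=; ring.
have len0 : (0 < edge_len P i)%N.
  rewrite lt0n; apply/eqP => e; have [_ cP] := convexP.
  have SSn : ordS (ordS i) != ordS i by rewrite ordS_neq // ltnW.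
  have := cP i (ordS (ordS i)) (ordSS_neq i n_gt2) SSn.
  by rewrite edge_vecE e /det /= !mulr0 !mul0r subrr ltxx.
have [->|ji] := eqVneq j i; first by rewrite subrr /det /=; split=> //; [lia | left].
have [->|jSi] := eqVneq j (ordS i).
  split; last by right.
  by rewrite -/(edge_vec P i) edge_vecE /det /=; nia.
have [_ /(_ i j ji jSi)] := convexP; rewrite E => h.
by split; [nia | move=> e; rewrite e mul0r ltxx in h].
Qed.

(** Of two edges with the same direction, each would lie on the left of the other, hence both on one
    line. Convexity then makes each the successor of the other, which is impossible with more than
    two edges. *)
Lemma normal_inj : injective (normal P).
Proof.
move=> i j e; have e2 : (edge_dir P i).2 = (edge_dir P j).2 := congr1 fst e.
have e1 : (edge_dir P i).1 = (edge_dir P j).1 by apply: oppr_inj; apply: (congr1 snd e).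
have [//|ij] := eqVneq i j; exfalso.
have [s1 z1] := side_ge0 i j; have [s2 z2] := side_ge0 j i.
have E : det (edge_dir P i) (P j - P i) = - det (edge_dir P j) (P i - P j).
  move: (edge_dir P i) (edge_dir P j) (P i) (P j) e1 e2 => [u1 u2] [w1 w2] p q /= -> ->.
  by rewrite /det /=; ring.
have d1 : det (edge_dir P i) (P j - P i) = 0 by lia.
have d2 : det (edge_dir P j) (P i - P j) = 0 by lia.
case: (z1 d1) => [ji|jS]; first by rewrite ji eqxx in ij.
case: (z2 d2) => [ji|iS]; first by rewrite ji eqxx in ij.
by have := ordSS_neq i n_gt2; rewrite -jS -iS eqxx.
Qed.

Hypothesis smoothP : smooth_surface P.

(* Otherwise the extremal edge [j] would pass through the common vertex of the
   edges [i] and [ordS i]. *)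
Lemma normal_neq_add i j : normal P j != normal P i + normal P (ordS i).
Proof.
apply/eqP => e.
have e2 : (edge_dir P j).2 = (edge_dir P i).2 + (edge_dir P (ordS i)).2 := congr1 fst e.
have e1 : (edge_dir P j).1 = (edge_dir P i).1 + (edge_dir P (ordS i)).1.
  by apply: oppr_inj; rewrite opprD; apply: (congr1 snd e).
have [s1 z1] := side_ge0 i j; have [s2 z2] := side_ge0 (ordS i) j.
have [s3 _] := side_ge0 j (ordS i).
have E1 : det (edge_dir P i) (P j - P i) = det (edge_dir P i) (P j - P (ordS i)).
  have -> : P (ordS i) = P i + edge_vec P i by rewrite addrC subrK.
  by rewrite edge_vecE /det /=; ring.
have E : det (edge_dir P j) (P (ordS i) - P j)
    = - det (edge_dir P i) (P j - P i) - det (edge_dir P (ordS i)) (P j - P (ordS i)).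
  rewrite E1; move: e1 e2; move: (edge_dir P i) (edge_dir P j) (edge_dir P _) (P _) (P j).
  by move=> [u1 u2] [w1 w2] [z1' z2'] p q /= -> ->; rewrite /det /=; ring.
have d1 : det (edge_dir P i) (P j - P i) = 0 by lia.
have d2 : det (edge_dir P (ordS i)) (P j - P (ordS i)) = 0 by lia.
have jS : j = ordS i.
  case: (z1 d1) => [ji|//]; case: (z2 d2) => [//|jSS].
  by have := ordSS_neq i n_gt2; rewrite -jSS ji eqxx.
have n0 : normal P i = 0 by apply: (@addIr _ (normal P (ordS i))); rewrite add0r -e jS.
by have := smoothP i; rewrite n0 /det /= !mul0r subrr.
Qed.

Hypothesis htP : h_transverse P.
Hypothesis horP : horizontal P.

Lemma normal_cases i : [\/ (normal P i).1 = 1, (normal P i).1 = -1 | (normal P i).1 = 0].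
Proof.
have -> : (normal P i).1 = (edge_dir P i).2 by [].
by case/or3P: (htP i) => [/eqP ->|/eqP ->|/orP[/eqP ->|/eqP ->]];
  [apply: Or33 | apply: Or33 | apply: Or31 | apply: Or32].
Qed.

Lemma exists_horizontal (x : int) : x = 1 \/ x = -1 -> exists i, normal P i = (0, x).
Proof. by case: horP => [[i hi] [j hj]] [->|->]; [exists i | exists j]. Qed.

Lemma normal_after_end (x : int) i : x = 1 \/ x = -1 ->
  normal P i = (0, - x) -> (normal P (ordS i)).1 = x.
Proof.
move=> hx e; have := smoothP i; have := normal_cases (ordS i); rewrite e.
move: (normal P _) => [u w]; rewrite /det /=.
by case: hx => -> [->|->|->]; lia.
Qed.

(** Determinant 1 allows a third successor, [(- x, x - k)]. But its sum with [(x, k)] is the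
    horizontal normal [(0, x)], which occurs among the normals, against [normal_neq_add]. *)
Lemma normal_after_side (x k : int) i : x = 1 \/ x = -1 -> normal P i = (x, k) ->
  normal P (ordS i) = (x, k + x) \/ normal P (ordS i) = (0, x).
Proof.
move=> hx e; have sm := smoothP i; rewrite e in sm.
have [j hj] := exists_horizontal hx; have := normal_neq_add i j; rewrite hj e.
have hu := normal_cases (ordS i); move: sm hu; case: (normal P (ordS i)) => u w; rewrite /det /= => sm hu ne.
have [ux|ux] := eqVneq u x.
  by left; rewrite ux; congr (_, _); move: sm; rewrite ux; case: hx => ->; lia.
have [u0|u0] := eqVneq u 0.
  by right; rewrite u0; congr (_, _); move: sm; rewrite u0; case: hx => ->; lia.
have uN : u = - x by case: hx ux u0 => ->; case: hu => ->.
exfalso; move/eqP: ne; apply; rewrite uN.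
have -> : w = x - k by move: sm; rewrite uN; case: hx => ->; lia.
apply/eqP; by rewrite xpair_eqE /=; apply/andP; split; apply/eqP; lia.
Qed.

Variable i0 : 'I_n.
Definition nu (k : nat) : int * int := normal P (iter k (@ordS n) i0).

(** The second coordinate moves by [x] at each step until the first coordinate changes, and the only
    possible change is to [(0, x)]. The length [m] is the first time when this happens; it exists
    because that normal is present and is reached cyclically. *)
Lemma nu_chain (x : int) p : x = 1 \/ x = -1 -> nu p = (0, - x) ->
  exists (k : int) (m : nat), [/\ (0 < m)%N,
    forall j, (j < m)%N -> nu (p.+1 + j) = (x, k + x * j%:Z) & nu (p.+1 + m) = (0, x)].
Proof.
move=> hx ep; have x0 : x != 0 by case: hx => ->.
have e1 : (nu p.+1).1 = x by apply: normal_after_end.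
have ex : exists j, (nu (p.+1 + j)).1 != x.
  have [t ht] := exists_horizontal hx; have [q pq hq] := ordS_reach i0 t p.+1.
  by exists (q - p.+1)%N; rewrite subnKC // /nu hq ht eq_sym.
case: (ex_minnP ex) => m hm minm.
have m0 : (0 < m)%N by rewrite lt0n; apply/eqP => e; rewrite e addn0 e1 eqxx in hm.
have H j : (j < m)%N -> nu (p.+1 + j) = (x, (nu p.+1).2 + x * j%:Z).
  elim: j => [|j IH] jm; first by rewrite addn0 mulr0 addr0 -e1; case: (nu p.+1).
  have e := IH (ltnW jm); rewrite addnS.
  case: (normal_after_side hx e) => e'; rewrite /nu iterS e'.
    by congr (_, _); rewrite intS; ring.
  have : (m <= j.+1)%N by apply: minm; rewrite addnS /nu iterS e' /= eq_sym.
  by lia.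
exists (nu p.+1).2, m; split=> //.
have hm1 : (m.-1 < m)%N by lia.
have -> : (p.+1 + m = (p.+1 + m.-1).+1)%N by lia.
case: (normal_after_side hx (H _ hm1)) => e; rewrite /nu iterS // in hm *.
have E : (p.+1 + m = (p.+1 + m.-1).+1)%N by lia.
by rewrite E iterS e eqxx in hm.
Qed.

Hypothesis bot0 : normal P i0 = (0, -1).

Lemma nu_structure : exists (kr kl : int) (nr nl : nat),
  [/\ (0 < nr)%N, (0 < nl)%N, n = (nr + nl).+2
    & [/\ nu 0 = (0, -1), forall j, (j < nr)%N -> nu j.+1 = (1, kr + j%:Z),
          nu nr.+1 = (0, 1)
        & forall j, (j < nl)%N -> nu (nr.+2 + j) = (-1, kl - j%:Z)]].
Proof.
have [kr [nr [nr0 hr tr]]] := nu_chain (or_introl erefl) (p := 0) bot0.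
have tr' : nu nr.+1 = (0, - -1) by rewrite opprK.
have [kl [nl [nl0 hl tl]]] := nu_chain (or_intror erefl) tr'.
exists kr, kl, nr, nl; split=> //; last first.
  split=> // j hj; first by rewrite -[j.+1]add1n hr // mul1r.
  by rewrite hl // mulN1r.
(* After both chains the normal is again the bottom one; as normals are distinct, the round trip has
   a length divisible by [n]. *)
have Nn : (n %| (nr + nl).+2)%N.
  rewrite -(iter_ordS_dvdn _ i0); apply/eqP/normal_inj; rewrite bot0 -/(nu _).
  by rewrite -tl; congr (nu _); lia.
have n0 : (0 < n)%N by apply: ltn_trans n_gt2.
(* If [n] were smaller, the bottom normal, met again after [n] steps, would occur inside the right
   chain, at the top or inside the left chain. *)
apply/eqP; rewrite eqn_leq [X in _ && X]leqNgt dvdn_leq //; apply/negP => nN.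
have : nu n = (0, -1) by rewrite /nu iter_ordS_size.
case: (leqP n nr) => h1.
  by rewrite -(prednK n0) -[n.-1.+1]add1n hr //; lia.
case: (eqVneq n nr.+1) => [->|h2]; first by rewrite tr.
have -> : n = (nr.+2 + (n - nr.+2))%N by lia.
by rewrite hl //; lia.
Qed.

End ConvexPolygon.

(** * Intersection numbers and the polygon of a class *)

Section Intersection.
Variables (n : nat) (P : 'I_n -> int * int).
Hypothesis n_gt2 : (2 < n)%N.

Local Notation prev i := (ord_pred i).
Local Notation self i := (det (normal P (prev i)) (normal P (ordS i))).

Lemma ordS_sum (F : 'I_n -> int) : \sum_i F (ordS i) = \sum_i F i.
Proof. by rewrite [RHS](reindex_inj (@ordS_inj n)). Qed.

Lemma ord_pred_sum (F : 'I_n -> int) : \sum_i F (prev i) = \sum_i F i.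
Proof. by rewrite -ordS_sum; apply: eq_bigr => i _; rewrite ordSK. Qed.

Lemma dot_toric (c : divisor n) i :
  dot P c (toric_divisor i) = c (prev i) + c (ordS i) - self i * c i.
Proof.
have Sp : ordS (prev i) = i by rewrite ord_predK.
have h1 : ordS i != i by apply: ordS_neq; apply: ltnW.
have h2 : prev i != i by rewrite -{2}Sp eq_sym; apply: ordS_neq; apply: ltnW.
have h3 : ordS i != prev i by rewrite -{1}Sp; apply: ordSS_neq.
rewrite /dot (eq_bigr (fun k => c k * inter P k i)) => [|k _]; last first.
  rewrite (bigD1 i) //= /toric_divisor eqxx mulr1 big1 ?addr0 // => j /negPf ->.
  by rewrite mulr0 mul0r.
rewrite (bigD1 i) //= (bigD1 (ordS i)) //= (bigD1 (prev i)) /=; last first.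
  by rewrite h2 eq_sym h3.
rewrite big1 ?addr0 => [|k /andP[/andP[ki kS] kp]].
  rewrite /inter eqxx (negPf h1) (negPf h2) Sp !eqxx orbT /=.
  by ring.
rewrite /inter (negPf ki) (negPf kS) orbF.
have -> : (i == ordS k) = false; last by rewrite mulr0.
by apply/negP => /eqP e; move: kp; rewrite e ordSK eqxx.
Qed.

Lemma dotE (c d : divisor n) : dot P c d = \sum_i d i * dot P c (toric_divisor i).
Proof.
rewrite /dot exchange_big /=; apply: eq_bigr => j _.
rewrite big_distrr /=; apply: eq_bigr => i _.
rewrite (bigD1 j) //= /toric_divisor eqxx mulr1 big1 ?addr0 => [|k /negPf ->]; first by ring.
by rewrite mulr0 mul0r.
Qed.

Lemma inter_sym i j : inter P i j = inter P j i.
Proof. by rewrite /inter eq_sym orbC; case: eqP => [->|]. Qed.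

Lemma dotC (c d : divisor n) : dot P c d = dot P d c.
Proof.
rewrite /dot exchange_big /=; apply: eq_bigr => j _; apply: eq_bigr => i _.
by rewrite inter_sym [d j * _]mulrC.
Qed.

Hypothesis smoothP : smooth_surface P.

(** Plane vectors satisfy [det(b,c) a + det(a,b) c = det(a,c) b], and smoothness makes the first two
    determinants 1. *)
Lemma normal_relation i :
  (normal P (prev i)).1 + (normal P (ordS i)).1 = self i * (normal P i).1 /\
  (normal P (prev i)).2 + (normal P (ordS i)).2 = self i * (normal P i).2.
Proof.
have := smoothP i; have := smoothP (prev i); rewrite ord_predK.
move: (normal P (prev i)) (normal P i) (normal P (ordS i)) => [a1 a2] [b1 b2] [c1 c2].
rewrite /det /= => h1 h2; split.
  transitivity ((b1 * c2 - b2 * c1) * a1 + (a1 * b2 - a2 * b1) * c1); last by ring.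
  by rewrite h1 h2 !mul1r.
transitivity ((b1 * c2 - b2 * c1) * a2 + (a1 * b2 - a2 * b1) * c2); last by ring.
by rewrite h1 h2 !mul1r.
Qed.

Lemma dot_lin_equiv (c c' : divisor n) i : lin_equiv P c c' ->
  dot P c (toric_divisor i) = dot P c' (toric_divisor i).
Proof.
case=> m hm; have [r1 r2] := normal_relation i; rewrite !dot_toric.
have e j : c j = c' j + (m.1 * (normal P j).1 + m.2 * (normal P j).2).
  by rewrite -hm addrC subrK.
rewrite !e; set k := self i in r1 r2 *.
transitivity (c' (prev i) + c' (ordS i) - k * c' i
   + (m.1 * ((normal P (prev i)).1 + (normal P (ordS i)).1 - k * (normal P i).1)
      + m.2 * ((normal P (prev i)).2 + (normal P (ordS i)).2 - k * (normal P i).2))).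
  by ring.
by rewrite r1 r2 !subrr !mulr0 !addr0.
Qed.

Lemma dot_lin_equiv2 (c c' d d' : divisor n) : lin_equiv P c c' -> lin_equiv P d d' ->
  dot P c d = dot P c' d'.
Proof.
move=> cc dd; transitivity (dot P c' d).
  by rewrite !dotE; apply: eq_bigr => i _; rewrite (dot_lin_equiv i cc).
by rewrite dotC [RHS]dotC !dotE; apply: eq_bigr => i _; rewrite (dot_lin_equiv i dd).
Qed.

Lemma lin_equiv_refl (c : divisor n) : lin_equiv P c c.
Proof. by exists (0, 0) => i; rewrite subrr /= !mul0r addr0. Qed.

Section Beta.
Variable beta : divisor n.
Local Notation m i := (dot P beta (toric_divisor i)).

(** The polygon closes up: summation by parts moves the intersection form onto the coordinates of
    the normals, which it kills by [normal_relation]. *)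
Lemma sum_normal : \sum_i m i * (normal P i).1 = 0 /\ \sum_i m i * (normal P i).2 = 0.
Proof.
have H (f : 'I_n -> int) : (forall i, f (prev i) + f (ordS i) = self i * f i) ->
    \sum_i m i * f i = 0.
  move=> hf; under eq_bigr => i _ do rewrite dot_toric.
  transitivity (\sum_i beta (prev i) * f i + \sum_i beta (ordS i) * f i
     - \sum_i beta i * (self i * f i)).
    by rewrite -big_split -sumrB; apply: eq_bigr => i _; rewrite /=; ring.
  rewrite -(ordS_sum (fun i => beta (prev i) * f i)) -(ord_pred_sum (fun i => beta (ordS i) * f i)).
  rewrite -big_split -sumrB big1 // => i _ /=.
  by rewrite ordSK ord_predK -hf; ring.
by split; apply: H => i; have [h1 h2] := normal_relation i.
Qed.

Lemma beta_vertex_last (i : 'I_n) : (i.+1 = n)%N ->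
  beta_polygon P beta i + edge_dir P i *~ m i = 0.
Proof.
move=> iN; rewrite /beta_polygon.
have -> : \sum_(j < n | (j < i)%N) edge_dir P j *~ m j + edge_dir P i *~ m i
   = \sum_j edge_dir P j *~ m j.
  rewrite [RHS](bigD1 i) //= addrC; congr (_ + _); apply: eq_bigl => j.
  rewrite -val_eqE /=; have := ltn_ord j; lia.
have [s1 s2] := sum_normal.
have e1 : (\sum_j edge_dir P j *~ m j).1 = 0.
  apply: oppr_inj; rewrite oppr0 -s2 (raddf_sum fst) -sumrN; apply: eq_bigr => j _.
  by rewrite (raddfMz fst) mulrzz mulrC -mulrN.
have e2 : (\sum_j edge_dir P j *~ m j).2 = 0.
  rewrite -s1 (raddf_sum snd); apply: eq_bigr => j _.
  by rewrite (raddfMz snd) mulrzz mulrC.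
by move: (\sum_j _) e1 e2 => [x y] /= -> ->.
Qed.

Local Notation Q := (beta_polygon P beta).

Lemma beta_edge i : edge_vec Q i = edge_dir P i *~ m i.
Proof.
(* Vertices are partial sums, so only the edge from the last vertex back to the origin needs the
   closing relation. *)
rewrite /edge_vec; have [iN|iN] := eqVneq i.+1 n.
  have S0 : (ordS i : nat) = 0%N by rewrite /= iN modnn.
  rewrite {1}/beta_polygon big_pred0 => [|j]; last by rewrite S0.
  by rewrite sub0r -(opprK (edge_dir P i *~ _)); congr (- _); apply/eqP;
     rewrite -addr_eq0 beta_vertex_last.
have Si : (ordS i : nat) = i.+1 by rewrite /= modn_small //; have := ltn_ord i; lia.
rewrite {1}/beta_polygon (bigD1 i); last by rewrite Si.
rewrite -addrA [X in _ + X](_ : _ = 0) ?addr0 //; apply/eqP; rewrite subr_eq0; apply/eqP.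
apply: eq_bigl => j; rewrite Si -val_eqE /=; lia.
Qed.

Lemma beta_x i : (Q (ordS i)).1 = (Q i).1 - m i * (normal P i).2.
Proof.
have := congr1 fst (beta_edge i); rewrite (raddfMz fst) mulrzz mulrC.
have -> : (normal P i).2 = - (edge_dir P i).1 by [].
by rewrite mulrN opprK => <-; rewrite addrC subrK.
Qed.

Lemma beta_y i : (Q (ordS i)).2 = (Q i).2 + m i * (normal P i).1.
Proof.
have := congr1 snd (beta_edge i); rewrite (raddfMz snd) mulrzz mulrC.
have -> : (normal P i).1 = (edge_dir P i).2 by [].
by move=> <-; rewrite addrC subrK.
Qed.

(* The support numbers [h] of the polygon define a divisor with the same
   intersection numbers as [beta], and twice the area is [\sum_i h i * m i]. *)
Lemma beta_double_area : double_area Q = dot P beta beta.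
Proof.
pose h : divisor n := fun i => (Q i).1 * (normal P i).1 + (Q i).2 * (normal P i).2.
have hm i : dot P h (toric_divisor i) = m i.
  have [r1 r2] := normal_relation i; have sm := smoothP i; rewrite dot_toric /h.
  set k := self i in r1 r2 *.
  have := beta_x (prev i); have := beta_y (prev i); have := beta_x i; have := beta_y i.
  rewrite ord_predK.
  move: (normal P i) (normal P (prev i)) (normal P (ordS i)) r1 r2 sm => [b1 b2] [a1 a2] [c1 c2].
  move: (Q i) (Q (prev i)) (Q (ordS i)) (m i) (m (prev i)) => [x y] [xp yp] [xs ys] mi mp.
  rewrite /det /= => r1 r2 sm -> -> ey ex.
  have -> : xp = x + mp * a2 by rewrite ex subrK.
  have -> : yp = y - mp * a1 by rewrite ey addrK.
  transitivity (x * (a1 + c1 - k * b1) + y * (a2 + c2 - k * b2) + mi * (b1 * c2 - b2 * c1)).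
    by ring.
  by rewrite r1 r2 sm !subrr !mulr0 !add0r mulr1.
transitivity (\sum_i h i * m i).
  apply: eq_bigr => i _; rewrite /det /h beta_x beta_y; ring.
by rewrite -dotE dotC dotE [RHS]dotE; apply: eq_bigr => i _; rewrite hm.
Qed.

Hypothesis htP : h_transverse P.
Hypothesis m_gt0 : forall i, 0 < m i.

Lemma beta_edge_len i : edge_len Q i = `|m i|%N.
Proof.
rewrite /edge_len beta_edge; have -> : (edge_dir P i *~ m i).1 = (edge_dir P i).1 * m i.
  by rewrite (raddfMz fst) mulrzz.
have -> : (edge_dir P i *~ m i).2 = (edge_dir P i).2 * m i by rewrite (raddfMz snd) mulrzz.
rewrite !abszM -muln_gcdl; suff -> : gcdn `|(edge_dir P i).1| `|(edge_dir P i).2| = 1%N.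
  by rewrite mul1n.
by case/or3P: (htP i) => [/eqP ->|/eqP ->|/orP[/eqP ->|/eqP ->]]; rewrite ?gcdn1 ?gcd1n.
Qed.

Lemma beta_edge_dir i : edge_dir Q i = edge_dir P i.
Proof.
have mi0 : m i != 0 by rewrite gt_eqF.
rewrite {1}/edge_dir beta_edge_len beta_edge gez0_abs ?ltW //.
by rewrite (raddfMz fst) (raddfMz snd) !mulrzz !mulzK //; case: (edge_dir P i).
Qed.

Lemma beta_normal i : normal Q i = normal P i.
Proof. by rewrite /normal beta_edge_dir. Qed.

End Beta.
End Intersection.

(** * Directions of a side, and area swept by it *)

Section Blocks.

Fixpoint blocks (k : int) (ms : seq nat) : seq int :=
  if ms is m :: ms' then nseq m k ++ blocks (k + 1) ms' else [::].

Lemma flatten_nseq_blocks (M : nat -> nat) (f : nat -> int) (ks : seq nat) k :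
  (forall j, (j < size ks)%N -> f (nth 0%N ks j) = k + j%:Z) ->
  flatten [seq nseq (M i) (f i) | i <- ks] = blocks k (map M ks).
Proof.
elim: ks k => //= i ks IH k h; have := h 0%N isT; rewrite addr0 /= => ->.
by rewrite (IH (k + 1)) // => j hj; have := h j.+1 hj; rewrite /= => ->; rewrite intS; ring.
Qed.

Lemma blocks_ge k ms : all (fun x => k <= x) (blocks k ms).
Proof.
elim: ms k => //= m ms IH k; rewrite all_cat all_nseq lexx orbT /=.
by apply: sub_all (IH (k + 1)) => x; lia.
Qed.

Lemma sorted_blocks k ms : sorted <=%R (blocks k ms).
Proof.
rewrite (sorted_pairwise le_trans); elim: ms k => //= m ms IH k.
rewrite pairwise_cat IH andbT; apply/andP; split.
  apply/allrelP => x y; rewrite mem_nseq => /andP[_ /eqP ->] /(allP (blocks_ge _ _)); lia.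
by apply/(pairwiseP 0) => i j; rewrite !inE size_nseq => hi hj _; rewrite !nth_nseq hi hj.
Qed.

Fixpoint ascent_count (x : int) (s : seq int) : nat :=
  if s is y :: s' then ((y == x + 1)%R + ascent_count y s')%N else 0%N.

Lemma size_ascents x s : size (ascents (x :: s)) = ascent_count x s.
Proof.
elim: s x => //= y s IH x; rewrite -IH /ascents !size_filter /=.
by rewrite -[1%N]addn0 iotaDl count_map.
Qed.

Lemma ascent_count_nseq x m s : ascent_count x (nseq m x ++ s) = ascent_count x s.
Proof.
elim: m => //= m ->; case: eqP => [e|_]; last by rewrite add0n.
by exfalso; lia.
Qed.

Lemma ascent_count_blocks k ms : all (fun m => 0 < m)%N ms ->
  ascent_count k (blocks (k + 1) ms) = size ms.
Proof.
elim: ms k => //= -[//|m] ms IH k /= h.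
by rewrite eqxx ascent_count_nseq IH.
Qed.

Lemma size_ascents_blocks k ms : all (fun m => 0 < m)%N ms ->
  size (ascents (blocks k ms)) = (size ms).-1.
Proof.
case: ms => //= -[//|m] ms /= h.
by rewrite size_ascents ascent_count_nseq ascent_count_blocks.
Qed.

Lemma last_blocks x k ms : all (fun m => 0 < m)%N ms -> (0 < size ms)%N ->
  last x (blocks k ms) = k + (size ms).-1%:Z.
Proof.
elim: ms x k => //= -[//|m] ms IH x k /= h _.
rewrite last_cat; have -> : last k (nseq m k) = k by elim: m {h} => //= m; case: m.
case: ms IH h => [|m' ms] IH h; first by rewrite /= addr0.
by rewrite IH // [in RHS]/= -addrA intS.
Qed.

Lemma head_blocks k ms : all (fun m => 0 < m)%N ms -> (0 < size ms)%N -> (blocks k ms)`_0 = k.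
Proof. by case: ms => // -[]. Qed.

Definition double_psum (s : seq int) : int :=
  \sum_(i <- iota 0 (size s)) (psum s i + psum s i.+1).

Lemma psum_cons x s i : psum (x :: s) i.+1 = x + psum s i.
Proof. by rewrite /psum /= big_cons. Qed.

Lemma double_psum_cons x s :
  double_psum (x :: s) = x + 2 * x * (size s)%:Z + double_psum s.
Proof.
rewrite /double_psum [size _]/= [iota 0 _]/= big_cons psum0 psum_cons psum0.
rewrite -[1%N]addn0 iotaDl big_map.
rewrite (eq_bigr (fun i => 2 * x + (psum s i + psum s i.+1))) => [|i _]; last first.
  by rewrite add1n !psum_cons; ring.
rewrite big_split /= big_const_seq count_predT size_iota iter_addr_0 -mulr_natr natz.
ring.
Qed.

Lemma double_psum_nseq m k s : double_psum (nseq m k ++ s)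
  = k * (m%:Z * m%:Z) + 2 * k * m%:Z * (size s)%:Z + double_psum s.
Proof.
elim: m => [|m IH]; first by rewrite /=; ring.
by rewrite /= double_psum_cons IH size_cat size_nseq PoszD intS; ring.
Qed.

(* Twice the area to the left of the broken line starting at abscissa [x]
   whose successive edges go up by [M k] and right by [- M k * f k]. *)
Fixpoint trapezoids (M : nat -> nat) (f : nat -> int) (x : int) (ks : seq nat) : int :=
  if ks is k :: ks' then
    let x' := x - (M k)%:Z * f k in (x + x') * (M k)%:Z + trapezoids M f x' ks'
  else 0.

(** After [i] unit steps upwards the abscissa is [x - psum s i]: cutting each trapezoid at the
    integer heights does not change the area. *)
Lemma trapezoidsE M f x ks : let s := flatten [seq nseq (M k) (f k) | k <- ks] in
  trapezoids M f x ks = 2 * x * (size s)%:Z - double_psum s.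
Proof.
elim: ks x => [|k ks IH] x /=; first by rewrite /double_psum /= big_nil; ring.
rewrite IH double_psum_nseq size_cat size_nseq PoszD.
move: (size _) (double_psum _) => u v; ring.
Qed.

Lemma trapezoids_up M f (X : nat -> int) p r :
  (forall k, (p <= k < p + r)%N -> X k.+1 = X k - (M k)%:Z * f k) ->
  trapezoids M f (X p) (iota p r) = \sum_(k <- iota p r) (X k + X k.+1) * (M k)%:Z.
Proof.
elim: r p => [|r IH] p h /=; first by rewrite big_nil.
rewrite big_cons -h ?IH //; last by lia.
by move=> k hk; apply: h; lia.
Qed.

Lemma trapezoids_down M f (X : nat -> int) p r :
  (forall k, (p <= k < p + r)%N -> X k = X k.+1 - (M k)%:Z * f k) ->
  trapezoids M f (X (p + r)%N) (rev (iota p r)) = \sum_(k <- iota p r) (X k + X k.+1) * (M k)%:Z.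
Proof.
elim: r => [|r IH] h; first by rewrite big_nil.
have E : iota p r.+1 = rcons (iota p r) (p + r)%N by rewrite -addn1 iotaD cats1.
rewrite E rev_rcons /= addnS -h; last by lia.
rewrite IH => [|k hk]; last by apply: h; lia.
by rewrite -cats1 big_cat big_seq1 /= addrC [X _ + X _]addrC.
Qed.

(** If the increment at [i] is nonpositive, so are all later ones and [w i] is at least the last
    value; otherwise all earlier increments are positive and [w i] is at least the first value. *)
Lemma concave_ge_min (w : nat -> int) (a : nat) (b : int) :
  (forall i j, (i <= j < a)%N -> w j.+1 - w j <= w i.+1 - w i) ->
  b <= w 0%N -> b <= w a -> forall i, (i <= a)%N -> b <= w i.
Proof.
move=> cw b0 ba i ia; have [->//|ia'] := eqVneq i a.
have {ia'}ia : (i < a)%N by lia.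
case: (lerP (w i.+1 - w i) 0) => d.
  apply: le_trans ba _; have H k : (i + k <= a)%N -> w (i + k)%N <= w i.
    elim: k => [|k IH] hk; first by rewrite addn0.
    have hk' : (i + k < a)%N by lia.
    have := IH (ltnW hk'); have := cw i (i + k)%N; rewrite leq_addr hk' addnS => /(_ isT); lia.
  by have := H (a - i)%N; rewrite (subnKC (ltnW ia)); exact.
apply: le_trans b0 _; have H k : (k <= i)%N -> w 0%N <= w k.
  elim: k => // k IH hk; have := IH (ltnW hk); have hki : (k <= i < a)%N by lia.
  by have := cw k i hki; lia.
exact: H.
Qed.

End Blocks.

(* The edges of the polygon, counterclockwise from the bottom one: the k-th has
   integer length [M k], starts at [(X k, Y k)] and has outward normal
   [(s k, f k)]. *)
Section Profile.
Variables (nr nl : nat) (kr kl : int) (M : nat -> nat) (f s X Y : nat -> int).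
Hypotheses (nr_gt0 : (0 < nr)%N) (nl_gt0 : (0 < nl)%N).

Local Notation right_idx := (iota 1 nr).
Local Notation left_idx := (iota nr.+2 nl).

Hypotheses (f_bot : f 0%N = -1) (s_bot : s 0%N = 0).
Hypotheses (f_right : forall j, (j < nr)%N -> f j.+1 = kr + j%:Z)
  (s_right : forall j, (j < nr)%N -> s j.+1 = 1).
Hypotheses (f_top : f nr.+1 = 1) (s_top : s nr.+1 = 0).
Hypotheses (f_left : forall j, (j < nl)%N -> f (nr.+2 + j)%N = kl - j%:Z)
  (s_left : forall j, (j < nl)%N -> s (nr.+2 + j)%N = -1).

Local Notation n := (nr + nl).+2.
Hypotheses (X_step : forall k, (k < n)%N -> X k.+1 = X k - (M k)%:Z * f k)
  (Y_step : forall k, (k < n)%N -> Y k.+1 = Y k + (M k)%:Z * s k).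
Hypotheses (X_closed : X n = X 0) (Y_closed : Y n = Y 0).
Hypothesis M_gt2 : forall k, (k < n)%N -> (2 < M k)%N.

Definition profile_height : nat := (\sum_(k <- right_idx) M k)%N.
Definition profile_right : seq int := flatten [seq nseq (M k) (f k) | k <- right_idx].
(** The left edges are traversed downwards; the reversal lists them from bottom to top, with
    increasing directions. *)
Definition profile_left : seq int := flatten [seq nseq (M k) (f k) | k <- rev left_idx].
Definition profile_width (i : nat) : nat :=
  `|((M 0%N)%:Z - psum profile_left i - psum profile_right i)%R|%N.

Local Notation a := profile_height.
Local Notation sR := profile_right.
Local Notation sL := profile_left.
Local Notation W := profile_width.

Lemma telescope_iota (Z : nat -> int) (g : nat -> int) p r :
  (forall k, (p <= k < p + r)%N -> Z k.+1 = Z k + g k) ->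
  Z (p + r)%N = Z p + \sum_(k <- iota p r) g k.
Proof.
elim: r => [|r IH] h; first by rewrite addn0 big_nil addr0.
rewrite -[in iota _ _]addn1 iotaD big_cat big_seq1 /= addrA -IH => [|k hk]; last by apply: h; lia.
by rewrite addnS h; last lia.
Qed.

Lemma PoszD_sum (I : Type) (r : seq I) (F : I -> nat) :
  (\sum_(i <- r) F i)%N%:Z = \sum_(i <- r) (F i)%:Z.
Proof. exact: (big_morph Posz PoszD erefl). Qed.

Lemma iota_split : iota 0 n = 0%N :: right_idx ++ nr.+1 :: left_idx.
Proof.
have -> : n = (1 + (nr + (1 + nl)))%N by lia.
by rewrite iotaD [iota 0 1]/= add0n iotaD add1n iotaD [iota nr.+1 1]/= addn1.
Qed.

Lemma right_idxP k : k \in right_idx -> [/\ (k < n)%N, f k = kr + k.-1%:Z & s k = 1].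
Proof.
rewrite mem_iota; case: k => // k hk; have hk' : (k < nr)%N by lia.
by rewrite f_right ?s_right //; split=> //; clear -hk'; lia.
Qed.

Lemma left_idxP k : k \in left_idx -> [/\ (k < n)%N, f k = kl - (k - nr.+2)%N%:Z & s k = -1].
Proof.
rewrite mem_iota => /andP[h1 h2]; have hk : (k - nr.+2 < nl)%N by clear -h1 h2; lia.
have := f_left hk; have := s_left hk; rewrite subnKC // => -> ->; split=> //.
Qed.

Lemma X_1 : X 1%N = X 0%N + (M 0%N)%:Z.
Proof. by rewrite X_step // f_bot; ring. Qed.

Lemma X_top : X nr.+2 = X nr.+1 - (M nr.+1)%:Z.
Proof. by rewrite X_step ?f_top ?mulr1 // !ltnS leq_addr. Qed.

Lemma Y_1 : Y 1%N = Y 0%N.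
Proof. by rewrite Y_step // s_bot mulr0 addr0. Qed.

Lemma Y_right k : (k <= nr)%N -> Y k.+1 = Y 0%N + (\sum_(i <- iota 1 k) M i)%N%:Z.
Proof.
move=> hk; rewrite -add1n (@telescope_iota Y (fun i => (M i)%:Z)) => [|i hi].
  by rewrite Y_1 PoszD_sum.
have [i_n _ si] : [/\ (i < n)%N, f i = kr + i.-1%:Z & s i = 1].
  by apply: right_idxP; rewrite mem_iota; lia.
by rewrite Y_step // si mulr1.
Qed.

Lemma Y_left k : (k <= nl)%N ->
  Y (nr.+2 + k)%N = Y nr.+1 - (\sum_(i <- iota nr.+2 k) M i)%N%:Z.
Proof.
move=> hk; rewrite (@telescope_iota Y (fun i => - (M i)%:Z)) => [|i hi].
  rewrite PoszD_sum sumrN Y_step ?s_top ?mulr0 ?addr0 //; last by rewrite !ltnS leq_addr.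
have [i_n _ si] : [/\ (i < n)%N, f i = kl - (i - nr.+2)%N%:Z & s i = -1].
  by apply: left_idxP; rewrite mem_iota; lia.
by rewrite Y_step // si mulrN1.
Qed.

Lemma left_height : (\sum_(k <- left_idx) M k)%N = a.
Proof.
have := Y_left (leqnn nl); have := Y_right (leqnn nr); rewrite -/a.
have -> : (nr.+2 + nl)%N = n by lia.
by rewrite Y_closed; move: (\sum_(k <- left_idx) M k)%N a => u v; lia.
Qed.

Lemma Y_bounds k : (k < n)%N -> Y 0%N <= Y k <= Y 0%N + a%:Z.
Proof.
have part p q r : (q <= r)%N -> (\sum_(i <- iota p q) M i <= \sum_(i <- iota p r) M i)%N.
  by move=> qr; rewrite -(subnKC qr) iotaD big_cat leq_addr.
case: k => [|k] kn; first by rewrite lexx lerDl.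
have [kr'|kr'] := leqP k nr.
  by rewrite Y_right //; have := part 1%N _ _ kr'; rewrite -/a; lia.
have -> : k.+1 = (nr.+2 + (k - nr.+1))%N by lia.
have hk : (k - nr.+1 <= nl)%N by lia.
rewrite Y_left // Y_right // -/a; have := part nr.+2 _ _ hk; rewrite left_height; lia.
Qed.

Lemma Y_top : Y nr.+1 = Y 0%N + a%:Z.
Proof. exact: Y_right. Qed.

Lemma profile_rightE : sR = blocks kr [seq M k | k <- right_idx].
Proof.
apply: flatten_nseq_blocks => j; rewrite size_iota => hj.
by rewrite nth_iota // add1n f_right.
Qed.

Lemma profile_leftE : sL = blocks (kl - nl.-1%:Z) [seq M k | k <- rev left_idx].
Proof.
apply: flatten_nseq_blocks => j; rewrite size_rev size_iota => hj.
rewrite nth_rev size_iota // nth_iota; last by rewrite ltn_subrL.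
by rewrite f_left; [lia | rewrite ltn_subrL].
Qed.

Lemma M_gt0_all ks : {subset ks <= iota 0 n} -> all (fun m => 0 < m)%N [seq M k | k <- ks].
Proof.
move=> h; rewrite all_map; apply/allP => k /h; rewrite mem_iota add0n => hk /=.
by apply: leq_trans (M_gt2 hk).
Qed.

Lemma right_pos : all (fun m => 0 < m)%N [seq M k | k <- right_idx].
Proof. by apply: M_gt0_all => k /right_idxP[hk _ _]; rewrite mem_iota. Qed.

Lemma left_pos : all (fun m => 0 < m)%N [seq M k | k <- rev left_idx].
Proof. by apply: M_gt0_all => k; rewrite mem_rev => /left_idxP[hk _ _]; rewrite mem_iota. Qed.

Lemma size_flatten_nseq (ks : seq nat) :
  size (flatten [seq nseq (M k) (f k) | k <- ks]) = (\sum_(k <- ks) M k)%N.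
Proof.
rewrite size_flatten /shape -map_comp sumnE big_map; apply: eq_bigr => k _ /=.
by rewrite size_nseq.
Qed.

Lemma size_profile_right : size sR = a.
Proof. exact: size_flatten_nseq. Qed.

Lemma size_profile_left : size sL = a.
Proof.
by rewrite size_flatten_nseq -left_height; apply: perm_big; rewrite perm_rev.
Qed.

Lemma sorted_profile_right : sorted <=%R sR.
Proof. by rewrite profile_rightE sorted_blocks. Qed.

Lemma sorted_profile_left : sorted <=%R sL.
Proof. by rewrite profile_leftE sorted_blocks. Qed.

(** A side with [r] edges has [r] consecutive directions, hence [r - 1] ascents. The 4 makes up for
    the two sides and the two horizontal edges. *)
Lemma ascents_profile : (size (ascents sL) + size (ascents sR) + 4 = n)%N.
Proof.
rewrite profile_leftE profile_rightE !size_ascents_blocks ?right_pos ?left_pos //.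
by rewrite !size_map size_rev !size_iota; lia.
Qed.

Lemma profile_height_gt2 : (2 < a)%N.
Proof.
rewrite /profile_height -(prednK nr_gt0) /= big_cons; apply: leq_trans (leq_addr _ _).
by apply: M_gt2; lia.
Qed.

Lemma sum_flatten_nseq (ks : seq nat) :
  \sum_(x <- flatten [seq nseq (M k) (f k) | k <- ks]) x = \sum_(k <- ks) (M k)%:Z * f k.
Proof.
rewrite big_flatten big_map; apply: eq_bigr => k _.
by rewrite big_nseq iter_addr_0 -mulr_natl natz.
Qed.

Lemma psum_right : psum sR a = X 1%N - X nr.+1.
Proof.
rewrite psum_oversize ?size_profile_right // sum_flatten_nseq.
have -> : nr.+1 = (1 + nr)%N by [].
rewrite (@telescope_iota X (fun k => - ((M k)%:Z * f k)) 1) => [|k hk].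
  by rewrite sumrN opprD opprK addrA subrr add0r.
have [kn _ _] : [/\ (k < n)%N, f k = kr + k.-1%:Z & s k = 1].
  by apply: right_idxP; rewrite mem_iota.
exact: X_step.
Qed.

Lemma psum_left : psum sL a = X nr.+2 - X 0%N.
Proof.
rewrite psum_oversize ?size_profile_left // sum_flatten_nseq.
rewrite (perm_big _ (permEl (perm_rev _))) /= -X_closed.
have -> : n = (nr.+2 + nl)%N by lia.
rewrite (@telescope_iota X (fun k => - ((M k)%:Z * f k))) => [|k hk].
  by rewrite sumrN opprD opprK addrA subrr add0r.
have [kn _ _] : [/\ (k < n)%N, f k = kl - (k - nr.+2)%N%:Z & s k = -1].
  by apply: left_idxP; rewrite mem_iota.
exact: X_step.
Qed.

Lemma width_end : (M 0%N)%:Z - psum sL a - psum sR a = (M nr.+1)%:Z.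
Proof. by rewrite psum_left psum_right X_1 X_top; ring. Qed.

(** Sorted directions make the width concave in the height, so its minimum is the length of the
    bottom or of the top edge. In particular the absolute value in [profile_width] changes
    nothing. *)
Lemma width_gt2 i : (i <= a)%N -> 3 <= (M 0%N)%:Z - psum sL i - psum sR i.
Proof.
pose w j := (M 0%N)%:Z - psum sL j - psum sR j; rewrite -/(w i).
apply: (@concave_ge_min w a) => [p q pqa||].
- have pa : (p < a)%N by case/andP: pqa; apply: leq_ltn_trans.
  have qa : (q < a)%N by case/andP: pqa.
  have pq : (p <= q)%N by case/andP: pqa.
  have := sorted_nth_le sorted_profile_left pq; have := sorted_nth_le sorted_profile_right pq.
  rewrite size_profile_left size_profile_right => /(_ qa) h1 /(_ qa) h2.
  rewrite /w !psumS ?size_profile_left ?size_profile_right //.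
  by move: h1 h2; move: (psum sL p) (psum sL q) (psum sR p) (psum sR q)
    (sL`_p) (sL`_q) (sR`_p) (sR`_q) => *; lia.
- by rewrite /w !psum0; have := M_gt2 (ltn0Sn _ : (0 < n)%N); lia.
rewrite /w width_end; have h : (nr.+1 < n)%N by rewrite !ltnS leq_addr.
by have := M_gt2 h; lia.
Qed.

Lemma profile_widthE i : (i <= a)%N ->
  (W i)%:Z = (M 0%N)%:Z - psum sL i - psum sR i.
Proof. by move=> /width_gt2; rewrite /profile_width; lia. Qed.

Lemma profile_width_gt2 i : (i <= a)%N -> (2 < W i)%N.
Proof. by move=> ia; have := width_gt2 ia; rewrite -profile_widthE. Qed.

Lemma profile_width0 : W 0 = M 0%N.
Proof. by rewrite /profile_width !psum0 !subr0. Qed.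

Lemma profile_width_top : W a = M nr.+1.
Proof. by rewrite /profile_width width_end. Qed.

(** Next to the bottom the width changes by minus the first directions of the two sides, and next to
    the top by their last ones. Directions being consecutive, last minus first is the number of
    ascents of the side. *)
Lemma profile_ends_width :
  (W 1 + W a.-1 = M 0 + M nr.+1 + (size (ascents sL) + size (ascents sR)))%N.
Proof.
have a2 := profile_height_gt2.
have e1 := profile_widthE (ltnW (ltnW a2)); have e2 := profile_widthE (leq_pred a).
have e3 := profile_widthE (leqnn a); rewrite profile_width_top in e3.
have aS : a = a.-1.+1 by rewrite prednK // ltnW // ltnW.
have Lt : (a.-1 < size sL)%N by rewrite size_profile_left {2}aS.
have Rt : (a.-1 < size sR)%N by rewrite size_profile_right {2}aS.
rewrite {1 2}aS !psumS // in e3.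
have L0 : (0 < size sL)%N by apply: leq_ltn_trans Lt.
have R0 : (0 < size sR)%N by apply: leq_ltn_trans Rt.
rewrite !psumS // !psum0 !add0r in e1.
have hL : (0 < size [seq M k | k <- rev left_idx])%N by rewrite size_map size_rev size_iota.
have hR : (0 < size [seq M k | k <- right_idx])%N by rewrite size_map size_iota.
have L1 : sL`_0 = kl - nl.-1%:Z by rewrite profile_leftE head_blocks // left_pos.
have R1 : sR`_0 = kr by rewrite profile_rightE head_blocks // right_pos.
have L2 : sL`_a.-1 = kl.
  rewrite -size_profile_left nth_last profile_leftE last_blocks ?left_pos //.
  by rewrite size_map size_rev size_iota subrK.
have R2 : sR`_a.-1 = kr + nr.-1%:Z.
  by rewrite -size_profile_right nth_last profile_rightE last_blocks ?right_pos // size_map size_iota.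
have As := ascents_profile.
rewrite L1 R1 in e1; rewrite L2 R2 in e3.
move: e1 e2 e3 As; clear -nr_gt0 nl_gt0.
move: (W 1) (W a.-1) (size _) (size _) (psum sL _) (psum sR _) (M _) (M _) => *; lia.
Qed.

Lemma sum_profile_width :
  (\sum_(i <- iota 0 a) (W i + W i.+1) = 2 * width_sum a W + (M 0 + M nr.+1))%N.
Proof.
have a0 : (0 < a)%N by apply: leq_ltn_trans profile_height_gt2.
have aS : a = a.-1.+1 by rewrite prednK.
rewrite big_split /= mul2n -addnn /width_sum.
have -> : (\sum_(i <- iota 0 a) W i = M 0 + \sum_(j <- iota 1 a.-1) W j)%N.
  by rewrite {1}aS /= big_cons profile_width0.
have -> : (\sum_(i <- iota 0 a) W i.+1 = \sum_(j <- iota 1 a.-1) W j + M nr.+1)%N.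
  transitivity (\sum_(j <- iota 1 a) W j)%N; first by rewrite -[1%N]addn0 iotaDl big_map.
  by rewrite {1}aS -(addn1 a.-1) (iotaD 1 a.-1 1) big_cat big_seq1 add1n -aS profile_width_top.
by move: (\sum_(j <- _) _)%N => u; lia.
Qed.

(** Horizontal edges do not contribute; the two sides give sums of unit trapezoids, whose difference
    is the sum of the widths at consecutive heights. *)
Lemma profile_area :
  \sum_(k <- iota 0 n) (X k + X k.+1) * (Y k.+1 - Y k)
  = (2 * width_sum a W + (M 0 + M nr.+1))%N%:Z.
Proof.
rewrite iota_split big_cons big_cat big_cons /= Y_1 subrr mulr0 add0r.
have -> : Y nr.+2 - Y nr.+1 = 0.
  by rewrite Y_step ?s_top ?mulr0 ?addr0 ?subrr // !ltnS leq_addr.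
rewrite mulr0 add0r.
have -> : \sum_(k <- right_idx) (X k + X k.+1) * (Y k.+1 - Y k)
    = 2 * X 1%N * a%:Z - double_psum sR.
  rewrite -size_profile_right -trapezoidsE trapezoids_up => [|k hk]; last first.
    by rewrite X_step //; have [] := @right_idxP k; rewrite ?mem_iota.
  apply: eq_big_seq => k /right_idxP[kn _ sk]; congr (_ * _).
  by rewrite (Y_step kn) sk mulr1 addrC addKr.
have -> : \sum_(k <- left_idx) (X k + X k.+1) * (Y k.+1 - Y k)
    = - (2 * X 0%N * a%:Z) - double_psum sL.
  have := trapezoidsE M f (- X 0%N) (rev left_idx).
  rewrite /= -/sL size_profile_left => e.
  have -> : - (2 * X 0%N * a%:Z) = 2 * - X 0%N * a%:Z by ring.
  rewrite -e -X_closed.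
  have -> : n = (nr.+2 + nl)%N by lia.
  rewrite (@trapezoids_down M f (fun k => - X k)) => [|k hk]; last first.
    by rewrite X_step ?opprB ?opprK; [ring | have [] := @left_idxP k; rewrite ?mem_iota].
  apply: eq_big_seq => k /left_idxP[kn _ sk].
  by rewrite (Y_step kn) sk; ring.
rewrite -sum_profile_width PoszD_sum X_1.
have -> : \sum_(i <- iota 0 a) (W i + W i.+1)%N%:Z
    = \sum_(i <- iota 0 a) (2 * (M 0%N)%:Z - (psum sL i + psum sL i.+1) - (psum sR i + psum sR i.+1)).
  apply: eq_big_seq => i; rewrite mem_iota add0n => ia.
  by rewrite PoszD !profile_widthE ?(ltnW ia) //; ring.
rewrite !sumrB /double_psum size_profile_left size_profile_right.
rewrite big_const_seq count_predT size_iota iter_addr_0 -mulr_natr natz.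
ring.
Qed.

Lemma sum_profile : (\sum_(k <- iota 0 n) M k = 2 * a + (M 0 + M nr.+1))%N.
Proof.
rewrite iota_split big_cons big_cat big_cons /= left_height -/a; lia.
Qed.

Lemma right_idx_filter : [seq k <- iota 0 n | s k == 1] = right_idx.
Proof.
rewrite iota_split /= s_bot filter_cat /= s_top.
rewrite (@eq_in_filter _ _ predT) => [|k /right_idxP[_ _ ->]] //.
rewrite [X in _ ++ X](@eq_in_filter _ _ pred0) => [|k /left_idxP[_ _ ->]] //.
by rewrite filter_predT filter_pred0 cats0.
Qed.

Lemma left_idx_filter : [seq k <- iota 0 n | s k == -1] = left_idx.
Proof.
rewrite iota_split /= s_bot filter_cat /= s_top.
rewrite (@eq_in_filter _ _ pred0) => [|k /right_idxP[_ _ ->]] //.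
rewrite [X in _ ++ X](@eq_in_filter _ _ predT) => [|k /left_idxP[_ _ ->]] //.
by rewrite filter_predT filter_pred0.
Qed.

Variable S : nat -> int.
Hypotheses (s_rel : forall k, s k + s k.+2 = S k.+1 * s k.+1)
  (f_rel : forall k, f k + f k.+2 = S k.+1 * f k.+1).
Hypotheses (s_closed : s n = s 0) (f_closed : f n = f 0) (f_closed1 : f n.+1 = f 1).

(** Here [S k] is minus a self-intersection number. Along a side with [r] edges, the first
    coordinates of the normals make the values sum to [2 (r - 1)]. The two horizontal edges use the
    second coordinates, where [kr] and [kl] cancel and [nr + nl - 2] remains; the total is
    [3 (n - 4)]. *)
Lemma sum_self : \sum_(k <- iota 1 n) S k = 3 * (n%:Z - 4).
Proof.
have E : iota 1 n = right_idx ++ nr.+1 :: left_idx ++ [:: n].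
  have -> : n = (nr + (1 + (nl + 1)))%N by lia.
  rewrite iotaD add1n iotaD [iota nr.+1 1]/= iotaD addn1 /= /iota.
  by have -> : (nr.+2 + nl = nr + (1 + (nl + 1)))%N by lia.
have const c p r : {in iota p r, forall k, s k = c} -> \sum_(k <- iota p r) s k = c * r%:Z.
  move=> h; rewrite (eq_big_seq _ h) big_const_seq count_predT size_iota iter_addr_0.
  by rewrite -mulr_natr natz.
have ends p r c : (0 < r)%N -> s p = 0 -> s (p + r).+1 = 0 -> {in iota p.+1 r, forall k, s k = c} ->
    \sum_(k <- iota p.+1 r) (s k.-1 + s k.+1) = 2 * c * r.-1%:Z.
  move=> r0 sp sq h; rewrite big_split /=.
  have -> : \sum_(k <- iota p.+1 r) s k.-1 = \sum_(k <- iota p r) s k.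
    by rewrite -(add1n p) iotaDl big_map.
  have -> : \sum_(k <- iota p.+1 r) s k.+1 = \sum_(k <- iota p.+2 r) s k.
    by rewrite -(add1n p.+1) iotaDl big_map.
  have hr : r = r.-1.+1 by rewrite prednK.
  rewrite {1}hr [iota p _]/= big_cons sp add0r.
  rewrite {2}hr -(addn1 r.-1) iotaD big_cat big_seq1 /=.
  have -> : (p.+2 + r.-1 = (p + r).+1)%N by lia.
  rewrite sq addr0 !(const c).
  - by ring.
  - by move=> k; rewrite mem_iota => hk; apply: h; rewrite mem_iota; lia.
  by move=> k; rewrite mem_iota => hk; apply: h; rewrite mem_iota; lia.
rewrite E big_cat big_cons big_cat big_seq1 /=.
have -> : \sum_(k <- right_idx) S k = 2 * nr.-1%:Z.
  rewrite -[2]mulr1 -(ends 0%N nr 1) ?s_bot ?s_top //; last by move=> k /right_idxP[].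
  apply: eq_big_seq => k hk; have [_ _ sk] := right_idxP hk.
  by move: hk sk; rewrite mem_iota; case: k => // k _ sk; rewrite s_rel sk mulr1.
have -> : \sum_(k <- left_idx) S k = 2 * nl.-1%:Z.
  have e := ends nr.+1 nl (-1) nl_gt0 s_top.
  have h : s (nr.+1 + nl).+1 = 0 by rewrite -s_bot -s_closed; congr s; lia.
  have {}e := e h; rewrite mulrN1 mulNr in e.
  apply: oppr_inj; rewrite -e; last by move=> k /left_idxP[].
  rewrite -sumrN; apply: eq_big_seq => k hk; have [_ _ sk] := left_idxP hk.
  by move: hk sk; rewrite mem_iota; case: k => // k _ sk; rewrite s_rel sk mulrN1.
have St := f_rel nr; rewrite f_top mulr1 in St.
have Sb := f_rel (nr + nl).+1; rewrite f_closed f_bot f_closed1 mulrN1 in Sb.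
have f1 := f_right nr_gt0.
have fr : f nr = kr + nr.-1%:Z by rewrite -{1}(prednK nr_gt0) f_right // prednK.
have fl := f_left nl_gt0; rewrite addn0 in fl.
have fl' : f (nr + nl).+1 = kl - nl.-1%:Z.
  by rewrite -f_left ?prednK //; congr f; lia.
rewrite f1 fl' in Sb; rewrite fr fl in St.
move: Sb St; clear -nr_gt0 nl_gt0; move: (S _) (S _) => u v; lia.
Qed.

End Profile.

(** * Numerical invariants of the polygon of a class *)

Section BetaPolygon.
Variables (n : nat) (P : 'I_n -> int * int).
Hypotheses (convexP : convex_polygon P) (htP : h_transverse P).
Hypothesis smoothP : smooth_surface P.
Variable beta : divisor n.
Local Notation m i := (dot P beta (toric_divisor i)).
Local Notation Q := (beta_polygon P beta).
Hypothesis m_gt2 : forall i, 2 < m i.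

Variables (i0 : 'I_n) (kr kl : int) (nr nl : nat).
Hypotheses (nr_gt0 : (0 < nr)%N) (nl_gt0 : (0 < nl)%N) (nE : n = (nr + nl).+2).
Hypotheses (nu_bot : nu P i0 0 = (0, -1))
  (nu_right : forall j, (j < nr)%N -> nu P i0 j.+1 = (1, kr + j%:Z))
  (nu_top : nu P i0 nr.+1 = (0, 1))
  (nu_left : forall j, (j < nl)%N -> nu P i0 (nr.+2 + j) = (-1, kl - j%:Z)).

Let n_gt2 : (2 < n)%N. Proof. by case: convexP. Qed.
Let m_gt0 i : 0 < m i. Proof. by apply: lt_trans (m_gt2 i). Qed.

Let it k := iter k (@ordS n) i0.
Let f k := (nu P i0 k).2.
Let s k := (nu P i0 k).1.
Let M k := `|m (it k)|%N.
Let X k := (Q (it k)).1.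
Let Y k := (Q (it k)).2.

Let f_bot : f 0%N = -1. Proof. by rewrite /f nu_bot. Qed.
Let s_bot : s 0%N = 0. Proof. by rewrite /s nu_bot. Qed.
Let f_right j : (j < nr)%N -> f j.+1 = kr + j%:Z. Proof. by move=> h; rewrite /f nu_right. Qed.
Let s_right j : (j < nr)%N -> s j.+1 = 1. Proof. by move=> h; rewrite /s nu_right. Qed.
Let f_top : f nr.+1 = 1. Proof. by rewrite /f nu_top. Qed.
Let s_top : s nr.+1 = 0. Proof. by rewrite /s nu_top. Qed.
Let f_left j : (j < nl)%N -> f (nr.+2 + j)%N = kl - j%:Z.
Proof. by move=> h; rewrite /f nu_left. Qed.
Let s_left j : (j < nl)%N -> s (nr.+2 + j)%N = -1.
Proof. by move=> h; rewrite /s nu_left. Qed.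

Let it_n : it (nr + nl).+2 = i0. Proof. by rewrite /it -nE iter_ordS_size. Qed.

Let M_m k : (M k)%:Z = m (it k). Proof. by rewrite /M gez0_abs // ltW. Qed.

Let X_step k : (k < (nr + nl).+2)%N -> X k.+1 = X k - (M k)%:Z * f k.
Proof. by move=> _; rewrite M_m /X /it iterS (beta_x n_gt2 smoothP). Qed.

Let Y_step k : (k < (nr + nl).+2)%N -> Y k.+1 = Y k + (M k)%:Z * s k.
Proof. by move=> _; rewrite M_m /Y /it iterS (beta_y n_gt2 smoothP). Qed.

Let X_closed : X (nr + nl).+2 = X 0%N. Proof. by rewrite /X it_n. Qed.
Let Y_closed : Y (nr + nl).+2 = Y 0%N. Proof. by rewrite /Y it_n. Qed.

Let M_gt2 k : (k < (nr + nl).+2)%N -> (2 < M k)%N.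
Proof. by move=> _; have := m_gt2 (it k); rewrite -M_m. Qed.

Let a := profile_height nr M.
Let sR := profile_right nr M f.
Let sL := profile_left nr nl M f.
Let W := profile_width nr nl M f.

Let sum_it (F : 'I_n -> int) : \sum_i F i = \sum_(k <- iota 0 (nr + nl).+2) F (it k).
Proof.
rewrite -nE -(big_map it xpredT F) (perm_big _ (perm_iter_ordS i0)) /=.
by rewrite big_enum.
Qed.

Let itP i : exists2 k, (k < (nr + nl).+2)%N & i = it k.
Proof.
have : i \in enum 'I_n by rewrite mem_enum.
rewrite -(perm_mem (perm_iter_ordS i0)) => /mapP[k hk ->]; exists k => //.
by move: hk; rewrite mem_iota -nE.
Qed.

Lemma beta_height : height Q = a.
Proof.
have bounds := Y_bounds nr_gt0 nl_gt0 f_bot s_bot f_right s_right f_top s_top f_left s_left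
  Y_step X_closed Y_closed.
have top := Y_top nr_gt0 nl_gt0 f_bot s_bot f_right s_right f_top s_top Y_step X_closed Y_closed.
apply/eqP; rewrite eqn_leq; apply/andP; split.
  apply/bigmax_leqP => i _; apply/bigmax_leqP => j _.
  have [k hk ->] := itP i; have [l hl ->] := itP j.
  have := bounds _ hk; have := bounds _ hl; rewrite /Y -/a; lia.
apply: (bigop.bigmax_sup (it nr.+1)) => //; apply: (bigop.bigmax_sup (it 0)) => //.
by rewrite -/(Y nr.+1) -/(Y 0) top -/a; lia.
Qed.

Let beta_end (v : int * int) k : nu P i0 k = v ->
  (\sum_(i < n | normal Q i == v) edge_len Q i)%N = M k.
Proof.
move=> e; rewrite (big_pred1 (it k)) => [|i]; first exact: (beta_edge_len n_gt2 smoothP _ htP).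
by rewrite (beta_normal n_gt2 smoothP htP m_gt0) -e (inj_eq (normal_inj convexP)).
Qed.

Lemma beta_bbot : bbot Q = M 0%N. Proof. exact: beta_end nu_bot. Qed.

Lemma beta_btop : btop Q = M nr.+1. Proof. exact: beta_end nu_top. Qed.

Let beta_bside (x : int) : perm_eq (bside Q x)
  (flatten [seq nseq (M k) (f k) | k <- iota 0 (nr + nl).+2 & s k == x]).
Proof.
apply: perm_flatten.
rewrite (eq_map (g := fun i => nseq `|m i| (normal P i).2)) => [|i]; last first.
  by rewrite (beta_edge_len n_gt2 smoothP _ htP) (beta_normal n_gt2 smoothP htP m_gt0).
rewrite (eq_filter (a2 := fun i => (normal P i).1 == x)) => [|i]; last first.
  by rewrite (beta_normal n_gt2 smoothP htP m_gt0).
rewrite -nE (map_comp (fun i => nseq `|m i| (normal P i).2) it).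
rewrite -(filter_map it (fun i => (normal P i).1 == x)).
by rewrite perm_sym; apply/perm_map/perm_filter/perm_iter_ordS.
Qed.

Lemma beta_bright : perm_eq (bright Q) sR.
Proof.
apply: perm_trans (beta_bside 1) _.
by rewrite (right_idx_filter nr_gt0 nl_gt0 f_bot s_bot f_right s_right f_top s_top f_left s_left
  X_closed Y_closed).
Qed.

Lemma beta_bleft : perm_eq (bleft Q) sL.
Proof.
apply: perm_trans (beta_bside (-1)) _.
rewrite (left_idx_filter nr_gt0 nl_gt0 f_bot s_bot f_right s_right f_top s_top f_left s_left
  X_closed Y_closed).
by apply/perm_flatten/perm_map; rewrite perm_sym perm_rev.
Qed.

(** The two formulas for the area differ by a cyclic sum of differences of products of coordinates,
    which telescopes to 0. *)
Lemma double_area_green (R : 'I_n -> int * int) :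
  double_area R = \sum_i ((R i).1 + (R (ordS i)).1) * ((R (ordS i)).2 - (R i).2).
Proof.
have z := ordS_sum (fun i => (R i).1 * (R i).2).
transitivity (double_area R + (\sum_i (R (ordS i)).1 * (R (ordS i)).2 - \sum_i (R i).1 * (R i).2)).
  by rewrite z subrr addr0.
rewrite /double_area -sumrB -big_split; apply: eq_bigr => i _; rewrite /det /=; ring.
Qed.

Lemma beta_area : double_area Q = (2 * width_sum a W + (M 0 + M nr.+1))%N%:Z.
Proof.
rewrite double_area_green sum_it.
by rewrite -(profile_area nr_gt0 nl_gt0 f_bot s_bot f_right s_right f_top s_top f_left s_left
  X_step Y_step X_closed Y_closed M_gt2).
Qed.

Lemma canonical_beta : dot P (canonical (n := n)) beta = - (2 * a + (M 0 + M nr.+1))%N%:Z.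
Proof.
rewrite dotC dotE sum_it.
rewrite -(sum_profile nr_gt0 nl_gt0 f_bot s_bot f_right s_right f_top s_top f_left s_left
  Y_step X_closed Y_closed) PoszD_sum -sumrN.
by apply: eq_bigr => k _; rewrite M_m mulN1r.
Qed.

(** The term of [K^2] at the i-th divisor is 2 plus its self-intersection number, so [sum_self]
    gives [2 n - 3 (n - 4)]. *)
Lemma noether : dot P (canonical (n := n)) (canonical (n := n)) = 12 - n%:Z.
Proof.
pose S k := det (normal P (ord_pred (it k))) (normal P (ordS (it k))).
have pk k : ord_pred (it k.+1) = it k by exact: ordSK.
have rel k := normal_relation smoothP (it k.+1).
have s_rel k : s k + s k.+2 = S k.+1 * s k.+1.
  by have [h _] := rel k; rewrite /S pk; rewrite pk in h.
have f_rel k : f k + f k.+2 = S k.+1 * f k.+1.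
  by have [_ h] := rel k; rewrite /S pk; rewrite pk in h.
have nu_n : nu P i0 (nr + nl).+2 = nu P i0 0 by rewrite /nu -/(it _) it_n.
have nu_n1 : nu P i0 (nr + nl).+3 = nu P i0 1 by rewrite /nu iterS -/(it _) it_n.
have sS := sum_self nr_gt0 nl_gt0 f_bot s_bot f_right s_right f_top s_top f_left s_left
  X_closed Y_closed s_rel f_rel (congr1 fst nu_n) (congr1 snd nu_n) (congr1 snd nu_n1).
have -> : dot P (canonical (n := n)) (canonical (n := n))
    = \sum_i (2 - det (normal P (ord_pred i)) (normal P (ordS i))).
  by rewrite dotE; apply: eq_bigr => i _; rewrite (dot_toric P n_gt2) /canonical; ring.
rewrite -ordS_sum sum_it sumrB big_const_seq count_predT size_iota iter_addr_0.
have -> : \sum_(k <- iota 0 (nr + nl).+2)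
    det (normal P (ord_pred (ordS (it k)))) (normal P (ordS (ordS (it k))))
    = 3 * ((nr + nl).+2%:Z - 4).
  by rewrite -sS -(addn0 1%N) iotaDl big_map.
by rewrite -mulr_natr natz nE; lia.
Qed.

Let ascents_nE : (size (ascents sL) + size (ascents sR) + 4 = n)%N.
Proof.
rewrite nE; exact: (ascents_profile nr_gt0 nl_gt0 f_bot s_bot f_right s_right f_top s_top
  f_left s_left X_closed Y_closed M_gt2).
Qed.

Lemma beta_coef1 g : exists2 p : {poly int}, is_BGtilde Q g p & (p`_1)%:~R = AR1_series P beta g.
Proof.
have a2 : (2 < a)%N := profile_height_gt2 nr_gt0 nl_gt0 f_bot s_bot f_top s_top X_closed Y_closed M_gt2.
have szL : size sL = a := size_profile_left nr_gt0 nl_gt0 f_bot s_bot f_right s_right f_top s_top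
  f_left s_left Y_step X_closed Y_closed.
have szR : size sR = a := size_profile_right nr M f.
have stL : sorted <=%R sL := sorted_profile_left M nr_gt0 nl_gt0 f_bot s_bot f_top s_top f_left
  X_closed Y_closed.
have stR : sorted <=%R sR := sorted_profile_right M f_right.
have WE i (ia : (i <= a)%N) : (W i)%:Z = (M 0%N)%:Z - psum sL i - psum sR i :=
  profile_widthE nr_gt0 nl_gt0 f_bot s_bot f_right s_right f_top s_top f_left s_left
  X_step Y_step X_closed Y_closed M_gt2 ia.
have W2 i (ia : (i <= a)%N) : (2 < W i)%N :=
  profile_width_gt2 nr_gt0 nl_gt0 f_bot s_bot f_right s_right f_top s_top f_left s_left
  X_step Y_step X_closed Y_closed M_gt2 ia.
have W0 : W 0 = M 0%N := profile_width0 nr nl M f.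
have Wa : W a = M nr.+1 := profile_width_top nr_gt0 nl_gt0 f_bot s_bot f_right s_right f_top s_top
  f_left s_left X_step Y_step X_closed Y_closed.
have We := profile_ends_width nr_gt0 nl_gt0 f_bot s_bot f_right s_right f_top s_top
  f_left s_left X_step Y_step X_closed Y_closed M_gt2.
have [p hp p1] := BGtilde_coef1 g beta_height beta_btop beta_bbot beta_bleft beta_bright beta_area
  a2 szL szR stL stR WE Wa W2.
exists p => //; rewrite p1 (low_total_coefE a2 szL szR W0 Wa W2 We) AR1_seriesE.
have ws := width_sum_exponent a2 szL szR W0 Wa W2 We.
have bb := beta_double_area n_gt2 smoothP beta; rewrite beta_area in bb.
(* This is the formula of Pick: twice the area minus the perimeter is twice [exponent a W - 1],
   because the contributions of the horizontal edges cancel. *)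
have gm : g_max P beta = (exponent a W)%:R.
  rewrite /g_max (dotC P beta) canonical_beta -bb.
  have -> : (2 * width_sum a W + (M 0 + M nr.+1))%N%:Z - (2 * a + (M 0 + M nr.+1))%N%:Z
    = 2 * ((exponent a W)%:Z - 1) by rewrite ws; move: (exponent a W) (M _) (M _) a2 => *; lia.
  rewrite rmorphM rmorphB /= mulrAC divff // mul1r addrC subrK //.
rewrite /= gm -bb canonical_beta noether.
have -> : euler_char n = (size (ascents sL) + size (ascents sR) + 4)%N%:Z by rewrite ascents_nE.
have -> : 12 - n%:Z = 8 - (size (ascents sL) + size (ascents sR))%N%:Z.
  by rewrite -ascents_nE; lia.
rewrite -!pmulrn rmorphN rmorphB /= -!pmulrn.
rewrite natrM; ring.
Qed.

End BetaPolygon.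

(** * The universal polynomials *)

Section UniversalPolynomial.

(** The binomial coefficient is a polynomial in its upper entry, so each coefficient of the series
    is one in the four invariants, for all surfaces at once. *)
Definition bin_mpoly (m : {mpoly rat[4]}) (k : nat) : {mpoly rat[4]} :=
  (k`!%:R^-1)%:MP * \prod_(j < k) (m - j%:R%:MP).

Lemma bin_mpolyE v m k : (bin_mpoly m k).@[v] = one_plus_u m.@[v] k.
Proof.
rewrite /bin_mpoly mevalM mevalC mulrC rmorph_prod /=; congr (_ * _).
by apply: eq_bigr => j _; rewrite mevalB mevalC.
Qed.

(* The variables stand for beta^2, K.beta, chi and K^2, in this order. *)
Definition AR1_mpoly (k : nat) : {mpoly rat[4]} :=
  let X (j : nat) : {mpoly rat[4]} := 'X_(inord j) in
  let gm := 1 + (2^-1)%:MP * (X 0%N + X 1%N) in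
  let term (j : nat) m := if (k < j)%N then 0 else bin_mpoly (gm - m%:R%:MP) (k - j) in
  - X 0%N * term 3%N 3%N + 2%:R%:MP * X 1%N * term 2%N 3%N + X 2%N * term 0%N 1%N - X 3%N * term 1%N 3%N.

Lemma AR1_mpolyE n (P : 'I_n -> int * int) beta k :
  (AR1_mpoly k).@[invariants P beta] = AR1_series P beta k.
Proof.
rewrite AR1_seriesE /AR1_mpoly; move: bin_mpolyE; move: bin_mpoly => bin binE /=.
have inv (j : nat) (hj : (j < 4)%N) : (('X_(inord j) : {mpoly rat[4]})).@[invariants P beta]
    = nth 0 [:: (dot P beta beta)%:~R; (dot P (canonical (n := n)) beta)%:~R;
              (euler_char n)%:~R; (dot P (canonical (n := n)) (canonical (n := n)))%:~R] j.
  by rewrite mevalXU /invariants (tnth_nth 0) /= inordK.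
have gmE (m : nat) : (1 + (2^-1)%:MP * ('X_(inord 0) + 'X_(inord 1)) - m%:R%:MP
     : {mpoly rat[4]}).@[invariants P beta] = g_max P beta - m%:R.
  rewrite mevalB mevalD meval1 mevalM mevalD !mevalC !inv //=.
  by rewrite /g_max (dotC P beta (canonical (n := n))) intrD mulrC.
have termE (j m : nat) : (if (k < j)%N then 0 else bin
      (1 + (2^-1)%:MP * ('X_(inord 0) + 'X_(inord 1)) - m%:R%:MP) (k - j)%N).@[invariants P beta]
    = if (k < j)%N then 0 else one_plus_u (g_max P beta - m%:R) (k - j).
  by case: ifP => _; rewrite ?meval0 // binE gmE.
by rewrite mevalB !mevalD !mevalM mevalN mevalC !termE binE gmE !inv.
Qed.

Variables (n : nat) (P : 'I_n -> int * int).
Hypotheses (n_gt2 : (2 < n)%N) (smoothP : smooth_surface P).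

Definition dot_mpoly (c d : 'I_n -> {mpoly rat[n]}) : {mpoly rat[n]} :=
  \sum_(i < n) \sum_(j < n) c i * d j * ((inter P i j)%:~R)%:MP.

Lemma dot_mpolyE v (c d : divisor n) (p q : 'I_n -> {mpoly rat[n]}) :
  (forall i, (p i).@[v] = (c i)%:~R) -> (forall i, (q i).@[v] = (d i)%:~R) ->
  (dot_mpoly p q).@[v] = (dot P c d)%:~R.
Proof.
move=> hp hq; rewrite /dot_mpoly /dot raddf_sum rmorph_sum; apply: eq_bigr => i _.
rewrite raddf_sum rmorph_sum; apply: eq_bigr => j _ /=.
by rewrite !mevalM mevalC hp hq !intrM.
Qed.

Lemma polynomial_function_invariants (A : {mpoly rat[4]}) :
  polynomial_function P (fun beta => A.@[invariants P beta]).
Proof.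
split=> [c c' cc|].
  have r := lin_equiv_refl P (canonical (n := n)).
  by rewrite /invariants (dot_lin_equiv2 n_gt2 smoothP cc cc) (dot_lin_equiv2 n_gt2 smoothP r cc).
pose X (i : 'I_n) : {mpoly rat[n]} := 'X_i.
pose K (i : 'I_n) : {mpoly rat[n]} := (-1)%:MP.
exists (A \mPo [tuple dot_mpoly X X; dot_mpoly K X; ((euler_char n)%:~R)%:MP; dot_mpoly K K]) => c.
rewrite comp_mpoly_meval; apply: meval_eq => i.
have hX j : (X j).@[fun i => (c i)%:~R] = (c j)%:~R by rewrite mevalXU.
have hK j : (K j).@[fun i => (c i)%:~R] = (canonical (n := n) j)%:~R by rewrite mevalC /canonical mulrN1z.
rewrite /invariants !(tnth_nth 0) /=.
by case: i => [[|[|[|[|//]]]] hi] /=;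
  rewrite ?(dot_mpolyE hX hX) ?(dot_mpolyE hK hX) ?(dot_mpolyE hK hK) ?mevalC.
Qed.

End UniversalPolynomial.

Theorem theorem3p2 :
  exists AR : nat -> {mpoly rat[4]},
  forall (n : nat) (P : 'I_n -> int * int),
    convex_polygon P -> h_transverse P -> horizontal P -> smooth_surface P ->
    (forall g : nat,
       asymptotic_polynomial P g 1 (fun beta => (AR g).@[invariants P beta])) /\
    (forall (beta : divisor n) (g : nat),
       (AR g).@[invariants P beta] = AR1_series P beta g).
Proof.
exists AR1_mpoly => n P convexP htP horP smoothP; split=> [g|beta g]; last exact: AR1_mpolyE.
have n_gt2 : (2 < n)%N by case: convexP.
split; first exact: polynomial_function_invariants.
(* The same constant 3 works for every [g]: edges of lattice length at least 3 make all widths at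
   least 3. *)
exists 3 => // beta m_gt2; have [_ [i0 bot0]] := horP.
have [kr [kl [nr [nl [nr_gt0 nl_gt0 nE [nu_bot nu_right nu_top nu_left]]]]]] :=
  nu_structure convexP smoothP htP horP bot0.
rewrite AR1_mpolyE.
exact: (beta_coef1 convexP htP smoothP m_gt2 nr_gt0 nl_gt0 nE nu_bot nu_right nu_top nu_left).
Qed.
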